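(* Let $\Omega=\Omega_D$ be an open circular domain in $\mathbb{H}$. If $f:\Omega\to\mathbb{H}$ is slice-regular, then: (a) The spherical derivative $f'_s$ is harmonic on $\Omega$ (i.e. its four real components are harmonic). (b) $\overline\partial_{CRF}\Delta_4f=\Delta_4\overline\partial_{CRF}f=-2\Delta_4f'_s=0$. As a consequence, $\Delta_4^2f=0$: every quaternionic slice-regular function is biharmonic. (c) $\Delta_4f=-4\,\dfrac{\partial f'_s}{\partial x}$. In particular, $\dfrac{\partial f'_s}{\partial x}$ is harmonic on $\Omega$.
   Context: $\mathbb{H}\simeq\mathbb{R}^4$ is the algebra of quaternions $x=x_0+x_1i+x_2j+x_3k$, with conjugation $\overline x=x_0-x_1i-x_2j-x_3k$, $\operatorname{Im}(x)=x_1i+x_2j+x_3k$, and $\mathbb{S}_{\mathbb{H}}=\{J\in\mathbb{H}:J^2=-1\}$. For $D\subseteq\mathbb{C}$ invariant under complex conjugation, $\Omega_D=\{\alpha+J\beta:\alpha+\sqrt{-1}\,\beta\in D,\ J\in\mathbb{S}_{\mathbb{H}}\}$ (circular set). A stem function on $D$ is a map $F=F_1+\imath F_2:D\to\mathbb{H}\otimes_{\mathbb{R}}\mathbb{C}$ ($F_1,F_2$ being $\mathbb{H}$-valued, $\imath^2=-1$) with $F(\overline z)=\overline{F(z)}$, where $\overline{a+\imath b}=a-\imath b$ for $a,b\in\mathbb{H}$. It induces the (left) slice function $f=\mathcal{I}(F):\Omega_D\to\mathbb{H}$, $f(\alpha+J\beta)=F_1(z)+JF_2(z)$, $z=\alpha+\sqrt{-1}\,\beta$;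 $f$ is slice-regular if $F$ is holomorphic (with respect to the complex structure given by $\imath$). The spherical derivative of $f$ is $f'_s(x)=\frac12\operatorname{Im}(x)^{-1}(f(x)-f(\overline x))$ for $x\notin\mathbb{R}$; it is a slice function (induced by $\beta^{-1}F_2(\alpha,\beta)$), and for $f$ slice-regular it extends real-analytically to the real points of $\Omega$. The slice derivative of a $\mathcal{C}^1$ slice function $g=\mathcal{I}(G)$ is $\frac{\partial g}{\partial x}=\mathcal{I}\left(\frac{\partial G}{\partial z}\right)$ with $\frac{\partial}{\partial z}=\frac12\left(\frac{\partial}{\partial\alpha}-\imath\frac{\partial}{\partial\beta}\right)$. $\overline\partial_{CRF}=\frac{\partial}{\partial x_0}+i\frac{\partial}{\partial x_1}+j\frac{\partial}{\partial x_2}+k\frac{\partial}{\partial x_3}$ and $\Delta_4=\sum_{l=0}^3\partial^2/\partial x_l^2$. *)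

(* Defs.v *)
From HB Require Import structures.
From mathcomp Require Import all_boot all_order all_algebra.
From mathcomp Require Import all_classical all_reals all_analysis.
Set Implicit Arguments.
Unset Strict Implicit.
Unset Printing Implicit Defensive.
Import Order.TTheory GRing.Theory Num.Theory.
Import numFieldNormedType.Exports.
Local Open Scope classical_set_scope.
Local Open Scope ring_scope.

(** Quaternions x0 + x1 i + x2 j + x3 k are the row vectors (x0, x1, x2, x3);
    this provides the real vector space structure and the topology of R^4. *)
Notation quat R := 'rV[R]_4.

(** A complex number alpha + sqrt(-1) beta is the pair (alpha, beta), so that
    the real partial derivatives d/dalpha and d/dbeta are directional
    derivatives in a real normed space. *)
Notation cplx R := (R * R)%type.

(** An element a + imath b of the tensor product of H and C over the reals is
    the pair (a, b) of quaternions. *)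
Notation cquat R := (quat R * quat R)%type.

Section Quaternions.
Context {R : realType}.
Implicit Types x y : quat R.

Definition mkq (a b c d : R) : quat R := \row_(l < 4) [:: a; b; c; d]`_l.

Definition qone : quat R := mkq 1 0 0 0.
Definition qi : quat R := mkq 0 1 0 0.
Definition qj : quat R := mkq 0 0 1 0.
Definition qk : quat R := mkq 0 0 0 1.

Definition qmul x y : quat R := mkq
  (x 0 0 * y 0 0 - x 0 1 * y 0 1 - x 0 2 * y 0 2 - x 0 3 * y 0 3)
  (x 0 0 * y 0 1 + x 0 1 * y 0 0 + x 0 2 * y 0 3 - x 0 3 * y 0 2)
  (x 0 0 * y 0 2 - x 0 1 * y 0 3 + x 0 2 * y 0 0 + x 0 3 * y 0 1)
  (x 0 0 * y 0 3 + x 0 1 * y 0 2 - x 0 2 * y 0 1 + x 0 3 * y 0 0).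

Definition qconj x : quat R := mkq (x 0 0) (- x 0 1) (- x 0 2) (- x 0 3).
Definition qIm x : quat R := mkq 0 (x 0 1) (x 0 2) (x 0 3).
Definition qinv x : quat R := (\sum_(l < 4) x 0 l ^+ 2)^-1 *: qconj x.

Definition qsphere : set (quat R) := [set J | qmul J J = - qone].

(** alpha + J beta, for z = alpha + sqrt(-1) beta *)
Definition qpoint (z : cplx R) (J : quat R) : quat R :=
  z.1 *: qone + z.2 *: J.

Definition circular (D : set (cplx R)) : set (quat R) :=
  [set x | exists z J, [/\ D z, qsphere J & x = qpoint z J]].

End Quaternions.

Section Differentiation.
Context {R : realType}.

(** Class C^k on an open set U: the iterated directional derivatives of order
    at most k, in all directions, exist and are continuous on U. *)
Fixpoint Ck {V W : normedModType R} (k : nat) (U : set V) (g : V -> W) : Prop :=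
  (forall x, U x -> {for x, continuous g}) /\
  (if k is k'.+1 then
     forall v, (forall x, U x -> derivable g x v) /\ Ck k' U ('D_v g)
   else True).

Context {W : normedModType R}.
Implicit Types g : quat R -> W.

Definition partial (l : 'I_4) g : quat R -> W := 'D_(delta_mx 0 l) g.

Definition laplacian g : quat R -> W :=
  fun x => \sum_(l < 4) partial l (partial l g) x.

End Differentiation.

Section SliceFunctions.
Context {R : realType}.
Implicit Types (D : set (cplx R)) (F G : cplx R -> cquat R).
Implicit Types (f g h : quat R -> quat R) (Omega : set (quat R)).

Definition cconj (z : cplx R) : cplx R := (z.1, - z.2).
Definition cqconj (w : cquat R) : cquat R := (w.1, - w.2).

Definition cmuli (z : cplx R) : cplx R := (- z.2, z.1).
Definition cqmuli (w : cquat R) : cquat R := (- w.2, w.1).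

Definition stem D F : Prop := forall z, D z -> F (cconj z) = cqconj (F z).

Definition induces D F f : Prop := forall z J, D z -> qsphere J ->
  f (qpoint z J) = (F z).1 + qmul J (F z).2.

(** Differentiability at every point, with a differential that is linear for
    the complex structures of C and of the complexified quaternions. *)
Definition holomorphic D F : Prop := forall z, D z ->
  differentiable F z /\
  forall v : cplx R, 'd F z (cmuli v) = cqmuli ('d F z v).

Definition slice_regular D f : Prop :=
  exists F, [/\ stem D F, holomorphic D F & induces D F f].

Definition stem_dz G : cplx R -> cquat R := fun z =>
  2^-1 *: ('D_((1, 0) : cplx R) G z - cqmuli ('D_((0, 1) : cplx R) G z)).

(** [h] is the slice derivative of [g] on the circular set of [D]. The values
    of [g] determine the stem function [G] on [D], and hence [h] on the circular
    set when [D] is open. *)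
Definition is_slice_derivative D g h : Prop :=
  exists G, [/\ stem D G, Ck 1 D G, induces D G g & induces D (stem_dz G) h].

Definition spherical_quotient f : quat R -> quat R := fun x =>
  2^-1 *: qmul (qinv (qIm x)) (f x - f (qconj x)).

(** At a real point, the value of the extension by continuity, i.e. the limit
    along the non-real points. *)
Definition spherical_derivative f : quat R -> quat R := fun x =>
  if qIm x == 0
  then lim (spherical_quotient f @ within [set y | qIm y != 0] (nbhs x))
  else spherical_quotient f x.

Definition crf g : quat R -> quat R := fun x =>
  partial 0 g x + qmul qi (partial 1 g x)
  + qmul qj (partial 2 g x) + qmul qk (partial 3 g x).

Definition component (l : 'I_4) g : quat R -> R := fun x => g x 0 l.

Definition harmonic_on Omega g : Prop := forall l : 'I_4,
  Ck 2 Omega (component l g) /\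
  forall x, Omega x -> laplacian (component l g) x = 0.

Definition biharmonic_on Omega g : Prop := forall l : 'I_4,
  Ck 4 Omega (component l g) /\
  forall x, Omega x -> laplacian (laplacian (component l g)) x = 0.

End SliceFunctions.

(* Main.v *)
Require Import Defs.
From HB Require Import structures.
From mathcomp Require Import all_boot all_order all_algebra.
From mathcomp Require Import all_classical all_reals all_analysis.
From mathcomp Require Import ring lra.
Import Order.TTheory GRing.Theory Num.Theory.
Import numFieldNormedType.Exports.
Local Open Scope classical_set_scope.
Local Open Scope ring_scope.
Set Implicit Arguments.
Unset Strict Implicit.
Unset Printing Implicit Defensive.

(** Everything is reduced to the four complex coordinates [u + i v] of the stem
    function [F], which are ordinary holomorphic functions of
    [z = alpha + i beta] with [u] even and [v] odd in [beta]. With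
    [beta = |Im x|], put [V = u(x0, beta)] and [S = v(x0, beta) / beta]. Then
    [f = V + Im(x) S] (coordinatewise for [V] and [S]), and [S] is the spherical
    derivative of [f].

    Smoothness. Holomorphy is given as mere complex differentiability. Goursat's
    bisection ([bisection], [closed_form_rectangle]), applied in polar
    coordinates, yields Cauchy's integral for the derivative
    ([cauchy_derivative]), and differentiating it under the integral sign shows
    that the derivative is again holomorphic ([CR_derive]). The derivatives of
    [V] and [S] are expressed by the same functions of the derived stem pair
    ([sph_value_derive], [sph_deriv_derive]), which gives all orders of
    regularity by induction, except that the formula for [S] divides by
    [beta]. Near the real axis this is avoided by
    [S(x) = int_0^1 V'(x0 + t Im(x)) dt], where [V'] is the spherical value of the
    derived pair ([sph_deriv_mean], [Ck_sph]).

    Harmonicity. The Laplacian of a function [s(x0, beta)] is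
    [s_aa + s_bb + 2 s_b / beta]. For [s = v / beta] this is
    [(v_aa + v_bb) / beta = 0], and for [s = u] it is
    [2 u_b / beta = - 2 v_a / beta], so that [S] is harmonic and
    [Delta V = - 2 dS/dx0] ([sph_deriv_harmonic], [laplacian_sph_value]). All
    pointwise identities are computed off the real axis and extended by
    continuity ([nonreal_dense]).

    Consequences. [Delta (x_i S) = 2 dS/dx_i] gives
    [Delta f = - 2 (dS/dx0 - i dS/dx1 - j dS/dx2 - k dS/dx3)]
    ([laplacian_slice_coord]); this is a combination of derivatives of
    harmonic functions, so [Delta^2 f = 0]. The Cauchy-Riemann equations give
    [crf f = - 2 S] ([crf_slice]). Finally [S] depends only on [(x0, beta)], so
    that its stem function is [(S, 0)] and its slice derivative at
    [alpha + J beta] is [(S_a - J S_b) / 2], which is [- Delta f / 4]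
    ([laplacian_qpoint], [stem_dzE]); the stem function is unique
    ([stem_unique]), whence the statement for every slice derivative. *)

(** * Integrals of continuous functions over a segment *)

Section Integrals.
Context {R : realType}.
Local Notation mu := (@lebesgue_measure R).
Implicit Types (a b c m M : R) (phi psi : R -> R).

(** Continuity in the ambient line at each point of the segment, and not only
    relative to the segment: this form passes directly to sub-segments and to
    sections of functions of two variables. *)
Definition cont_on a b phi := forall x, a <= x <= b -> {for x, continuous phi}.

Definition integ a b phi : R := \int[mu]_(x in `[a, b]) phi x.

Lemma cont_on_integrable a b phi :
  cont_on a b phi -> mu.-integrable `[a, b] (EFin \o phi).
Proof.
move=> cphi; apply: continuous_compact_integrable; first exact: segment_compact.
apply: continuous_in_subspaceT => x; rewrite inE/= in_itv/= => xab.
exact: cphi.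
Qed.

(** The comparison with an arbitrary constant [m], rather than with [0], is what
    both the local estimate of Goursat's theorem and the limit of circular means
    consume. *)
Lemma integ_bound a b m M phi : a <= b -> cont_on a b phi ->
  (forall x, a <= x <= b -> `|phi x - m| <= M) ->
  `|integ a b phi - m * (b - a)| <= M * (b - a).
Proof.
move=> ab cphi bphi.
have len (r : R) : \int[mu]_(x in `[a, b]) r = r * (b - a).
  have E : fine (mu `[a, b]) = b - a.
    rewrite lebesgue_measure_itv/= lte_fin.
    by case: ltgtP ab => //= ->; rewrite subrr.
  by rewrite -E; exact: Rintegral_cst.
have ccst (r : R) : mu.-integrable `[a, b] (EFin \o (fun=> r)).
  by apply: cont_on_integrable => x _; exact: cvg_cst.
have cB : cont_on a b (fun x => phi x - m).
  by move=> x xab; apply: cvgB; [exact: cphi|exact: cvg_cst].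
rewrite /integ -(len m) -RintegralB//; last exact: cont_on_integrable.
apply: le_trans (le_normr_Rintegral _ _) _ => //; first exact: cont_on_integrable.
rewrite -(len M); apply: le_Rintegral => //.
  apply: cont_on_integrable => x xab.
  exact: cvg_norm (cB x xab).
Qed.

Lemma integ_split a b c phi : a <= b -> b <= c -> cont_on a c phi ->
  integ a c phi = integ a b phi + integ b c phi.
Proof.
move=> ab bc cphi.
have ic := cont_on_integrable cphi.
have := @Rintegral_itvB _ phi (BLeft a) (BRight c) b ic.
rewrite !bnd_simp => /(_ ab bc) H.
have ibc : mu.-integrable `]b, c] (EFin \o phi).
  by apply: integrableS ic => //; apply: subset_itvr; rewrite bnd_simp.
have := Rintegral_itv_obnd_cbnd ibc; rewrite /integ => <-.
by rewrite -H addrC subrK.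
Qed.

Lemma integD a b phi psi : cont_on a b phi -> cont_on a b psi ->
  integ a b (fun x => phi x + psi x) = integ a b phi + integ a b psi.
Proof. by move=> cp cq; apply: RintegralD => //; exact: cont_on_integrable. Qed.

Lemma integB a b phi psi : cont_on a b phi -> cont_on a b psi ->
  integ a b (fun x => phi x - psi x) = integ a b phi - integ a b psi.
Proof. by move=> cp cq; apply: RintegralB => //; exact: cont_on_integrable. Qed.

Lemma integZ a b (k : R) phi : cont_on a b phi ->
  integ a b (fun x => k * phi x) = k * integ a b phi.
Proof. by move=> cp; apply: RintegralZl => //; exact: cont_on_integrable. Qed.

Lemma eq_integ a b phi psi : (forall x, a <= x <= b -> phi x = psi x) ->
  integ a b phi = integ a b psi.
Proof. by move=> e; apply: eq_Rintegral => x; rewrite inE/= in_itv/= => /e. Qed.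

Lemma integ_FTC a b phi Phi : a <= b -> cont_on a b phi ->
  (forall x, a <= x <= b -> is_derive x 1 Phi (phi x)) ->
  integ a b phi = Phi b - Phi a.
Proof.
rewrite le_eqVlt => /predU1P[->|ab] cphi dPhi.
  by rewrite subrr /integ set_itv1 Rintegral_set1.
have cPhi x : a <= x <= b -> {for x, continuous Phi}.
  by move=> /dPhi d; apply/differentiable_continuous/derivable1_diffP.
rewrite /integ /Rintegral (@continuous_FTC2 _ phi Phi)//=.
- apply: continuous_in_subspaceT => x; rewrite inE/= in_itv/=; exact: cphi.
- split.
  + move=> x; rewrite in_itv/= => /andP[ax xb].
    by have [] := dPhi x _; rewrite ?(ltW ax) ?(ltW xb).
  + by apply/cvg_at_right_filter/cPhi; rewrite lexx ltW.
  + by apply/cvg_at_left_filter/cPhi; rewrite lexx ltW.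
- move=> x; rewrite in_itv/= => /andP[ax xb].
  by rewrite derive1E; have [] := dPhi x _; rewrite ?(ltW ax) ?(ltW xb).
Qed.

End Integrals.

(** * Mean value theorem and total differentials *)

Section EpsilonDelta.
Context {R : realType}.
Implicit Types V W : normedModType R.

Lemma contP V W (f : V -> W) x : {for x, continuous f} <->
  forall e, 0 < e -> exists2 d, 0 < d & forall y, `|y - x| < d -> `|f y - f x| < e.
Proof.
split=> [/cvgrPdist_lt cf e e0|cf].
  have /nbhs_normP[d /= d0 dP] := cf _ e0; exists d => // y yx.
  by rewrite distrC; apply: dP; rewrite /ball_/= distrC.
apply/cvgrPdist_lt => e e0; have [d d0 dP] := cf _ e0.
apply/nbhs_normP; exists d => //= y; rewrite /ball_/= distrC => /dP.
by rewrite distrC.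
Qed.

Lemma open_normP V (U : set V) x : open U -> U x ->
  exists2 d, 0 < d & forall y, `|y - x| < d -> U y.
Proof.
rewrite openE => oU /oU /nbhs_normP[d /= d0 dP]; exists d => // y yx.
by apply: dP; rewrite /ball_/= distrC.
Qed.

Lemma is_deriveP V W (f : V -> W) x v l : is_derive x v f l <->
  forall e, 0 < e -> exists2 d, 0 < d & forall h : R, h != 0 -> `|h| < d ->
    `|h^-1 *: (f (x + h *: v) - f x) - l| < e.
Proof.
have -> : is_derive x v f l <->
    (fun h : R => h^-1 *: (f (h *: v + x) - f x)) @ 0^' --> l.
  split=> [[df dv]|df]; first by rewrite -dv; exact: df.
  by apply: DeriveDef; [apply/cvg_ex; exists l|exact: cvg_lim df].
split=> [/cvgrPdist_lt df e e0|df].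
  have := df _ e0; rewrite near_withinE => /nbhs_normP[d /= d0 dP]; exists d => // h h0 hd.
  by rewrite distrC [x + _]addrC; apply: dP => //; rewrite /ball_/= sub0r normrN.
apply/cvgrPdist_lt => e e0; have [d d0 dP] := df _ e0.
rewrite near_withinE; apply/nbhs_normP; exists d => //= h; rewrite /ball_/= sub0r normrN => hd h0.
by rewrite distrC [_ + x]addrC; apply: dP.
Qed.

Lemma diff_eps V W (f : V -> W) x : differentiable f x ->
  forall e, 0 < e -> exists2 d, 0 < d & forall h, `|h| < d ->
    `|f (x + h) - f x - 'd f x h| <= e * `|h|.
Proof.
move=> /diff_locally /eqaddoP H e e0.
have := H _ e0 => /nbhs_normP[d /= d0 dP]; exists d => // h hd.
have := dP h; rewrite /ball_/= sub0r normrN => /(_ hd).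
by rewrite !fctE /= opprD addrA [h + x]addrC.
Qed.

Lemma eps_diff V W (f : V -> W) (df : {linear V -> W}) x : continuous df ->
  (forall e, 0 < e -> exists2 d, 0 < d & forall h, `|h| < d ->
    `|f (x + h) - f x - df h| <= e * `|h|) ->
  is_diff x f df.
Proof.
move=> cdf H; have H' : f \o shift x = cst (f x) + df +o_ 0 id.
  apply/eqaddoP => e e0; have [d d0 dP] := H _ e0.
  apply/nbhs_normP; exists d => //= h; rewrite /ball_/= sub0r normrN => /dP.
  by rewrite !fctE/= opprD addrA [h + x]addrC.
have E := diff_unique cdf H'.
by split=> //; apply/diff_locallyP; rewrite E.
Qed.

Lemma is_derive_line V W (f : V -> W) x v (t : R) :
  derivable f (x + t *: v) v ->
  is_derive t (1 : R) (fun s : R => f (x + s *: v)) ('D_v f (x + t *: v)).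
Proof.
move=> /derivableP /is_deriveP H; apply/is_deriveP => e e0.
have [d d0 dP] := H _ e0; exists d => // h h0 hd.
by rewrite scalerDl addrA [_ *: 1]mulr1; exact: dP.
Qed.

Lemma MVT_line V (f : V -> R) x v (h : R) :
  (forall c : R, `|c| <= `|h| -> derivable f (x + c *: v) v) ->
  exists2 c : R, `|c| <= `|h| & f (x + h *: v) - f x = h * 'D_v f (x + c *: v).
Proof.
move=> df; pose g s := f (x + s *: v).
have dg (c : R) : `|c| <= `|h| -> is_derive c (1 : R) g ('D_v f (x + c *: v)).
  by move=> /df; exact: is_derive_line.
have cg c : `|c| <= `|h| -> {for c, continuous g}.
  by move=> /dg ?; apply/differentiable_continuous/derivable1_diffP.
have fx : f x = g 0 by rewrite /g scale0r addr0.
have [h0|h0] := leP 0 h.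
- have [|||c ch E] := @MVT_segment _ g (fun c => 'D_v f (x + c *: v)) 0 h.
  + by [].
  + move=> c; rewrite in_itv/= => /andP[c0 ch]; apply: dg.
    by rewrite !ger0_norm// ltW.
  + apply: continuous_in_subspaceT => c; rewrite inE/= in_itv/= => /andP[c0 ch].
    by apply: cg; rewrite !ger0_norm.
  exists c.
    by move: ch; rewrite in_itv/= => /andP[c0 ch]; rewrite !ger0_norm.
  by rewrite fx -/(g h) E subr0 mulrC.
- have [|||c ch E] := @MVT_segment _ g (fun c => 'D_v f (x + c *: v)) h 0.
  + exact: ltW.
  + move=> c; rewrite in_itv/= => /andP[c0 ch]; apply: dg.
    by rewrite !ler0_norm ?lerN2 ltW.
  + apply: continuous_in_subspaceT => c; rewrite inE/= in_itv/= => /andP[c0 ch].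
    by apply: cg; rewrite !ler0_norm ?lerN2// ltW.
  exists c.
    by move: ch; rewrite in_itv/= => /andP[c0 ch]; rewrite !ler0_norm ?lerN2// ltW.
  by rewrite fx -/(g h) -opprB E; ring.
Qed.

(** The increment along [v + w] is the increment along [v] followed by one along
    [w]; by the mean value theorem the latter is a value of ['D_w f] at a nearby
    point, and continuity of ['D_w f] brings it back to [x]. *)
Lemma is_derive_addv V (f : V -> R) x v w l r : 0 < r ->
  is_derive x v f l ->
  (forall y, `|y - x| < r -> derivable f y w) ->
  {for x, continuous ('D_w f)} ->
  is_derive x (v + w) f (l + 'D_w f x).
Proof.
move=> r0 /is_deriveP dv dw /contP cw; apply/is_deriveP => e e0.
have [|d1 d10 d1P] := dv (e / 2); first by rewrite divr_gt0.
have [|d2 d20 d2P] := cw (e / 2); first by rewrite divr_gt0.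
pose d3 := Num.min r d2.
have d30 : 0 < d3 by rewrite lt_min r0.
pose N := `|v| + `|w| + 1.
have N0 : 0 < N by rewrite ltr_wpDl// addr_ge0.
exists (Num.min d1 (d3 / N)); first by rewrite lt_min d10 divr_gt0.
move=> h h0; rewrite lt_min => /andP[hd1 hd3].
have small c : `|c| <= `|h| -> `|x + h *: v + c *: w - x| < d3.
  move=> ch; rewrite addrC addrA addKr.
  apply: le_lt_trans (ler_normD _ _) _; rewrite !normrZ.
  apply: (@le_lt_trans _ _ (`|h| * N)); last by rewrite -ltr_pdivlMr.
  rewrite /N !mulrDr mulr1 -addrA lerD2l.
  by apply: (@le_trans _ _ (`|h| * `|w|)); [rewrite ler_wpM2r|rewrite lerDl].
have [|c ch E] := @MVT_line _ f (x + h *: v) w h.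
  by move=> c /small; rewrite lt_min => /andP[+ _]; exact: dw.
have -> : f (x + h *: (v + w)) - f x = h * 'D_w f (x + h *: v + c *: w) + (f (x + h *: v) - f x).
  by rewrite -E scalerDr addrA subrKA.
have -> : h^-1 *: (h * 'D_w f (x + h *: v + c *: w) + (f (x + h *: v) - f x)) - (l + 'D_w f x)
  = (h^-1 *: (f (x + h *: v) - f x) - l) + ('D_w f (x + h *: v + c *: w) - 'D_w f x).
  by rewrite scalerDr [h^-1 *: (h * _)]mulKf//; ring.
apply: le_lt_trans (ler_normD _ _) _; rewrite [ltRHS]splitr ltrD ?d1P//.
by apply: d2P; have := small _ ch; rewrite lt_min => /andP[].
Qed.

Lemma derive_scale V (f : V -> R) x v k : derivable f x v ->
  is_derive x (k *: v) f (k * 'D_v f x).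
Proof.
move=> df; have [->|k0] := eqVneq k 0.
  by rewrite scale0r mul0r; exact: is_derive0.
apply/is_deriveP => e e0.
have /derivableP/is_deriveP H := df.
have [|d d0 dP] := H (e / `|k|); first by rewrite divr_gt0// normr_gt0.
exists (d / `|k|); first by rewrite divr_gt0// normr_gt0.
move=> h h0 hd; have hk0 : h * k != 0 by rewrite mulf_neq0.
have := dP _ hk0; rewrite normrM -ltr_pdivlMr ?normr_gt0// => /(_ hd).
rewrite ltr_pdivlMr ?normr_gt0// -normrM scalerA; congr (`| _ | < _).
by rewrite /GRing.scale /=; field; rewrite h0 k0.
Qed.

End EpsilonDelta.

Section Plane.
Context {R : realType}.

Definition lin2 (a b : R) (w : R * R) : R := a * w.1 + b * w.2.

Fact lin2_linear a b : linear (lin2 a b).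
Proof. by move=> k u v; rewrite /lin2 /= /GRing.scale/=; ring. Qed.

HB.instance Definition _ a b :=
  GRing.isLinear.Build R (R * R)%type R *:%R (lin2 a b) (lin2_linear a b).

Lemma lin2_continuous a b : continuous (lin2 a b).
Proof.
by move=> w; apply: cvgD; apply: cvgMr; [exact: cvg_fst|exact: cvg_snd].
Qed.

(** The increment is telescoped along the two axes, and the mean value theorem
    turns each step into a partial derivative at a nearby point. *)
Lemma C1_differentiable (u : R * R -> R) z r : 0 < r ->
  (forall y, `|y - z| < r -> derivable u y (1, 0) /\ derivable u y (0, 1)) ->
  {for z, continuous ('D_(1, 0) u)} -> {for z, continuous ('D_(0, 1) u)} ->
  is_diff z u (lin2 ('D_(1, 0) u z) ('D_(0, 1) u z)).
Proof.
move=> r0 du /contP cx /contP cy.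
apply: eps_diff; first exact: lin2_continuous.
move=> e e0.
have [|d1 d10 d1P] := cx (e / 2); first by rewrite divr_gt0.
have [|d2 d20 d2P] := cy (e / 2); first by rewrite divr_gt0.
exists (Num.min r (Num.min d1 d2)); first by rewrite !lt_min r0 d10.
move=> [a b]; rewrite !lt_min => /and3P[hr hd1 hd2].
have na : `|a| <= `|(a, b)| by rewrite [leRHS]prod_normE/= le_max lexx.
have nb : `|b| <= `|(a, b)| by rewrite [leRHS]prod_normE/= le_max lexx orbT.
have nn c1 c2 : `|c1| <= `|a| -> `|c2| <= `|b| ->
    `|z + c1 *: (1, 0) + c2 *: (0, 1) - z| <= `|(a, b)|.
  move=> h1 h2; rewrite addrC addrA addKr.
  have -> : c1 *: (1, 0) + c2 *: (0, 1) = (c1, c2) :> (R * R).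
    by congr pair; rewrite /= /GRing.scale/= !(mulr0, mulr1) ?addr0 ?add0r.
  rewrite [leLHS]prod_normE/= [leRHS]prod_normE/= ge_max !le_max h1 h2 orbT.
  by [].
have [|c1 c1a E1] := @MVT_line _ _ u z (1, 0) a.
  move=> c ca; have sm : `|z + c *: (1, 0) - z| <= `|(a, b)|.
    by have := nn c 0 ca; rewrite normr0 scale0r addr0; apply.
  exact: (du _ (le_lt_trans sm hr)).1.
have [|c2 c2b E2] := @MVT_line _ _ u (z + a *: (1, 0)) (0, 1) b.
  by move=> c cb; have [] := du _ (le_lt_trans (nn a c (lexx _) cb) hr).
have -> : u (z + (a, b)) - u z - lin2 ('D_(1, 0) u z) ('D_(0, 1) u z) (a, b) =
  a * ('D_(1, 0) u (z + c1 *: (1, 0)) - 'D_(1, 0) u z) +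
  b * ('D_(0, 1) u (z + a *: (1, 0) + c2 *: (0, 1)) - 'D_(0, 1) u z).
  rewrite !mulrBr -E1 -E2 /lin2/=.
  have -> : z + a *: (1, 0) + b *: (0, 1) = z + (a, b).
    rewrite -addrA; congr (_ + _).
    by congr pair; rewrite /= /GRing.scale/= !(mulr0, mulr1) ?addr0 ?add0r.
  ring.
apply: le_trans (ler_normD _ _) _; rewrite !normrM [e]splitr mulrDl.
rewrite lerD//.
  rewrite mulrC ler_pM// ltW// d1P//.
  have := nn c1 0 c1a; rewrite normr0 scale0r addr0 => /(_ (normr_ge0 _)).
  by move=> /le_lt_trans; apply.
rewrite mulrC ler_pM// ltW// d2P//.
by have := nn a c2 (lexx _) c2b => /le_lt_trans; apply.
Qed.

End Plane.

(** * Symmetry of second derivatives and integrals with a parameter *)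

Section Schwarz.
Context {R : realType} {V : normedModType R}.

Lemma is_derive_shiftv {W : normedModType R} (f : V -> W) x a v l :
  is_derive (x + a) v f l -> is_derive x v (fun y => f (y + a)) l.
Proof.
move=> /is_deriveP H; apply/is_deriveP => e /H[d d0 dP]; exists d => // h h0 hd.
by rewrite [x + _ + a]addrAC; exact: dP.
Qed.

(** Two applications of the mean value theorem, to [f (. + h w) - f] along [v] and
    then to ['D_v f] along [w]. *)
Lemma second_difference (f : V -> R) x v w r h :
  `|h| * (`|v| + `|w|) < r ->
  (forall y, `|y - x| < r -> derivable f y v) ->
  (forall y, `|y - x| < r -> derivable ('D_v f) y w) ->
  exists2 y, `|y - x| <= `|h| * (`|v| + `|w|) &
    f (x + h *: v + h *: w) - f (x + h *: w) - (f (x + h *: v) - f x) =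
    h * (h * 'D_w ('D_v f) y).
Proof.
move=> hr df ddf.
have small (c k : R) : `|c| <= `|h| -> `|k| <= `|h| ->
    `|x + c *: v + k *: w - x| <= `|h| * (`|v| + `|w|).
  move=> ch kh; rewrite addrC addrA addKr.
  apply: le_trans (ler_normD _ _) _; rewrite !normrZ mulrDr.
  by rewrite lerD// ler_wpM2r.
pose g y := f (y + h *: w) - f y.
have dg c : `|c| <= `|h| ->
    is_derive (x + c *: v) v g ('D_v f (x + c *: v + h *: w) - 'D_v f (x + c *: v)).
  move=> ch; apply: is_deriveB.
    by apply: is_derive_shiftv; apply/derivableP/df/(le_lt_trans (small c h ch (lexx _))).
  apply/derivableP/df; have := small c 0 ch; rewrite normr0 scale0r addr0.
  by move=> /(_ (normr_ge0 _)) sm; exact: le_lt_trans sm hr.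
have [|c ch E1] := @MVT_line _ _ g x v h.
  by move=> c /dg [].
have [|k kh E2] := @MVT_line _ _ ('D_v f) (x + c *: v) w h.
  by move=> k kh; apply: ddf; apply: le_lt_trans (small c k ch kh) hr.
exists (x + c *: v + k *: w); first exact: small.
rewrite -E2; have [_ <-] := dg _ ch; rewrite -E1 /g.
by rewrite [x + h *: v + _]addrAC [RHS]addrC; ring.
Qed.

(** The second difference is symmetric in [v] and [w], so that the two mixed
    derivatives take a common value at points arbitrarily close to [x]. *)
Lemma deriveC (f : V -> R) x v w r : 0 < r ->
  (forall y, `|y - x| < r -> derivable f y v /\ derivable f y w) ->
  (forall y, `|y - x| < r -> derivable ('D_v f) y w /\ derivable ('D_w f) y v) ->
  {for x, continuous ('D_w ('D_v f))} -> {for x, continuous ('D_v ('D_w f))} ->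
  'D_w ('D_v f) x = 'D_v ('D_w f) x.
Proof.
move=> r0 df ddf /contP c1 /contP c2.
apply/eqP; rewrite -subr_eq0 -normr_le0; apply/ler_addgt0Pr => e e0; rewrite add0r.
have [|d1 d10 d1P] := c1 (e / 2); first by rewrite divr_gt0.
have [|d2 d20 d2P] := c2 (e / 2); first by rewrite divr_gt0.
pose d := Num.min r (Num.min d1 d2).
have d0 : 0 < d by rewrite !lt_min r0 d10.
pose N := `|v| + `|w| + 1.
have N0 : 0 < N by rewrite ltr_wpDl// addr_ge0.
pose h := d / 2 / N.
have h0 : 0 < h by rewrite !divr_gt0.
have hd : `|h| * (`|v| + `|w|) < d.
  apply: (@le_lt_trans _ _ (h * N)); first by rewrite gtr0_norm// ler_wpM2l ?lerDl// ltW.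
  by rewrite divfK ?gt_eqF// ltr_pdivrMr// ltr_pMr// ltr1n.
have : `|h| * (`|v| + `|w|) < r by move: hd; rewrite lt_min => /andP[].
move=> hr.
have [||y1 y1h E1] := @second_difference f x v w r h hr.
- by move=> y /df[].
- by move=> y /ddf[].
have hr' : `|h| * (`|w| + `|v|) < r by rewrite addrC.
have [||y2 y2h E2] := @second_difference f x w v r h hr'.
- by move=> y /df[].
- by move=> y /ddf[].
have EE : 'D_w ('D_v f) y1 = 'D_v ('D_w f) y2.
  have hn : h != 0 by rewrite gt_eqF.
  apply/(mulfI hn)/(mulfI hn)/(etrans (esym E1))/(etrans _ E2).
  by rewrite [x + h *: w + _]addrAC; ring.
have {}d1P := d1P y1; have {}d2P := d2P y2; rewrite -{}EE in d2P.
move: ('D_w ('D_v f) x) ('D_v ('D_w f) x) ('D_w ('D_v f) y1) d1P d2P => A B C d1P d2P.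
rewrite -[A](subrK C) -addrA.
apply: le_trans (ler_normD _ _) _; rewrite [leRHS]splitr lerD// ltW//.
  rewrite distrC; apply: d1P; apply: le_lt_trans y1h _; apply: lt_le_trans hd _.
  by rewrite !ge_min lexx orbT.
apply: d2P; rewrite addrC in y2h; rewrite addrC; apply: le_lt_trans y2h _.
by rewrite [`|w| + _]addrC; apply: lt_le_trans hd _; rewrite !ge_min lexx !orbT.
Qed.

End Schwarz.

Section ParametricIntegrals.
Context {R : realType} {V : normedModType R}.
Implicit Types (a b : R) (U : set V) (K : R -> V -> R).

Definition joint_cont a b U K := forall t x, a <= t <= b -> U x ->
  {for (t, x), continuous (fun p : R * V => K p.1 p.2)}.

Lemma joint_cont_on a b U K x : joint_cont a b U K -> U x ->
  cont_on a b (fun t => K t x).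
Proof.
move=> cK Ux t tab.
apply/contP => e e0; have /contP/(_ _ e0)[d d0 dP] := cK t x tab Ux.
exists d => // s st; apply: (dP (s, x)).
by rewrite [ltLHS]prod_normE/= subrr normr0 gt_max st d0.
Qed.

(** Compactness of [[a, b]] makes the continuity in the parameter uniform. *)
Lemma joint_cont_uniform a b U K x e : joint_cont a b U K -> U x -> 0 < e ->
  exists2 d, 0 < d & forall t y, a <= t <= b -> `|y - x| < d ->
    `|K t y - K t x| < e.
Proof.
move=> cK Ux e0.
have e20 : 0 < e / 2 by rewrite divr_gt0.
have := @segment_compact R a b; rewrite compact_near_coveringP.
move=> /(_ V (nbhs x) (fun y t => `|K t y - K t x| < e)) H.
have /nbhs_normP[d /= d0 dP] : \forall y \near x, `[a, b] `<=` (fun t => `|K t y - K t x| < e).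
  apply: H => t; rewrite /= in_itv/= => tab.
  have /contP/(_ _ e20)[d d0 dP] := cK t x tab Ux.
  exists (ball t d, ball x d); first by split; apply: nbhsx_ballx.
  move=> [s y] [/= ts xy].
  have -> : K s y - K s x = (K s y - K t x) - (K s x - K t x) by ring.
  apply: le_lt_trans (ler_normB _ _) _; rewrite [e]splitr.
  have xx : ball x d x by exact: ballxx.
  have N y' : ball x d y' -> `|(s, y') - (t, x)| < d.
    move: ts; rewrite -!ball_normE /ball_/= => ts xy'.
    by rewrite [ltLHS]prod_normE/= gt_max distrC ts distrC xy'.
  by apply: ltrD; [exact: (dP (s, y) (N _ xy))|exact: (dP (s, x) (N _ xx))].
exists d => // t y tab yx; apply: (dP y) => /=; last by rewrite in_itv.
by rewrite /ball_/= distrC.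
Qed.

Lemma integ_small a b phi m : a <= b -> cont_on a b phi ->
  (forall t, a <= t <= b -> `|phi t| <= m) -> `|integ a b phi| <= m * (b - a).
Proof.
move=> ab cphi H; have := @integ_bound _ a b 0 m phi ab cphi.
by rewrite mul0r subr0; apply => t /H; rewrite subr0.
Qed.

Lemma param_cont a b U K : a <= b -> open U -> joint_cont a b U K ->
  forall x, U x -> {for x, continuous (fun x => integ a b (fun t => K t x))}.
Proof.
move=> ab oU cK x Ux; apply/contP => e e0.
have L0 : 0 < b - a + 1 by rewrite ltr_wpDl// subr_ge0.
have [|d1 d10 d1P] := @joint_cont_uniform a b U K x (e / (b - a + 1)) cK Ux.
  by rewrite divr_gt0.
have [d2 d20 d2P] := open_normP oU Ux.
exists (Num.min d1 d2); first by rewrite lt_min d10.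
move=> y; rewrite lt_min => /andP[yd1 /d2P Uy].
have c1 := joint_cont_on cK Ux; have c2 := joint_cont_on cK Uy.
rewrite -integB//; apply: le_lt_trans (@integ_small _ _ _ (e / (b - a + 1)) ab _ _) _.
- by move=> t tab; apply: cvgB; [exact: c2|exact: c1].
- by move=> t tab; apply: ltW; exact: d1P.
- by rewrite mulrAC ltr_pdivrMr// ltr_pM2l// ltrDl.
Qed.

(** By the mean value theorem each difference quotient of the integrand is a
    value of the derivative at a nearby parameter, and this derivative is
    continuous in the parameter uniformly over the segment. *)
Lemma param_derive a b U K v : a <= b -> open U -> joint_cont a b U K ->
  (forall t x, a <= t <= b -> U x -> derivable (K t) x v) ->
  joint_cont a b U (fun t => 'D_v (K t)) ->
  forall x, U x -> is_derive x v (fun x => integ a b (fun t => K t x))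
    (integ a b (fun t => 'D_v (K t) x)).
Proof.
move=> ab oU cK dK cdK x Ux; apply/is_deriveP => e e0.
have L0 : 0 < b - a + 1 by rewrite ltr_wpDl// subr_ge0.
have [|d1 d10 d1P] := @joint_cont_uniform a b U _ x (e / (b - a + 1)) cdK Ux.
  by rewrite divr_gt0.
have [d2 d20 d2P] := open_normP oU Ux.
have N0 : 0 < `|v| + 1 by rewrite ltr_wpDl.
exists (Num.min d1 d2 / (`|v| + 1)); first by rewrite divr_gt0// lt_min d10.
move=> h h0; rewrite ltr_pdivlMr// => hd.
have small (c : R) : `|c| <= `|h| -> `|x + c *: v - x| < d1 /\ U (x + c *: v).
  move=> ch; have : `|x + c *: v - x| < Num.min d1 d2.
    rewrite addrC addKr normrZ; apply: le_lt_trans hd.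
    by rewrite ler_pM// lerDl.
  by rewrite lt_min => /andP[? /d2P].
have c1 := joint_cont_on cK Ux; have c2 := joint_cont_on cK (small h (lexx _)).2.
have c3 := joint_cont_on cdK Ux.
have cB : cont_on a b (fun t => K t (x + h *: v) - K t x).
  by move=> t tab; apply: cvgB; [exact: c2|exact: c1].
have cZ : cont_on a b (fun t => h^-1 * (K t (x + h *: v) - K t x)).
  by move=> t tab; apply: cvgMr; exact: cB.
have -> : h^-1 *: (integ a b (fun t => K t (x + h *: v)) - integ a b (fun t => K t x)) -
    integ a b (fun t => 'D_v (K t) x) =
    integ a b (fun t => h^-1 * (K t (x + h *: v) - K t x) - 'D_v (K t) x).
  by rewrite integB// integZ// integB.
apply: le_lt_trans (@integ_small _ _ _ (e / (b - a + 1)) ab _ _) _.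
- by move=> t tab; apply: cvgB; [exact: cZ|exact: c3].
- move=> t tab; have [|c ch ->] := @MVT_line _ _ (K t) x v h.
    by move=> c /small[_ Uc]; exact: dK.
  by rewrite mulKf// ltW// d1P// (small _ ch).1.
- by rewrite mulrAC ltr_pdivrMr// ltr_pM2l// ltrDl.
Qed.

End ParametricIntegrals.

(** * Goursat's theorem on a rectangle *)

Section Bisection.
Context {R : realType}.
Implicit Types (a b c d x y m e : R).

Lemma nested_intervals (u v : nat -> R) :
  (forall n, u n <= u n.+1) -> (forall n, v n.+1 <= v n) ->
  (forall n, u n <= v n) -> exists x, forall n, u n <= x <= v n.
Proof.
move=> uS vS uv.
have umono k n : u n <= u (k + n)%N.
  by elim: k => // k IH; rewrite addSn (le_trans IH).
have vmono k n : v (k + n)%N <= v n.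
  by elim: k => // k IH; rewrite addSn (le_trans _ IH).
have uvm n k : u n <= v k.
  by apply: le_trans (umono k n) _; apply: le_trans (uv _) _; rewrite addnC vmono.
exists (sup (range u)) => n; apply/andP; split.
  apply: ub_le_sup; last by exists n.
  by exists (v 0%N) => _ [k _ <-].
apply: ge_sup; first by exists (u 0%N), 0%N.
by move=> _ [k _ <-].
Qed.

Lemma half_powers_small (A d : R) : 0 < d -> exists n, A / 2 ^+ n < d.
Proof.
move=> d0; exists (Num.bound (A / d)).
have p0 n : 0 < 2 ^+ n :> R by rewrite exprn_gt0.
rewrite ltr_pdivrMr// -ltr_pdivrMl// mulrC.
have [A0|A0] := leP 0 (A / d); last by apply: lt_trans A0 _.
apply: lt_le_trans (archi_boundP A0) _.
by rewrite -natrX ler_nat ltnW// ltn_expl.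
Qed.

(** [(a, b, (c, d))] stands for [[a, b] x [c, d]]. *)
Definition rect : Type := R * R * (R * R).
Implicit Types r : rect.
Definition sub_rect r (s : rect) :=
  [&& s.1.1 <= r.1.1, r.1.1 <= r.1.2, r.1.2 <= s.1.2 &
  [&& s.2.1 <= r.2.1, r.2.1 <= r.2.2 & r.2.2 <= s.2.2]].
Definition rect_size r := (r.1.2 - r.1.1) + (r.2.2 - r.2.1).

(** Goursat's bisection: an additive function of rectangles that is locally
    small compared with the area scale vanishes, since otherwise a nested
    sequence of quarters would keep the ratio bounded below. *)
Lemma bisection (J : rect -> R) (r0 : rect) : sub_rect r0 r0 ->
  (forall a m b c d, sub_rect (a, b, (c, d)) r0 -> a <= m <= b ->
    J (a, b, (c, d)) = J (a, m, (c, d)) + J (m, b, (c, d))) ->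
  (forall a b c m d, sub_rect (a, b, (c, d)) r0 -> c <= m <= d ->
    J (a, b, (c, d)) = J (a, b, (c, m)) + J (a, b, (m, d))) ->
  (forall x y e, r0.1.1 <= x <= r0.1.2 -> r0.2.1 <= y <= r0.2.2 -> 0 < e ->
    exists2 d, 0 < d & forall r, sub_rect r r0 ->
      r.1.1 <= x <= r.1.2 -> r.2.1 <= y <= r.2.2 ->
      r.1.2 - r.1.1 < d -> r.2.2 - r.2.1 < d -> `|J r| <= e * rect_size r ^+ 2) ->
  J r0 = 0.
Proof.
move=> sr0 addJ1 addJ2 locJ; apply/eqP/negP => /negP J0.
(* With this ratio the whole rectangle violates the bound, even if it is
   degenerate, which is the purpose of the term 1. *)
pose e := `|J r0| / (rect_size r0 ^+ 2 + 1).
have S0 : 0 < rect_size r0 ^+ 2 + 1 by rewrite ltr_wpDl// sqr_ge0.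
have e0 : 0 < e by rewrite divr_gt0// normr_gt0.
pose bad r := e * rect_size r ^+ 2 < `|J r|.
have bad0 : bad r0.
  rewrite /bad /e mulrAC ltr_pdivrMr// ltr_pM2l ?normr_gt0//.
  by rewrite ltrDl.
pose mx r := (r.1.1 + r.1.2) / 2; pose my r := (r.2.1 + r.2.2) / 2.
pose q1 r : rect := (r.1.1, mx r, (r.2.1, my r)).
pose q2 r : rect := (mx r, r.1.2, (r.2.1, my r)).
pose q3 r : rect := (r.1.1, mx r, (my r, r.2.2)).
pose q4 r : rect := (mx r, r.1.2, (my r, r.2.2)).
pose next r := if bad (q1 r) then q1 r else if bad (q2 r) then q2 r
  else if bad (q3 r) then q3 r else q4 r.
have next_cases r : next r \in [:: q1 r; q2 r; q3 r; q4 r].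
  by rewrite /next !inE; repeat case: ifP => _; rewrite ?eqxx ?orbT.
have next_sub r : sub_rect r r -> [/\ sub_rect (next r) r,
    (next r).1.2 - (next r).1.1 = (r.1.2 - r.1.1) / 2 &
    (next r).2.2 - (next r).2.1 = (r.2.2 - r.2.1) / 2].
  rewrite /sub_rect => /and4P[_ ab _ /and3P[_ cd _]].
  have [m1 m2] := midf_le ab; have [m3 m4] := midf_le cd.
  have := next_cases r; rewrite !inE => /or4P[] /eqP ->; rewrite /= /mx /my;
    (split; [by rewrite ?lexx ?m1 ?m2 ?m3 ?m4|by field..]).
have next_bad r : sub_rect r r0 -> bad r -> bad (next r).
  move=> srr0 br; rewrite /next; case: ifP => // /negbT; rewrite /bad -leNgt => b1.
  case: ifP => // /negbT; rewrite -leNgt => b2.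
  case: ifP => // /negbT; rewrite -leNgt => b3.
  rewrite ltNge; apply/negP => b4; move: br; rewrite /bad ltNge => /negP; apply.
  case: r srr0 b1 b2 b3 b4 => [[a b] [c d]] srr0.
  rewrite /q1 /q2 /q3 /q4 /mx /my /rect_size /=.
  move: (srr0); rewrite /sub_rect/= => /and4P[aa ab bb /and3P[cc cd dd]].
  have mab : a <= (a + b) / 2 <= b by have [-> ->] := midf_le ab.
  have mcd : c <= (c + d) / 2 <= d by have [-> ->] := midf_le cd.
  rewrite (addJ1 _ _ _ _ _ srr0 mab) !(addJ2 _ _ _ _ _ _ mcd); last 2 first.
  - have /andP[m1 m2] := mab.
    by rewrite /sub_rect/= (le_trans aa m1) m2 bb cc cd dd.
  - have /andP[m1 m2] := mab.
    by rewrite /sub_rect/= aa m1 (le_trans m2 bb) cc cd dd.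
  move: (J _) (J _) (J _) (J _) => J1 J2 J3 J4.
  move=> b1 b2 b3 b4; apply: le_trans (ler_normD _ _) _.
  apply: le_trans (lerD (ler_normD _ _) (ler_normD _ _)) _.
  set s := (b - a + (d - c)).
  have E (t : R) : t = s / 2 -> e * t ^+ 2 = e * s ^+ 2 / 4 by move=> ->; field.
  have Q1 := E ((a + b) / 2 - a + ((c + d) / 2 - c)).
  have Q2 := E (b - (a + b) / 2 + ((c + d) / 2 - c)).
  have Q3 := E ((a + b) / 2 - a + (d - (c + d) / 2)).
  have Q4 := E (b - (a + b) / 2 + (d - (c + d) / 2)).
  rewrite Q1 in b1; last by rewrite /s; field.
  rewrite Q2 in b2; last by rewrite /s; field.
  rewrite Q3 in b3; last by rewrite /s; field.
  rewrite Q4 in b4; last by rewrite /s; field.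
  move: b1 b2 b3 b4; lra.
pose rn n := iter n next r0.
have rn_inv n : [/\ sub_rect (rn n) (rn n), sub_rect (rn n) r0, bad (rn n),
    (rn n).1.2 - (rn n).1.1 = (r0.1.2 - r0.1.1) / 2 ^+ n &
    (rn n).2.2 - (rn n).2.1 = (r0.2.2 - r0.2.1) / 2 ^+ n].
  elim: n => [|n [s1 s2 b w1 w2]]; first by rewrite /rn/= expr0 !divr1; split.
  have [t1 v1 v2] := next_sub _ s1.
  have tt : sub_rect (rn n.+1) (rn n.+1).
    move: t1; rewrite /rn /= -/(rn n) /sub_rect !lexx /=.
    by move=> /and4P[_ -> _ /and3P[_ -> _]].
  split=> //.
  - move: t1 s2; rewrite /rn /= -/(rn n) /sub_rect.
    move=> /and4P[x1 x2 x3 /and3P[x4 x5 x6]] /and4P[y1 y2 y3 /and3P[y4 y5 y6]].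
    by rewrite (le_trans y1 x1) x2 (le_trans x3 y3) (le_trans y4 x4) x5 (le_trans x6 y6).
  - exact: next_bad.
  - by rewrite /rn /= -/(rn n) v1 w1 exprS invfM mulrA mulrAC.
  - by rewrite /rn /= -/(rn n) v2 w2 exprS invfM mulrA mulrAC.
have stepP n : sub_rect (rn n.+1) (rn n).
  by have [s1 _ _ _ _] := rn_inv n; have [t1 _ _] := next_sub _ s1.
have [||| x xP] := @nested_intervals (fun n => (rn n).1.1) (fun n => (rn n).1.2).
- by move=> n; have /and4P[] := stepP n.
- by move=> n; have /and4P[] := stepP n.
- by move=> n; have [/and4P[]] := rn_inv n.
have [||| y yP] := @nested_intervals (fun n => (rn n).2.1) (fun n => (rn n).2.2).
- by move=> n; have /and4P[_ _ _ /and3P[]] := stepP n.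
- by move=> n; have /and4P[_ _ _ /and3P[]] := stepP n.
- by move=> n; have [/and4P[_ _ _ /and3P[]]] := rn_inv n.
have [d d0 dP] := locJ x y e (xP 0%N) (yP 0%N) e0.
have [n nd] := half_powers_small (rect_size r0) d0.
have [_ s2 b w1 w2] := rn_inv n.
move: b; rewrite /bad ltNge => /negP; apply; apply: dP => //.
- rewrite w1; apply: le_lt_trans nd; rewrite ler_pM2r ?invr_gt0 ?exprn_gt0//.
  by rewrite lerDl; move: sr0; rewrite /sub_rect subr_ge0 => /and4P[_ _ _ /and3P[]].
- rewrite w2; apply: le_lt_trans nd; rewrite ler_pM2r ?invr_gt0 ?exprn_gt0//.
  by rewrite lerDr; move: sr0; rewrite /sub_rect subr_ge0 => /and4P[].
Qed.

(** Goursat's theorem for the form [P ds + Q dt]. The affine part of the form at a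
    point is closed, hence has no circulation; what remains is small compared
    with the distance to the point, so that its circulation is small compared
    with the square of the size of the rectangle. *)
Lemma closed_form_rectangle (P Q : R * R -> R) a b c d : a <= b -> c <= d ->
  (forall s t, a <= s <= b -> c <= t <= d ->
    [/\ differentiable P (s, t), differentiable Q (s, t) &
        'D_(1, 0) Q (s, t) = 'D_(0, 1) P (s, t)]) ->
  integ c d (fun t => Q (b, t)) - integ c d (fun t => Q (a, t)) =
  integ a b (fun s => P (s, d)) - integ a b (fun s => P (s, c)).
Proof.
move=> ab cd dPQ.
have cQ s c' d' : a <= s <= b -> c <= c' -> d' <= d -> cont_on c' d' (fun t => Q (s, t)).
  move=> sab cc dd t /andP[ct td]; have [|_ dQ _] := dPQ s t sab.
    by rewrite (le_trans cc ct) (le_trans td dd).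
  have /contP cq := differentiable_continuous dQ.
  apply/contP => e /cq[r r0 rP]; exists r => // t' t'r; apply: rP.
  by rewrite [ltLHS]prod_normE/= subrr normr0 gt_max t'r r0.
have cP t a' b' : c <= t <= d -> a <= a' -> b' <= b -> cont_on a' b' (fun s => P (s, t)).
  move=> tcd aa bb s /andP[as' sb]; have [|dP' _ _] := dPQ s t _ tcd.
    by rewrite (le_trans aa as') (le_trans sb bb).
  have /contP cp := differentiable_continuous dP'.
  apply/contP => e /cp[r r0 rP]; exists r => // t' t'r; apply: rP.
  by rewrite [ltLHS]prod_normE/= subrr normr0 gt_max t'r r0.
pose J (r : rect) :=
  integ r.2.1 r.2.2 (fun t => Q (r.1.2, t)) - integ r.2.1 r.2.2 (fun t => Q (r.1.1, t)) -
  (integ r.1.1 r.1.2 (fun s => P (s, r.2.2)) - integ r.1.1 r.1.2 (fun s => P (s, r.2.1))).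
apply/eqP; rewrite -subr_eq0; apply/eqP.
apply: (@bisection J (a, b, (c, d))).
- by rewrite /sub_rect/= !lexx ab cd.
- move=> a' m b' c' d' /and4P[/= aa' ab' bb' /and3P[cc' cd' dd']] /andP[am mb].
  rewrite /J/= (@integ_split _ a' m b' (fun s => P (s, d')))//; last by apply: cP => //; lra.
  rewrite (@integ_split _ a' m b' (fun s => P (s, c')))//; last by apply: cP => //; lra.
  ring.
- move=> a' b' c' m d' /and4P[/= aa' ab' bb' /and3P[cc' cd' dd']] /andP[cm md].
  rewrite /J/= (@integ_split _ c' m d' (fun t => Q (b', t)))//; last by apply: cQ => //; lra.
  rewrite (@integ_split _ c' m d' (fun t => Q (a', t)))//; last by apply: cQ => //; lra.
  ring.
- move=> x y e /= xab ycd e0.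
  have [dP' dQ' clo] := dPQ x y xab ycd.
  pose px := 'D_(1, 0) P (x, y); pose py := 'D_(0, 1) P (x, y).
  pose qx := 'D_(1, 0) Q (x, y); pose qy := 'D_(0, 1) Q (x, y).
  have dE (F : R * R -> R) (h k : R) : differentiable F (x, y) ->
      'd F (x, y) (h, k) = h * 'D_(1, 0) F (x, y) + k * 'D_(0, 1) F (x, y).
    move=> dF; have -> : (h, k) = h *: (1, 0) + k *: (0, 1) :> R * R.
      by congr pair; rewrite /= /GRing.scale/= !(mulr0, mulr1) ?addr0 ?add0r.
    by rewrite linearD !linearZ/= !deriveE.
  have e20 : 0 < e / 2 by rewrite divr_gt0.
  have [d1 d10 d1P] := diff_eps dP' e20.
  have [d2 d20 d2P] := diff_eps dQ' e20.
  exists (Num.min d1 d2); first by rewrite lt_min d10.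
  move=> [[a' b'] [c' d']] /= /and4P[/= aa' ab' bb' /and3P[cc' cd' dd']].
  rewrite /rect_size/= => /andP[ax xb] /andP[cy yd] wx wy.
  set L := b' - a' + (d' - c').
  have close s t : a' <= s <= b' -> c' <= t <= d' ->
      `|P (s, t) - P (x, y) - ((s - x) * px + (t - y) * py)| <= e / 2 * L /\
      `|Q (s, t) - Q (x, y) - ((s - x) * qx + (t - y) * qy)| <= e / 2 * L.
    move=> /andP[as' sb] /andP[ct td].
    have Est : (s, t) = (x, y) + (s - x, t - y).
      by congr pair; rewrite /= addrC subrK.
    have n1 : `|s - x| <= b' - a' by rewrite ler_norml; lra.
    have n2 : `|t - y| <= d' - c' by rewrite ler_norml; lra.
    have nL : `|(s - x, t - y)| <= L.
      rewrite [leLHS]prod_normE/= ge_max (le_trans n1) ?(le_trans n2)//.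
        by rewrite lerDr subr_ge0.
      by rewrite lerDl subr_ge0.
    have nd : `|(s - x, t - y)| < Num.min d1 d2.
      by rewrite [ltLHS]prod_normE/= gt_max (le_lt_trans n1 wx) (le_lt_trans n2 wy).
    move: nd; rewrite lt_min => /andP[/d1P b1 /d2P b2].
    rewrite !dE// -Est in b1 b2.
    split; [apply: le_trans b1 _|apply: le_trans b2 _]; by rewrite ler_pM2l.
  have IQ : `|integ c' d' (fun t => Q (b', t) - Q (a', t)) - (b' - a') * qx * (d' - c')| <=
      e * L * (d' - c').
    apply: integ_bound => // [|t tcd].
      by move=> t tcd; apply: cvgB; apply: (cQ _ c' d') => //; lra.
    have [|_ h1] := close b' t _ tcd; first by rewrite ab' lexx.
    have [|_ h2] := close a' t _ tcd; first by rewrite ab' lexx.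
    have -> : Q (b', t) - Q (a', t) - (b' - a') * qx =
      (Q (b', t) - Q (x, y) - ((b' - x) * qx + (t - y) * qy)) -
      (Q (a', t) - Q (x, y) - ((a' - x) * qx + (t - y) * qy)) by ring.
    by apply: le_trans (ler_normB _ _) _; move: h1 h2; lra.
  have IP : `|integ a' b' (fun s => P (s, d') - P (s, c')) - (d' - c') * py * (b' - a')| <=
      e * L * (b' - a').
    apply: integ_bound => // [|s sab].
      by move=> s sab; apply: cvgB; apply: (cP _ a' b') => //; lra.
    have [|h1 _] := close s d' sab; first by rewrite cd' lexx.
    have [|h2 _] := close s c' sab; first by rewrite cd' lexx.
    have -> : P (s, d') - P (s, c') - (d' - c') * py =
      (P (s, d') - P (x, y) - ((s - x) * px + (d' - y) * py)) -
      (P (s, c') - P (x, y) - ((s - x) * px + (c' - y) * py)) by ring.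
    by apply: le_trans (ler_normB _ _) _; move: h1 h2; lra.
  rewrite /J/= -integB; [|by apply: cQ => //; lra..].
  rewrite -integB; [|by apply: cP => //; lra..].
  rewrite -/py -/qx in clo; rewrite clo in IQ.
  set I1 := integ _ _ _ in IQ *; set I2 := integ _ _ _ in IP *.
  have -> : I1 - I2 = (I1 - (b' - a') * py * (d' - c')) - (I2 - (d' - c') * py * (b' - a')).
    by ring.
  apply: le_trans (ler_normB _ _) _; apply: le_trans (lerD IQ IP) _.
  by rewrite -mulrDr addrC expr2 mulrA.
Qed.

End Bisection.

(** * Chain rules and the Cauchy-Riemann equations *)

Section ChainRules.
Context {R : realType}.
Implicit Types V W : normedModType R.

(** Reduction of a directional derivative to a derivative in one variable. *)
Lemma is_derive_lineP V W (f : V -> W) x v l :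
  is_derive x v f l <-> is_derive 0 (1 : R) (fun h : R => f (x + h *: v)) l.
Proof.
split=> /is_deriveP H; apply/is_deriveP => e /H[d d0 dP]; exists d => // h h0 hd.
  by rewrite add0r scale0r addr0 [_ *: 1]mulr1; exact: dP.
by have := dP h h0 hd; rewrite add0r scale0r addr0 [_ *: 1]mulr1.
Qed.

Lemma is_derive_comp1 V (g : R -> R) (phi : V -> R) x v l l' :
  is_derive x v phi l -> is_derive (phi x) 1 g l' ->
  is_derive x v (fun y => g (phi y)) (l * l').
Proof.
move=> /is_derive_lineP dphi dg; apply/is_derive_lineP; rewrite mulrC.
apply: (@is_derive1_comp _ g (fun h : R => phi (x + h *: v)) 0).
by rewrite scale0r addr0.
Qed.

Lemma diff_plane (u : R * R -> R) z (h k : R) : differentiable u z ->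
  'd u z (h, k) = h * 'D_(1, 0) u z + k * 'D_(0, 1) u z.
Proof.
move=> du; have -> : (h, k) = h *: (1, 0) + k *: (0, 1) :> R * R.
  by congr pair; rewrite /= /GRing.scale/= !(mulr0, mulr1) ?addr0 ?add0r.
by rewrite linearD !linearZ/= !deriveE.
Qed.

Lemma is_derive_comp2 V (u : R * R -> R) (phi psi : V -> R) x v l l' :
  is_derive x v phi l -> is_derive x v psi l' ->
  differentiable u (phi x, psi x) ->
  is_derive x v (fun y => u (phi y, psi y))
    (l * 'D_(1, 0) u (phi x, psi x) + l' * 'D_(0, 1) u (phi x, psi x)).
Proof.
move=> /is_derive_lineP dphi /is_derive_lineP dpsi du; apply/is_derive_lineP.
rewrite -diff_plane//.
set p := fun h : R => phi (x + h *: v) in dphi *.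
set q := fun h : R => psi (x + h *: v) in dpsi *.
have px : p 0 = phi x by rewrite /p scale0r addr0.
have qx : q 0 = psi x by rewrite /q scale0r addr0.
have dp : is_diff 0 p ( *:%R^~ l).
  split; first by apply/derivable1_diffP; case: dphi.
  by rewrite diff1E ?derive1E; [case: dphi => _ ->|apply/derivable1_diffP; case: dphi].
have dq : is_diff 0 q ( *:%R^~ l').
  split; first by apply/derivable1_diffP; case: dpsi.
  by rewrite diff1E ?derive1E; [case: dpsi => _ ->|apply/derivable1_diffP; case: dpsi].
have du' : is_diff (p 0, q 0) u ('d u (phi x, psi x)) by rewrite px qx; split.
have D : is_diff 0 (u \o (fun h => (p h, q h)))
    ('d u (phi x, psi x) \o (fun h => (h *: l, h *: l'))).
  exact: is_diff_comp.
have [dD eD] := D.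
apply: DeriveDef; first exact/derivable1_diffP.
by rewrite deriveE// eD /= !scale1r.
Qed.

Lemma is_derive_fst (p v : R * R) : is_derive p v fst v.1.
Proof.
apply/is_deriveP => e e0; exists 1 => // h h0 _; rewrite /= [X in _ *: X]addrC addKr.
by rewrite scalerA mulVf// scale1r subrr normr0.
Qed.

Lemma is_derive_snd (p v : R * R) : is_derive p v snd v.2.
Proof.
apply/is_deriveP => e e0; exists 1 => // h h0 _; rewrite /= [X in _ *: X]addrC addKr.
by rewrite scalerA mulVf// scale1r subrr normr0.
Qed.

Lemma differentiable_fst (p : R * R) : differentiable (fst : R * R -> R) p.
Proof.
have -> : fst = lin2 1 0 :> (R * R -> R).
  by apply/funext => w; rewrite /lin2 mul1r mul0r addr0.
exact/linear_differentiable/lin2_continuous.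
Qed.

Lemma differentiable_snd (p : R * R) : differentiable (snd : R * R -> R) p.
Proof.
have -> : snd = lin2 0 1 :> (R * R -> R).
  by apply/funext => w; rewrite /lin2 mul1r mul0r add0r.
exact/linear_differentiable/lin2_continuous.
Qed.

End ChainRules.

Section CauchyRiemann.
Context {R : realType}.
Implicit Types (D U : set (R * R)) (u v : R * R -> R) (z w p : R * R).
Local Notation dx u := ('D_((1, 0) : R * R) u).
Local Notation dy u := ('D_((0, 1) : R * R) u).

(** Holomorphy of [u + i v], by its real and imaginary parts. *)
Definition CR D u v := forall z, D z ->
  [/\ differentiable u z, differentiable v z,
      dx u z = dy v z & dy u z = - dx v z].

(** [(v, -u)] is [-i (u + i v)]: what is proved for the real part of a
    holomorphic function transfers to its imaginary part. *)
Lemma CR_rot D u v : CR D u v -> CR D v (- u).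
Proof.
move=> cr z /cr[du dv e1 e2]; split => //; first exact: differentiableN.
  by rewrite deriveN ?e2 ?opprK//; exact: diff_derivable.
by rewrite deriveN ?e1 ?opprK//; exact: diff_derivable.
Qed.

Definition polar z (s t : R) : R * R := (z.1 + s * cos t, z.2 + s * sin t).

Lemma polar_near z s t : `|polar z s t - z| <= `|s|.
Proof.
have -> : polar z s t - z = (s * cos t, s * sin t).
  by congr pair; rewrite /= addrC addKr.
rewrite [leLHS]prod_normE/= ge_max !normrM.
by rewrite !ler_piMr// ler_norml ?cos_geN1 ?cos_le1 ?sin_geN1 ?sin_le1.
Qed.

(** The real part of the mean of [(u + i v)(z + r exp(i t)) exp(- i t) / r] over the
    circle, which is Cauchy's integral for the derivative at [z]. *)
Definition circle_mean u v (r : R) z :=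
  (2 * pi * r)^-1 * integ 0 (2 * pi)
    (fun t => u (polar z r t) * cos t + v (polar z r t) * sin t).

Lemma is_derive_polar u z p w : differentiable u (polar z p.1 p.2) ->
  is_derive p w (fun p => u (polar z p.1 p.2))
    ((w.1 * cos p.2 - p.1 * (w.2 * sin p.2)) * dx u (polar z p.1 p.2) +
     (w.1 * sin p.2 + p.1 * (w.2 * cos p.2)) * dy u (polar z p.1 p.2)).
Proof.
move=> du.
have dc : is_derive p w (fun p : R * R => cos p.2) (w.2 * - sin p.2).
  by apply: is_derive_comp1; exact: is_derive_snd.
have ds : is_derive p w (fun p : R * R => sin p.2) (w.2 * cos p.2).
  by apply: is_derive_comp1; exact: is_derive_snd.
have df := is_derive_fst p w.
rewrite /polar in du *.
apply: (@is_derive_comp2 _ _ u (fun p : R * R => z.1 + p.1 * cos p.2)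
                             (fun p : R * R => z.2 + p.1 * sin p.2)) => //.
  apply: is_derive_eq.
  by rewrite add0r /GRing.scale/=; ring.
apply: is_derive_eq.
by rewrite add0r /GRing.scale/=; ring.
Qed.

Lemma differentiable_cos2 p : differentiable (fun p : R * R => cos p.2) p.
Proof.
apply: (@differentiable_comp _ _ _ _ snd cos); first exact: differentiable_snd.
exact/derivable1_diffP/derivable_cos.
Qed.

Lemma differentiable_sin2 p : differentiable (fun p : R * R => sin p.2) p.
Proof.
apply: (@differentiable_comp _ _ _ _ snd sin); first exact: differentiable_snd.
exact/derivable1_diffP/derivable_sin.
Qed.

Lemma differentiable_polar u z p : differentiable u (polar z p.1 p.2) ->
  differentiable (fun p => u (polar z p.1 p.2)) p.
Proof.
move=> du; apply: (@differentiable_comp _ _ _ _ (fun p => polar z p.1 p.2) u) => //.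
apply: differentiable_pair.
  apply: (@differentiableD _ _ _ (cst z.1)) => //.
  apply: differentiableM; [exact: differentiable_fst|exact: differentiable_cos2].
apply: (@differentiableD _ _ _ (cst z.2)) => //.
apply: differentiableM; [exact: differentiable_fst|exact: differentiable_sin2].
Qed.

End CauchyRiemann.

(** * Cauchy's formula for the derivative *)

Section CauchyFormula.
Context {R : realType}.
Implicit Types (D U : set (R * R)) (u v : R * R -> R) (z w p : R * R).
Local Notation dx u := ('D_((1, 0) : R * R) u).
Local Notation dy u := ('D_((0, 1) : R * R) u).

Lemma cos_2pi : cos (2 * pi) = 1 :> R.
Proof. by rewrite mulr_natl mulr2n cosDpi cospi opprK. Qed.

Lemma sin_2pi : sin (2 * pi) = 0 :> R.
Proof. by rewrite mulr_natl mulr2n sinDpi sinpi oppr0. Qed.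

Lemma cont_on_cos (a b : R) : cont_on a b cos.
Proof. by move=> t _; exact: continuous_cos. Qed.

Lemma cont_on_sin (a b : R) : cont_on a b sin.
Proof. by move=> t _; exact: continuous_sin. Qed.

Lemma pi2_ge0 : 0 <= 2 * pi :> R.
Proof. by rewrite mulr_ge0// pi_ge0. Qed.

Lemma integ_cos : integ 0 (2 * pi) (cos : R -> R) = 0.
Proof.
rewrite (@integ_FTC _ _ _ cos sin) ?pi2_ge0//; last exact: cont_on_cos.
by rewrite sin_2pi sin0 subrr.
Qed.

Lemma integ_sin : integ 0 (2 * pi) (sin : R -> R) = 0.
Proof.
have d (x : R) : is_derive x (1 : R) (- cos : R -> R) (sin x) by rewrite -[sin x]opprK; exact: is_deriveN.
rewrite (integ_FTC pi2_ge0 (@cont_on_sin _ _) (fun x _ => d x)).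
by rewrite !fctE cos_2pi cos0 subrr.
Qed.

Lemma is_derive_invfst p w : p.1 != 0 ->
  is_derive p w (fun p : R * R => p.1^-1) (- p.1 ^- 2 * w.1).
Proof.
move=> p0; have [d e] := is_derive_fst p w.
by split; [exact: derivableV|rewrite deriveV// e].
Qed.

Lemma differentiable_invfst p : p.1 != 0 ->
  differentiable (fun p : R * R => p.1^-1) p.
Proof. by move=> p0; apply: differentiableV => //; exact: differentiable_fst. Qed.

Lemma cont_on_polar D u z (r : R) (a b : R) : (forall t, D (polar z r t)) ->
  (forall p, D p -> differentiable u p) -> cont_on a b (fun t => u (polar z r t)).
Proof.
move=> Dz du t _.
have /differentiable_continuous/contP H := @differentiable_polar _ u z (r, t) (du _ (Dz t)).
apply/contP => e /H[d d0 dP]; exists d => // t' t'd.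
apply: (dP (r, t')).
by rewrite [ltLHS]prod_normE/= subrr normr0 gt_max d0 t'd.
Qed.

(** Writing [g = u + i v], the function [(g(zeta) - g(z)) / (zeta - z)^2] is
    holomorphic on the punctured disc, so that its circulation around [z] does
    not depend on the radius; it tends to [2 pi i g'(z)] as the radius shrinks.
    In polar coordinates the independence of the radius is Goursat's theorem on a
    rectangle, since the sides [t = 0] and [t = 2 pi] cancel. *)
Lemma cauchy_derivative D u v z r : 0 < r ->
  (forall s t, 0 <= s <= r -> D (polar z s t)) -> CR D u v ->
  dx u z = circle_mean u v r z.
Proof.
move=> r0 Dz cr.
have Dz0 : D z.
  have := Dz 0 0; rewrite lexx ltW// => /(_ isT).
  by rewrite /polar !mul0r !addr0; case: (z).
have [duz dvz cr1 cr2] := cr z Dz0.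
have du p : D p -> differentiable u p by move=> /cr[].
have dv p : D p -> differentiable v p by move=> /cr[].
(* k1 + i s k2 is (g(zeta) - g(z)) exp(- i t) / s at zeta = z + s exp(i t), and
   the imaginary part of the form above is k1 dt + k2 ds. *)
pose k1 (p : R * R) := ((u (polar z p.1 p.2) - u z) * cos p.2 +
  (v (polar z p.1 p.2) - v z) * sin p.2) * p.1^-1.
pose k2 (p : R * R) := ((v (polar z p.1 p.2) - v z) * cos p.2 -
  (u (polar z p.1 p.2) - u z) * sin p.2) * p.1^-1 * p.1^-1.
have dU p : D (polar z p.1 p.2) -> differentiable (fun p => u (polar z p.1 p.2) - u z) p.
  by move=> Dp; apply: differentiableB => //; apply: differentiable_polar; exact: du.
have dV p : D (polar z p.1 p.2) -> differentiable (fun p => v (polar z p.1 p.2) - v z) p.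
  by move=> Dp; apply: differentiableB => //; apply: differentiable_polar; exact: dv.
have dc := @differentiable_cos2 R; have ds := @differentiable_sin2 R.
have dk1 p : p.1 != 0 -> D (polar z p.1 p.2) -> differentiable k1 p.
  move=> p0 Dp; apply: differentiableM; last exact: differentiable_invfst.
  by apply: differentiableD; apply: differentiableM; auto.
have dk2 p : p.1 != 0 -> D (polar z p.1 p.2) -> differentiable k2 p.
  move=> p0 Dp; apply: differentiableM; last exact: differentiable_invfst.
  apply: differentiableM; last exact: differentiable_invfst.
  by apply: differentiableB; apply: differentiableM; auto.
have closed p : p.1 != 0 -> D (polar z p.1 p.2) -> dx k1 p = dy k2 p.
  move=> p0 Dp; have [dup dvp c1 c2] := cr _ Dp.
  have Du w := is_deriveB (is_derive_polar w dup) (is_derive_cst (u z) p w).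
  have Dv w := is_deriveB (is_derive_polar w dvp) (is_derive_cst (v z) p w).
  have Dc w : is_derive p w (fun p : R * R => cos p.2) (w.2 * - sin p.2).
    by apply: is_derive_comp1; exact: is_derive_snd.
  have Ds w : is_derive p w (fun p : R * R => sin p.2) (w.2 * cos p.2).
    by apply: is_derive_comp1; exact: is_derive_snd.
  have Di w := is_derive_invfst w p0.
  have D1 w := @derive_val _ _ _ _ _ _ _
    (is_deriveM (is_deriveD (is_deriveM (Du w) (Dc w)) (is_deriveM (Dv w) (Ds w))) (Di w)).
  have D2 w := @derive_val _ _ _ _ _ _ _ (is_deriveM (is_deriveM
    (is_deriveB (is_deriveM (Dv w) (Dc w)) (is_deriveM (Du w) (Ds w))) (Di w)) (Di w)).
  rewrite (D1 (1, 0) : dx k1 p = _) (D2 (0, 1) : dy k2 p = _).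
  rewrite !fctE /= c1 c2 /GRing.scale /=.
  set U := u _ - _; set V := v _ - _.
  move: (dx v _) (dy v _) U V => vx vy U V.
  move: (cos p.2) (sin p.2) => c s; field.
  exact: p0.
have I_eq s : 0 < s <= r ->
    integ 0 (2 * pi) (fun t => k1 (r, t)) = integ 0 (2 * pi) (fun t => k1 (s, t)).
  move=> /andP[s0 sr]; apply/eqP; rewrite -subr_eq0; apply/eqP.
  rewrite (@closed_form_rectangle _ k2 k1 s r 0 (2 * pi) sr pi2_ge0).
    rewrite (_ : (fun s => k2 (s, 2 * pi)) = (fun s => k2 (s, 0))) ?subrr//.
    by apply/funext => x; rewrite /k2 /polar /= cos_2pi sin_2pi cos0 sin0.
  move=> s' t /andP[ss sr'] _.
  have s'0 : s' != 0 by rewrite gt_eqF// (lt_le_trans s0).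
  have Ds' : D (polar z s' t) by apply: Dz; rewrite sr' (le_trans (ltW s0)).
  by split; [exact: dk2|exact: dk1|exact: closed].
have ck1 s : 0 < s <= r -> cont_on 0 (2 * pi) (fun t => k1 (s, t)).
  move=> /andP[s0 sr]; have Ds' t : D (polar z s t) by apply: Dz; rewrite ltW.
  rewrite /k1 /= => t tI; apply: cvgM; last exact: cvg_cst.
  apply: cvgD; apply: cvgM.
  - apply: cvgB; last exact: cvg_cst.
    exact: (@cont_on_polar D u z s 0 (2 * pi)).
  - exact: continuous_cos.
  - apply: cvgB; last exact: cvg_cst.
    exact: (@cont_on_polar D v z s 0 (2 * pi)).
  - exact: continuous_sin.
have I_lim : integ 0 (2 * pi) (fun t => k1 (r, t)) = dx u z * (2 * pi).
  apply/eqP; rewrite -subr_eq0 -normr_le0; apply/ler_addgt0Pr => e e0; rewrite add0r.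
  pose e' := e / (2 * (2 * pi)).
  have pi0 : 0 < 2 * pi :> R by rewrite mulr_gt0// pi_gt0.
  have e'0 : 0 < e' by rewrite divr_gt0// mulr_gt0.
  have [d1 d10 d1P] := diff_eps duz e'0.
  have [d2 d20 d2P] := diff_eps dvz e'0.
  pose s := Num.min r (Num.min d1 d2 / 2).
  have m0 : 0 < Num.min d1 d2 by rewrite lt_min d10.
  have s0 : 0 < s by rewrite lt_min r0 divr_gt0.
  have sr : s <= r by rewrite ge_min lexx.
  have sd : `|s| < Num.min d1 d2.
    rewrite gtr0_norm//; apply: (@le_lt_trans _ _ (Num.min d1 d2 / 2)).
      by rewrite ge_min lexx orbT.
    by rewrite ltr_pdivrMr// ltr_pMr// ltr1n.
  have s0r : 0 < s <= r by rewrite s0.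
  rewrite (I_eq s)//.
  have -> : e = 2 * e' * (2 * pi).
    rewrite /e'; move: (2 * pi) (lt0r_neq0 pi0) => p p0.
    by field.
  have B := @integ_bound _ 0 (2 * pi) (dx u z) (2 * e') _ pi2_ge0 (ck1 s s0r).
  rewrite subr0 in B; apply: B => t _; pose h := (s * cos t, s * sin t).
  have hE : polar z s t = z + h by [].
  have hs : `|h| <= s.
    by have := polar_near z s t; rewrite hE addrC addKr gtr0_norm.
  have hd : `|h| < Num.min d1 d2 by rewrite (le_lt_trans hs)// -[s]gtr0_norm.
  move: hd; rewrite lt_min => /andP[/d1P h1 /d2P h2].
  rewrite /k1 /= hE; rewrite !diff_plane// cr2 -/h in h1 h2.
  have sn : s != 0 by rewrite gt_eqF.
  have -> : dx u z = ((s * cos t * dx u z + s * sin t * - dx v z) * cos t +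
      (s * cos t * dx v z + s * sin t * dy v z) * sin t) / s.
    rewrite cr1; transitivity (dy v z * (cos t ^+ 2 + sin t ^+ 2)).
      by rewrite cos2Dsin2 mulr1.
    by move: (dy v z) (dx v z) (cos t) (sin t) => a b c n; field.
  rewrite -mulrBl normrM [X in _ * X]ger0_norm ?invr_ge0 ?(ltW s0)// ler_pdivrMr//.
  have -> : 2 * e' * s = e' * s + e' * s by ring.
  have {}h1 := le_trans h1 (ler_wpM2l (ltW e'0) hs).
  have {}h2 := le_trans h2 (ler_wpM2l (ltW e'0) hs).
  rewrite opprD addrACA -!mulrBl.
  apply: le_trans (ler_normD _ _) _; rewrite !normrM.
  apply: lerD; [apply: le_trans h1|apply: le_trans h2].
    by rewrite ler_piMr// ler_norml cos_geN1 cos_le1.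
  by rewrite ler_piMr// ler_norml sin_geN1 sin_le1.
have Dzr t : D (polar z r t) by apply: Dz; rewrite lexx ltW.
have cu := @cont_on_polar D u z r 0 (2 * pi) Dzr du.
have cv := @cont_on_polar D v z r 0 (2 * pi) Dzr dv.
have cuc : cont_on 0 (2 * pi) (fun t => u (polar z r t) * cos t).
  by move=> t tI; apply: cvgM; [exact: cu|exact: continuous_cos].
have cvs : cont_on 0 (2 * pi) (fun t => v (polar z r t) * sin t).
  by move=> t tI; apply: cvgM; [exact: cv|exact: continuous_sin].
have cc := @cont_on_cos 0 (2 * pi); have cs := @cont_on_sin 0 (2 * pi).
have ccst k : cont_on 0 (2 * pi) (fun t => k * cos t : R).
  by move=> t tI; apply: cvgMr; exact: cc.
have scst k : cont_on 0 (2 * pi) (fun t => k * sin t : R).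
  by move=> t tI; apply: cvgMr; exact: cs.
(* The constants u z and v z disappear since cos and sin have mean zero. *)
rewrite /circle_mean.
have -> : integ 0 (2 * pi) (fun t => u (polar z r t) * cos t + v (polar z r t) * sin t) =
    r * integ 0 (2 * pi) (fun t => k1 (r, t)).
  rewrite -integZ; last by apply: ck1; rewrite r0 lexx.
  transitivity (integ 0 (2 * pi) (fun t =>
     (u (polar z r t) * cos t - u z * cos t) + (v (polar z r t) * sin t - v z * sin t))).
    rewrite [RHS]integD; last 2 first.
    - by move=> t tI; exact: (cvgB (cuc t tI) (ccst _ t tI)).
    - by move=> t tI; exact: (cvgB (cvs t tI) (scst _ t tI)).
    by rewrite !integB// !integZ// integ_cos integ_sin !mulr0 !subr0 integD.
  apply: eq_integ => t _; rewrite /k1 /=.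
  by rewrite [RHS]mulrC divfK ?gt_eqF// !mulrBl.
rewrite I_lim; have pi0 : 2 * pi != 0 :> R by rewrite gt_eqF// mulr_gt0// pi_gt0.
move: (2 * pi) (dx u z) pi0 => p x p0; field.
by rewrite p0 gt_eqF.
Qed.

End CauchyFormula.

(** * Derivatives of holomorphic functions *)

Section HolomorphicDerivative.
Context {R : realType}.
Implicit Types (D U : set (R * R)) (u v : R * R -> R) (z w p : R * R).
Local Notation dx u := ('D_((1, 0) : R * R) u).
Local Notation dy u := ('D_((0, 1) : R * R) u).

Lemma cont_pair {V W1 W2 : normedModType R} (f : V -> W1) (g : V -> W2) x :
  {for x, continuous f} -> {for x, continuous g} ->
  {for x, continuous (fun x => (f x, g x))}.
Proof.
move=> /contP cf /contP cg; apply/contP => e e0.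
have [d1 d10 d1P] := cf _ e0; have [d2 d20 d2P] := cg _ e0.
exists (Num.min d1 d2); first by rewrite lt_min d10.
move=> y; rewrite lt_min => /andP[/d1P h1 /d2P h2].
by rewrite [ltLHS]prod_normE/= gt_max h1.
Qed.

Lemma near_eq_cont {V W : normedModType R} (U : set V) (f g : V -> W) x : open U -> U x ->
  (forall y, U y -> f y = g y) -> {for x, continuous f} -> {for x, continuous g}.
Proof.
move=> oU Ux fg /contP cf; apply/contP => e /cf[d1 d10 d1P].
have [d2 d20 d2P] := open_normP oU Ux.
exists (Num.min d1 d2); first by rewrite lt_min d10.
by move=> y; rewrite lt_min => /andP[h1 /d2P Uy]; rewrite -!fg//; exact: d1P.
Qed.

Lemma near_eq_deriv {V W : normedModType R} (U : set V) (f g : V -> W) x (a : V) l : open U -> U x ->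
  (forall y, U y -> f y = g y) -> is_derive x a f l -> is_derive x a g l.
Proof.
move=> oU Ux fg; apply: near_eq_is_derive.
by apply: filterS (open_nbhs_nbhs (conj oU Ux)) => y; exact: fg.
Qed.

Lemma polar_cont D U u (r : R) : (forall z t, U z -> D (polar z r t)) ->
  (forall z, D z -> {for z, continuous u}) ->
  joint_cont 0 (2 * pi) U (fun t z => u (polar z r t)).
Proof.
move=> UD cu t z _ Uz.
have cf1 : {for (t, z), continuous (fun p : R * (R * R) => p.2.1)}.
  apply/contP => e e0; exists e => // p pe; apply: le_lt_trans pe.
  by rewrite [leRHS]prod_normE/= le_max [X in _ || (_ <= X)]prod_normE/= le_max lexx orbT.
have cf2 : {for (t, z), continuous (fun p : R * (R * R) => p.2.2)}.
  apply/contP => e e0; exists e => // p pe; apply: le_lt_trans pe.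
  by rewrite [leRHS]prod_normE/= le_max [X in _ || (_ <= X)]prod_normE/= le_max lexx !orbT.
have cc : {for (t, z), continuous (fun p : R * (R * R) => cos p.1)}.
  by apply: continuous_comp; [exact: cvg_fst|exact: continuous_cos].
have cs : {for (t, z), continuous (fun p : R * (R * R) => sin p.1)}.
  by apply: continuous_comp; [exact: cvg_fst|exact: continuous_sin].
apply: (@continuous_comp _ _ _ (fun p : R * (R * R) => polar p.2 r p.1) u).
  apply: cont_pair; first by apply: cvgD; [exact: cf1|apply: cvgMr; exact: cc].
  by apply: cvgD; [exact: cf2|apply: cvgMr; exact: cs].
by apply: cu; exact: UD.
Qed.

Lemma circle_joint_cont D U u v (r : R) : (forall z t, U z -> D (polar z r t)) ->
  (forall z, D z -> {for z, continuous u}) -> (forall z, D z -> {for z, continuous v}) ->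
  joint_cont 0 (2 * pi) U
    (fun t z => u (polar z r t) * cos t + v (polar z r t) * sin t).
Proof.
move=> UD cu cv t z tI Uz.
have c1 := polar_cont UD cu tI Uz; have c2 := polar_cont UD cv tI Uz.
apply: cvgD; apply: cvgM; [exact: c1| |exact: c2|].
  by apply: continuous_comp; [exact: cvg_fst|exact: continuous_cos].
by apply: continuous_comp; [exact: cvg_fst|exact: continuous_sin].
Qed.

Lemma circle_mean_cont D U u v (r : R) : open U -> (forall z t, U z -> D (polar z r t)) ->
  (forall z, D z -> {for z, continuous u}) -> (forall z, D z -> {for z, continuous v}) ->
  forall z, U z -> {for z, continuous (circle_mean u v r)}.
Proof.
move=> oU UD cu cv z Uz; apply: cvgMr.
exact: (param_cont pi2_ge0 oU (circle_joint_cont UD cu cv)).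
Qed.

Lemma circle_mean_derive D U u v (r : R) w : open U -> (forall z t, U z -> D (polar z r t)) ->
  (forall z, D z -> {for z, continuous u}) -> (forall z, D z -> {for z, continuous v}) ->
  (forall z, D z -> derivable u z w) -> (forall z, D z -> derivable v z w) ->
  (forall z, D z -> {for z, continuous ('D_w u)}) ->
  (forall z, D z -> {for z, continuous ('D_w v)}) ->
  forall z, U z -> is_derive z w (circle_mean u v r) (circle_mean ('D_w u) ('D_w v) r z).
Proof.
move=> oU UD cu cv du dv cdu cdv z Uz.
pose K t z := u (polar z r t) * cos t + v (polar z r t) * sin t.
have shift t y : polar y r t = y + polar 0 r t.
  by congr pair; rewrite /= add0r.
have dK t y : U y -> is_derive y w (K t)
    ('D_w u (polar y r t) * cos t + 'D_w v (polar y r t) * sin t).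
  move=> Uy; have Dy := UD y t Uy.
  have d1 : is_derive y w (fun y => u (polar y r t)) ('D_w u (polar y r t)).
    rewrite (_ : (fun y => _) = fun y => u (y + polar 0 r t)); last first.
      by apply/funext => y'; rewrite shift.
    by apply: is_derive_shiftv; rewrite -shift; apply/derivableP/du.
  have d2 : is_derive y w (fun y => v (polar y r t)) ('D_w v (polar y r t)).
    rewrite (_ : (fun y => _) = fun y => v (y + polar 0 r t)); last first.
      by apply/funext => y'; rewrite shift.
    by apply: is_derive_shiftv; rewrite -shift; apply/derivableP/dv.
  have := is_deriveD (is_deriveM d1 (is_derive_cst (cos t : R) y w))
                     (is_deriveM d2 (is_derive_cst (sin t : R) y w)).
  rewrite !scaler0 !add0r /GRing.scale /= !fctE => H.
  by apply: is_derive_eq H _; congr (_ + _); rewrite mulrC.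
have E t y : U y -> 'D_w (K t) y =
    'D_w u (polar y r t) * cos t + 'D_w v (polar y r t) * sin t.
  by move=> Uy; have [_ ->] := dK t y Uy.
have jK : joint_cont 0 (2 * pi) U K by exact: circle_joint_cont UD cu cv.
have jdK : joint_cont 0 (2 * pi) U (fun t => 'D_w (K t)).
  move=> t y tI Uy; have c := circle_joint_cont UD cdu cdv tI Uy.
  have oRU : open [set p : R * (R * R) | U p.2].
    by apply: open_comp oU => p _; exact: cvg_snd.
  have e (q : R * (R * R)) : [set q : R * (R * R) | U q.2] q ->
      'D_w u (polar q.2 r q.1) * cos q.1 + 'D_w v (polar q.2 r q.1) * sin q.1 =
      'D_w (K q.1) q.2 by move=> Uq; rewrite E.
  exact: (@near_eq_cont _ _ _ _ _ (t, y) oRU Uy e c).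
have H := @param_derive _ _ _ _ _ K w pi2_ge0 oU jK
  (fun t x _ Ux => @ex_derive _ _ _ _ _ _ _ (dK t x Ux)) jdK z Uz.
rewrite (_ : integ _ _ (fun t => 'D_w (K t) z) = integ 0 (2 * pi)
  (fun t => 'D_w u (polar z r t) * cos t + 'D_w v (polar z r t) * sin t)) in H.
  exact: (@is_deriveZ _ _ _ _ (2 * pi * r)^-1 _ _ _ H).
by apply: eq_integ => t _; exact: E.
Qed.

Lemma half_disc D z : open D -> D z -> exists2 r, 0 < r &
  forall y s t, `|y - z| < r -> 0 <= s <= r -> D (polar y s t).
Proof.
move=> oD Dz; have [d d0 dP] := open_normP oD Dz.
exists (d / 2); first by rewrite divr_gt0.
move=> y s t yz /andP[s0 sr]; apply: dP.
rewrite -(subrK y (polar y s t)) -addrA; apply: le_lt_trans (ler_normD _ _) _.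
rewrite [ltRHS]splitr ler_ltD// (le_trans (polar_near _ _ _))//.
by rewrite ger0_norm.
Qed.

Lemma CR_cont_derive D u v : open D -> CR D u v ->
  forall z, D z -> {for z, continuous (dx u)}.
Proof.
move=> oD cr z Dz; have [r r0 rP] := half_disc oD Dz.
pose U := [set y | `|y - z| < r].
have oU : open U.
  by rewrite (_ : U = ball z r); [exact: ball_open|apply/seteqP; split => y;
    rewrite /U -ball_normE /ball_/= distrC].
have Uz : U z by rewrite /U /= subrr normr0.
apply: (near_eq_cont (f := circle_mean u v r) oU Uz).
  move=> y Uy; rewrite (cauchy_derivative r0 _ cr)// => s t sr.
  exact: rP.
apply: (@circle_mean_cont D U) => //.
- by move=> y t Uy; apply: rP => //; rewrite lexx ltW.
- by move=> y /cr[? _ _ _]; exact: differentiable_continuous.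
- by move=> y /cr[_ ? _ _]; exact: differentiable_continuous.
Qed.

Lemma eq_circle_mean (u u' v v' : R * R -> R) r z :
  (forall t, u (polar z r t) * cos t + v (polar z r t) * sin t =
     u' (polar z r t) * cos t + v' (polar z r t) * sin t) ->
  circle_mean u v r z = circle_mean u' v' r z.
Proof. by move=> H; congr (_ * _); apply: eq_integ => t _; exact: H. Qed.

(** Cauchy's formula makes the derivative a circular mean of the function, hence
    continuous; the partial derivatives being thereby continuous, the mean can be
    differentiated under the integral sign, and the Cauchy-Riemann equations pass
    to it. *)
Lemma CR_derive D u v : open D -> CR D u v -> CR D (dx u) (dx v).
Proof.
move=> oD cr z Dz; have [r r0 rP] := half_disc oD Dz.
have cr' := CR_rot cr.
have cxu := CR_cont_derive oD cr; have cxv := CR_cont_derive oD cr'.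
have cyu y : D y -> {for y, continuous (dy u)}.
  move=> Dy; apply: (near_eq_cont (f := - dx v) oD Dy).
    by move=> x /cr[_ _ _ ->].
  by apply: cvgN; exact: cxv.
have cyv y : D y -> {for y, continuous (dy v)}.
  move=> Dy; apply: (near_eq_cont (f := dx u) oD Dy) => //; last exact: cxu.
  by move=> x /cr[_ _ -> _].
pose U := [set y | `|y - z| < r].
have oU : open U.
  by rewrite (_ : U = ball z r); [exact: ball_open|apply/seteqP; split => y;
    rewrite /U -ball_normE /ball_/= distrC].
have Uz : U z by rewrite /U /= subrr normr0.
have UD y t : U y -> D (polar y r t).
  by move=> Uy; apply: rP => //; rewrite lexx ltW.
have Eu y : U y -> circle_mean u v r y = dx u y.
  by move=> Uy; rewrite (cauchy_derivative r0 _ cr)// => s t sr; exact: rP.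
have Ev y : U y -> circle_mean v (- u) r y = dx v y.
  by move=> Uy; rewrite (cauchy_derivative r0 _ cr')// => s t sr; exact: rP.
have cu y : D y -> {for y, continuous u}.
  by move=> /cr[? _ _ _]; exact: differentiable_continuous.
have cv y : D y -> {for y, continuous v}.
  by move=> /cr[_ ? _ _]; exact: differentiable_continuous.
have cNu y : D y -> {for y, continuous (- u)} by move=> Dy; apply: cvgN; exact: cu.
have du w y : D y -> derivable u y w by move=> /cr[? _ _ _]; exact: diff_derivable.
have dv w y : D y -> derivable v y w by move=> /cr[_ ? _ _]; exact: diff_derivable.
have dNu w y : D y -> derivable (- u) y w by move=> Dy; apply: derivableN; exact: du.
have DNu w y : D y -> 'D_w (- u) y = - 'D_w u y.
  by move=> Dy; rewrite deriveN//; exact: du.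
have cDNu w : (forall y, D y -> {for y, continuous ('D_w u)}) ->
    forall y, D y -> {for y, continuous ('D_w (- u))}.
  move=> c y Dy; apply: (near_eq_cont (f := - 'D_w u) oD Dy).
    by move=> x Dx; rewrite DNu.
  by apply: cvgN; exact: c.
have derU w : (forall y, D y -> {for y, continuous ('D_w u)}) ->
    (forall y, D y -> {for y, continuous ('D_w v)}) -> forall y, U y ->
    is_derive y w (dx u) (circle_mean ('D_w u) ('D_w v) r y).
  move=> c1 c2 y Uy; apply: (near_eq_deriv oU Uy Eu).
  exact: (circle_mean_derive oU UD cu cv (du w) (dv w) c1 c2 Uy).
have derV w : (forall y, D y -> {for y, continuous ('D_w u)}) ->
    (forall y, D y -> {for y, continuous ('D_w v)}) -> forall y, U y ->
    is_derive y w (dx v) (circle_mean ('D_w v) ('D_w (- u)) r y).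
  move=> c1 c2 y Uy; apply: (near_eq_deriv oU Uy Ev).
  exact: (circle_mean_derive oU UD cv cNu (dv w) (dNu w) c2 (cDNu _ c1) Uy).
have dxu := derU (1, 0) cxu cxv; have dyu := derU (0, 1) cyu cyv.
have dxv := derV (1, 0) cxu cxv; have dyv := derV (0, 1) cyu cyv.
have ex y (Uy : U y) : dx (dx u) y = circle_mean (dx u) (dx v) r y.
  by have [_ ->] := dxu y Uy.
have ex' y (Uy : U y) : dx (dx v) y = circle_mean (dx v) (dx (- u)) r y.
  by have [_ ->] := dxv y Uy.
have ey y (Uy : U y) : dy (dx u) y = circle_mean (dy u) (dy v) r y.
  by have [_ ->] := dyu y Uy.
have ey' y (Uy : U y) : dy (dx v) y = circle_mean (dy v) (dy (- u)) r y.
  by have [_ ->] := dyv y Uy.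
have cD w1 (g a b : R * R -> R) : (forall y, D y -> {for y, continuous a}) ->
    (forall y, D y -> {for y, continuous b}) ->
    (forall y, U y -> 'D_w1 g y = circle_mean a b r y) ->
    {for z, continuous ('D_w1 g)}.
  move=> ca cb E; apply: (near_eq_cont (f := circle_mean a b r) oU Uz).
    by move=> y Uy; rewrite E.
  exact: (circle_mean_cont oU UD ca cb Uz).
split.
- have [] // := @C1_differentiable _ (dx u) z r r0.
  + by move=> y Uy; split; [have [] := dxu y Uy|have [] := dyu y Uy].
  + exact: (cD _ _ _ _ cxu cxv ex).
  + exact: (cD _ _ _ _ cyu cyv ey).
- have [] // := @C1_differentiable _ (dx v) z r r0.
  + by move=> y Uy; split; [have [] := dxv y Uy|have [] := dyv y Uy].
  + exact: (cD _ _ _ _ cxv (cDNu _ cxu) ex').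
  + exact: (cD _ _ _ _ cyv (cDNu _ cyu) ey').
- apply: (etrans (ex z Uz)); apply: (etrans _ (esym (ey' z Uz))).
  apply: eq_circle_mean => t; have [_ _ e1 e2] := cr _ (UD z t Uz).
  by rewrite (DNu _ _ (UD z t Uz)) e1 e2 opprK.
- apply: (etrans (ey z Uz)); rewrite (ex' z Uz) /circle_mean -mulrN; congr (_ * _).
  rewrite -mulN1r -integZ; last first.
    exact: (joint_cont_on (circle_joint_cont UD cxv (cDNu _ cxu))).
  apply: eq_integ => t _; have [_ _ e1 e2] := cr _ (UD z t Uz).
  by rewrite (DNu _ _ (UD z t Uz)) -e1 e2; ring.
Qed.

End HolomorphicDerivative.

(** * Functions of class C^k *)

Section CkCalculus.
Context {R : realType} {V : normedModType R}.
Implicit Types (U N : set V) (f g : V -> R) (k : nat).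

Lemma Ck_cont {W : normedModType R} k U (g : V -> W) : Ck k U g ->
  forall x, U x -> {for x, continuous g}.
Proof. by case: k => [|k] []. Qed.

Lemma Ck_derivable {W : normedModType R} k U (g : V -> W) v : Ck k.+1 U g ->
  forall x, U x -> derivable g x v.
Proof. by move=> [_ /(_ v)[]]. Qed.

Lemma Ck_derive {W : normedModType R} k U (g : V -> W) v : Ck k.+1 U g -> Ck k U ('D_v g).
Proof. by move=> [_ /(_ v)[]]. Qed.

Arguments Ck_derivable {W k U g} v _ {x} _.
Arguments Ck_derive {W k U g} v _.

Lemma CkW {W : normedModType R} k U (g : V -> W) : Ck k.+1 U g -> Ck k U g.
Proof.
elim: k g => [|k IH] g; first by move=> [cg _]; split.
move=> [cg dg]; split=> // v; have [dv Dv] := dg v.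
by split=> //; exact: IH.
Qed.

Lemma Ck_le {W : normedModType R} k m U (g : V -> W) : (k <= m)%N -> Ck m U g -> Ck k U g.
Proof.
elim: m => [|m IH]; first by rewrite leqn0 => /eqP ->.
by rewrite leq_eqVlt => /predU1P[->//|]; rewrite ltnS => km /CkW; exact: IH.
Qed.

Lemma Ck_local {W : normedModType R} k U (g : V -> W) :
  (forall x, U x -> exists2 N, N x & Ck k N g) -> Ck k U g.
Proof.
elim: k g => [|k IH] g H; split.
- by move=> x /H[N Nx /Ck_cont]; apply.
- by [].
- by move=> x /H[N Nx /Ck_cont]; apply.
- move=> v; split; first by move=> x /H[N Nx /Ck_derivable]; apply.
  by apply: IH => x /H[N Nx /Ck_derive h]; exists N.
Qed.

Lemma Ck_sub {W : normedModType R} k U N (g : V -> W) : N `<=` U -> Ck k U g -> Ck k N g.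
Proof. by move=> NU cg; apply: Ck_local => x /NU Ux; exists U. Qed.

Lemma eq_derive_on {W : normedModType R} U (f g : V -> W) x v : open U -> U x ->
  (forall y, U y -> f y = g y) -> 'D_v f x = 'D_v g x.
Proof.
move=> oU Ux fg; apply: near_eq_derive.
by apply: filterS (open_nbhs_nbhs (conj oU Ux)) => y; exact: fg.
Qed.

Lemma Ck_eq {W : normedModType R} k U (f g : V -> W) : open U ->
  (forall x, U x -> f x = g x) -> Ck k U f -> Ck k U g.
Proof.
move=> oU; elim: k f g => [|k IH] f g fg cf.
  by split=> // x Ux; apply: (near_eq_cont oU Ux fg); exact: (Ck_cont cf Ux).
split=> [x Ux|v].
  by apply: (near_eq_cont oU Ux fg); exact: (Ck_cont cf Ux).
split=> [x Ux|].
  have /derivableP d := Ck_derivable v cf Ux.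
  by have [] := near_eq_deriv oU Ux fg d.
apply: (IH _ _ _ (Ck_derive v cf)) => x Ux; exact: (eq_derive_on _ oU Ux fg).
Qed.

(** It is enough to know some formula [dg] for the derivatives that is of class
    [C^k]; it need agree with the derivatives on [U] only. *)
Lemma Ck_intro k U g (dg : V -> V -> R) : open U ->
  (forall x v, U x -> is_derive x v g (dg v x)) ->
  (forall x, U x -> {for x, continuous g}) ->
  (forall v, Ck k U (dg v)) -> Ck k.+1 U g.
Proof.
move=> oU d c C; split=> // v; split.
  by move=> x Ux; have [] := d x v Ux.
by apply: (Ck_eq oU _ (C v)) => x Ux; have [_ ->] := d x v Ux.
Qed.

Lemma Ck_cst k U (a : R) : Ck k U (fun=> a).
Proof.
elim: k a => [|k IH] a; split.
- by move=> x _; exact: cvg_cst.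
- by [].
- by move=> x _; exact: cvg_cst.
move=> v; split; first by move=> x _; exact: derivable_cst.
by rewrite (_ : 'D_v _ = fun=> 0)//; apply/funext => x; exact: derive_cst.
Qed.

Lemma CkD k U f g : open U -> Ck k U f -> Ck k U g -> Ck k U (fun x => f x + g x).
Proof.
move=> oU; elim: k f g => [|k IH] f g cf cg.
  by split=> // x Ux; apply: cvgD; [exact: (Ck_cont cf Ux)|exact: (Ck_cont cg Ux)].
apply: (@Ck_intro _ _ _ (fun v x => 'D_v f x + 'D_v g x)) => //.
- move=> x v Ux; apply: is_deriveD; apply: derivableP.
    exact: (Ck_derivable _ cf Ux).
  exact: (Ck_derivable _ cg Ux).
- by move=> x Ux; apply: cvgD; [exact: (Ck_cont cf Ux)|exact: (Ck_cont cg Ux)].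
- by move=> v; apply: IH; apply: Ck_derive.
Qed.

Lemma CkM k U f g : open U -> Ck k U f -> Ck k U g -> Ck k U (fun x => f x * g x).
Proof.
move=> oU; elim: k f g => [|k IH] f g cf cg.
  by split=> // x Ux; apply: cvgM; [exact: (Ck_cont cf Ux)|exact: (Ck_cont cg Ux)].
apply: (@Ck_intro _ _ _ (fun v x => f x * 'D_v g x + g x * 'D_v f x)) => //.
- move=> x v Ux; apply: is_deriveM; apply: derivableP.
    exact: (Ck_derivable _ cf Ux).
  exact: (Ck_derivable _ cg Ux).
- by move=> x Ux; apply: cvgM; [exact: (Ck_cont cf Ux)|exact: (Ck_cont cg Ux)].
- move=> v; apply: CkD => //; apply: IH;
    by [exact: CkW|exact: Ck_derive].
Qed.

Lemma CkZ k U (a : R) f : open U -> Ck k U f -> Ck k U (fun x => a * f x).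
Proof. by move=> oU cf; apply: CkM => //; exact: Ck_cst. Qed.

Lemma CkN k U f : open U -> Ck k U f -> Ck k U (fun x => - f x).
Proof.
move=> oU /(CkZ (-1) oU); apply: Ck_eq => // x _; exact: mulN1r.
Qed.

Lemma CkB k U f g : open U -> Ck k U f -> Ck k U g -> Ck k U (fun x => f x - g x).
Proof. by move=> oU cf cg; apply: CkD => //; exact: CkN. Qed.

Lemma CkV k U f : open U -> (forall x, U x -> f x != 0) -> Ck k U f ->
  Ck k U (fun x => (f x)^-1).
Proof.
move=> oU f0; elim: k => [|k IH] cf.
  by split=> // x Ux; apply: cvgV; [exact: f0|exact: (Ck_cont cf Ux)].
apply: (@Ck_intro _ _ _ (fun v x => - ((f x)^-1 * (f x)^-1 * 'D_v f x))) => //.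
- move=> x v Ux; have dv := Ck_derivable v cf Ux; split.
    by apply: derivableV => //; exact: f0.
  by rewrite deriveV ?f0// [_ *: _]mulNr -invfM expr2.
- by move=> x Ux; apply: cvgV; [exact: f0|exact: (Ck_cont cf Ux)].
- move=> v; have iV := IH (CkW cf); apply: CkN => //; apply: CkM => //; first exact: CkM.
  exact: Ck_derive.
Qed.

Lemma Ck_deriveC U f v w x : open U -> Ck 2 U f -> U x ->
  'D_w ('D_v f) x = 'D_v ('D_w f) x.
Proof.
move=> oU cf Ux; have [r r0 rP] := open_normP oU Ux.
have cv := Ck_derive v cf; have cw := Ck_derive w cf.
apply: (deriveC r0).
- by move=> y /rP Uy; split; exact: (Ck_derivable _ cf Uy).
- by move=> y /rP Uy; split; [exact: (Ck_derivable _ cv Uy)|exact: (Ck_derivable _ cw Uy)].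
- exact: (Ck_cont (Ck_derive w cv) Ux).
- exact: (Ck_cont (Ck_derive v cw) Ux).
Qed.

Lemma C1_is_derive_sum U f x (I : Type) (s : seq I) (a : I -> R) (e : I -> V) :
  open U -> Ck 1 U f -> U x ->
  is_derive x (\sum_(i <- s) a i *: e i) f (\sum_(i <- s) a i * 'D_(e i) f x).
Proof.
move=> oU cf Ux; have [r r0 rP] := open_normP oU Ux.
elim: s => [|i s IH]; first by rewrite !big_nil; exact: is_derive0.
rewrite !big_cons addrC [X in is_derive _ _ _ X]addrC.
have -> : a i * 'D_(e i) f x = 'D_(a i *: e i) f x.
  by have [_ ->] := derive_scale (a i) (Ck_derivable (e i) cf Ux : derivable f x (e i)).
apply: (is_derive_addv r0 IH).
  by move=> y /rP Uy; exact: (Ck_derivable _ cf Uy).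
exact: (Ck_cont (Ck_derive _ cf) Ux).
Qed.

End CkCalculus.

Arguments Ck_derivable {R V W k U g} v _ {x} _.

(** * Real coordinates of quaternions *)

Section QuaternionCoordinates.
Context {R : realType}.
Implicit Types (x y w : quat R) (t : R).

Lemma ord4_ind (P : 'I_4 -> Prop) : P 0 -> P 1 -> P 2 -> P 3 -> forall l, P l.
Proof.
move=> P0 P1 P2 P3 [[|[|[|[|//]]]] lt4].
- by rewrite (_ : Ordinal _ = 0)//; exact: val_inj.
- by rewrite (_ : Ordinal _ = 1)//; exact: val_inj.
- by rewrite (_ : Ordinal _ = 2)//; exact: val_inj.
- by rewrite (_ : Ordinal _ = 3)//; exact: val_inj.
Qed.

Lemma sum4 (W : zmodType) (F : 'I_4 -> W) : \sum_(l < 4) F l = F 0 + F 1 + F 2 + F 3.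
Proof.
rewrite !big_ord_recl big_ord0 addr0 !addrA.
by congr (_ + _ + _ + _); congr F; exact: val_inj.
Qed.

Lemma mkq0 (a b c d : R) : mkq a b c d 0 0 = a. Proof. by rewrite mxE. Qed.
Lemma mkq1 (a b c d : R) : mkq a b c d 0 1 = b. Proof. by rewrite mxE. Qed.
Lemma mkq2 (a b c d : R) : mkq a b c d 0 2 = c. Proof. by rewrite mxE. Qed.
Lemma mkq3 (a b c d : R) : mkq a b c d 0 3 = d. Proof. by rewrite mxE. Qed.
Definition mkqE := (mkq0, mkq1, mkq2, mkq3).

Lemma quat_eqP x y : x 0 0 = y 0 0 -> x 0 1 = y 0 1 -> x 0 2 = y 0 2 ->
  x 0 3 = y 0 3 -> x = y.
Proof. by move=> *; apply/rowP; apply: ord4_ind. Qed.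

Lemma coordD x y l : (x + y) 0 l = x 0 l + y 0 l. Proof. by rewrite mxE. Qed.
Lemma coordB x y l : (x - y) 0 l = x 0 l - y 0 l. Proof. by rewrite !mxE. Qed.
Lemma coordN x l : (- x) 0 l = - x 0 l. Proof. by rewrite mxE. Qed.
Lemma coordZ t x l : (t *: x) 0 l = t * x 0 l. Proof. by rewrite mxE. Qed.
Definition coordE := (coordD, coordB, coordN, coordZ, mkq0, mkq1, mkq2, mkq3).

Lemma coord_cont l x : {for x, continuous (fun x : quat R => x 0 l)}.
Proof. exact: coord_continuous. Qed.

Lemma is_derive_coord l x w : is_derive x w (fun x : quat R => x 0 l) (w 0 l).
Proof.
apply/is_deriveP => e e0; exists 1 => // h h0 _.
by rewrite coordD coordZ addrAC subrr add0r [_ *: _]mulKf// subrr normr0.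
Qed.

Lemma Ck_coord k (U : set (quat R)) l : open U -> Ck k U (fun x : quat R => x 0 l).
Proof.
move=> oU; case: k => [|k]; first by split=> // x _; exact: coord_cont.
apply: (@Ck_intro _ _ _ _ _ (fun w _ => w 0 l)) => //.
- by move=> x w _; exact: is_derive_coord.
- by move=> x _; exact: coord_cont.
- by move=> w; exact: Ck_cst.
Qed.

Definition imnorm2 x : R := x 0 1 ^+ 2 + x 0 2 ^+ 2 + x 0 3 ^+ 2.
Definition imnorm x : R := Num.sqrt (imnorm2 x).
Definition dotIm w x : R := w 0 1 * x 0 1 + w 0 2 * x 0 2 + w 0 3 * x 0 3.
(** The point of the closed upper half plane corresponding to the sphere through
    [x]: the values of a stem function on [D] are read off at [axial x]. *)
Definition axial x : R * R := (x 0 0, imnorm x).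

Lemma imnorm2_ge0 x : 0 <= imnorm2 x.
Proof. by rewrite !addr_ge0 ?sqr_ge0. Qed.

Lemma imnorm_ge0 x : 0 <= imnorm x. Proof. exact: sqrtr_ge0. Qed.

Lemma imnorm2E x : imnorm2 x = imnorm x ^+ 2.
Proof. by rewrite sqr_sqrtr ?imnorm2_ge0. Qed.

Lemma imnorm2_eq0 x : (imnorm2 x == 0) = (imnorm x == 0).
Proof. by rewrite imnorm2E sqrf_eq0. Qed.

Lemma imnorm_eq0_coord x : imnorm x = 0 -> [/\ x 0 1 = 0, x 0 2 = 0 & x 0 3 = 0].
Proof.
move=> r0; have : imnorm2 x == 0 by rewrite imnorm2E r0 expr0n.
rewrite /imnorm2 !paddr_eq0 ?addr_ge0 ?sqr_ge0// !sqrf_eq0.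
by move=> /andP[/andP[/eqP-> /eqP->] /eqP->].
Qed.

Lemma dotIm_imnorm0 w x : imnorm x = 0 -> dotIm w x = 0.
Proof. by move=> /imnorm_eq0_coord[h1 h2 h3]; rewrite /dotIm h1 h2 h3 !mulr0 !addr0. Qed.

Lemma imnorm2_cont x : {for x, continuous imnorm2}.
Proof.
have c l : {for x, continuous (fun x : quat R => x 0 l ^+ 2)}.
  apply: (@continuous_comp _ _ _ (fun x : quat R => x 0 l) (fun y : R => y ^+ 2)).
    exact: coord_cont.
  exact: exprn_continuous.
exact: (cvgD (cvgD (c 1) (c 2)) (c 3)).
Qed.

Lemma imnorm_cont x : {for x, continuous imnorm}.
Proof.
by apply: (@continuous_comp _ _ _ imnorm2 Num.sqrt); [exact: imnorm2_cont|exact: sqrt_continuous].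
Qed.

Lemma axial_cont x : {for x, continuous axial}.
Proof. by apply: cont_pair; [exact: coord_cont|exact: imnorm_cont]. Qed.

Lemma Ck_imnorm2 k (U : set (quat R)) : open U -> Ck k U imnorm2.
Proof.
by move=> oU; do ![apply: CkD => //]; rewrite /exprz;
  apply: CkM => //; exact: Ck_coord.
Qed.

Lemma is_derive_imnorm2 x w : is_derive x w imnorm2 (2 * dotIm w x).
Proof.
have d l := is_derive_coord l x w.
apply: is_derive_eq (is_deriveD (is_deriveD
  (is_deriveM (d 1) (d 1)) (is_deriveM (d 2) (d 2))) (is_deriveM (d 3) (d 3))) _.
by rewrite /dotIm /GRing.scale /=; ring.
Qed.

Lemma is_derive_imnorm x w : imnorm x != 0 -> is_derive x w imnorm (dotIm w x / imnorm x).
Proof.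
move=> r0; have p0 : 0 < imnorm2 x by rewrite lt_neqAle eq_sym imnorm2_eq0 r0 imnorm2_ge0.
have := is_derive_comp1 (is_derive_imnorm2 x w) (is_derive1_sqrt p0).
move=> H; apply: is_derive_eq H _; rewrite -/(imnorm x) invfM.
by field.
Qed.

(** The real part is fixed and the imaginary part multiplied by [t]; in this form
    linearity in [x] and joint continuity are visible. *)
Definition imscale t x : quat R := t *: x + ((1 - t) * x 0 0) *: delta_mx 0 0.

Lemma imscale0 t x : imscale t x 0 0 = x 0 0.
Proof. by rewrite !coordE mxE/=; ring. Qed.

Lemma imscale_im t x l : l != 0 -> imscale t x 0 l = t * x 0 l.
Proof. by move=> l0; rewrite !coordE mxE eqxx/= (negbTE l0) mulr0 addr0. Qed.

Lemma imnorm_imscale t x : 0 <= t -> imnorm (imscale t x) = t * imnorm x.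
Proof.
move=> t0; rewrite /imnorm (_ : imnorm2 _ = t ^+ 2 * imnorm2 x).
  by rewrite sqrtrM ?sqr_ge0// sqrtr_sqr ger0_norm.
by rewrite /imnorm2 !imscale_im//; ring.
Qed.

Lemma axial_imscale t x : 0 <= t -> axial (imscale t x) = (x 0 0, t * imnorm x).
Proof. by move=> t0; rewrite /axial imscale0 imnorm_imscale. Qed.

Lemma imscale_line t x h w : imscale t (x + h *: w) = imscale t x + h *: imscale t w.
Proof.
rewrite /imscale !coordE scalerDr scalerDr !scalerA addrACA; congr (_ + _ + _).
  by rewrite mulrC.
by rewrite -scalerDl; congr (_ *: _); ring.
Qed.

Lemma is_derive_imscale (g : quat R -> R) t x w l :
  is_derive (imscale t x) (imscale t w) g l ->
  is_derive x w (fun y => g (imscale t y)) l.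
Proof.
move=> /is_deriveP H; apply/is_deriveP => e /H[d d0 dP]; exists d => // h h0 hd.
by rewrite imscale_line; exact: dP.
Qed.

Lemma imscale_joint_cont t x :
  {for (t, x), continuous (fun p : R * quat R => imscale p.1 p.2)}.
Proof.
have c1 : {for (t, x), continuous (fun p : R * quat R => p.1)} by exact: cvg_fst.
have c2 : {for (t, x), continuous (fun p : R * quat R => p.2)} by exact: cvg_snd.
have c3 : {for (t, x), continuous (fun p : R * quat R => p.2 0 0)}.
  by apply: (@continuous_comp _ _ _ snd (fun y : quat R => y 0 0)) => //; exact: coord_cont.
apply: cvgD; first by apply: cvgZ; [exact: c1|exact: c2].
apply: cvgZr_tmp; apply: cvgM; last exact: c3.
by apply: cvgB; [exact: cvg_cst|exact: c1].
Qed.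

End QuaternionCoordinates.

(** * Means over the shrinking of the imaginary part *)

Section SphericalParts.
Context {R : realType}.
Implicit Types (D : set (R * R)) (N U : set (quat R)) (u v : R * R -> R).
Implicit Types (x y w : quat R) (g : quat R -> R).
Local Notation dx u := ('D_((1, 0) : R * R) u).
Local Notation dy u := ('D_((0, 1) : R * R) u).
Local Notation partial l g := ('D_(delta_mx 0 l) g).

(** The powers of [t] are needed for stability under differentiation: a derivative
    in an imaginary direction brings out one factor [t]. *)
Definition imscale_mean (m : nat) g y : R :=
  integ 0 1 (fun t => t ^+ m * g (imscale t y)).

Lemma Ck_imscale_mean k m N g : open N ->
  (forall t y, 0 <= t <= 1 -> N y -> N (imscale t y)) ->
  Ck k N g -> Ck k N (imscale_mean m g).
Proof.
move=> oN sN.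
have jc m' g' : (forall y, N y -> {for y, continuous g'}) ->
    joint_cont 0 1 N (fun t y => t ^+ m' * g' (imscale t y)).
  move=> cg t y tI Ny; apply: cvgM.
    by apply: (@continuous_comp _ _ _ fst (fun t : R => t ^+ m'));
      [exact: cvg_fst|exact: exprn_continuous].
  apply: (@continuous_comp _ _ _ (fun p : R * quat R => imscale p.1 p.2) g').
    exact: imscale_joint_cont.
  by apply: cg; exact: sN.
elim: k m g => [|k IH] m g cg.
  by split=> // y Ny; apply: (param_cont ler01 oN (jc m g (fun y Ny => Ck_cont cg Ny))).
have cgd l y : N y -> {for y, continuous (partial l g)}.
  by move=> Ny; exact: (Ck_cont (Ck_derive _ cg)).
have dg w t y : N (imscale t y) -> is_derive y w (fun y => t ^+ m * g (imscale t y))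
  (w 0 0 * (t ^+ m * partial 0 g (imscale t y)) +
   (w 0 1 * (t ^+ m.+1 * partial 1 g (imscale t y)) +
   (w 0 2 * (t ^+ m.+1 * partial 2 g (imscale t y)) +
    w 0 3 * (t ^+ m.+1 * partial 3 g (imscale t y))))).
  move=> Nt.
  have cg1 : Ck 1 N g by apply: Ck_le cg.
  have := C1_is_derive_sum (index_enum 'I_4) (fun l => imscale t w 0 l)
    (fun l => delta_mx 0 l) oN cg1 Nt.
  rewrite -row_sum_delta sum4 => /is_derive_imscale H.
  apply: is_derive_eq (@is_deriveZ _ _ _ _ (t ^+ m) _ _ _ H) _.
  rewrite imscale0 !imscale_im//.
  move: (partial 0 g _) (partial 1 g _) (partial 2 g _) (partial 3 g _) => a b c d.
  by rewrite /GRing.scale /= exprSr; ring.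
have cI a l y : N y -> cont_on 0 1 (fun t => t ^+ a * partial l g (imscale t y)).
  by move=> Ny; apply: (joint_cont_on (jc a _ (cgd l)) Ny).
(* Near the ends of the segment the formula for the derivative is used for t
   slightly outside of it, where imscale t y still lies in the open set N. *)
have jcw w : joint_cont 0 1 N (fun t => 'D_w (fun y => t ^+ m * g (imscale t y))).
  move=> t y tI Ny.
  have c a l : {for (t, y), continuous (fun p : R * quat R =>
      w 0 l * (p.1 ^+ a * partial l g (imscale p.1 p.2)))}.
    by apply: cvgMr; exact: (jc a _ (cgd l) t y tI Ny).
  have [d d0 dP] := open_normP oN (sN t y tI Ny).
  have /contP/(_ _ d0)[d' d'0 d'P] := @imscale_joint_cont R t y.
  apply/contP => e e0.
  have cc : {for (t, y), continuous (fun p : R * quat R =>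
      w 0 0 * (p.1 ^+ m * partial 0 g (imscale p.1 p.2)) +
      (w 0 1 * (p.1 ^+ m.+1 * partial 1 g (imscale p.1 p.2)) +
      (w 0 2 * (p.1 ^+ m.+1 * partial 2 g (imscale p.1 p.2)) +
       w 0 3 * (p.1 ^+ m.+1 * partial 3 g (imscale p.1 p.2)))))}.
    exact: (cvgD (c m 0) (cvgD (c m.+1 1) (cvgD (c m.+1 2) (c m.+1 3)))).
  have /contP/(_ _ e0)[d2 d20 d2P] := cc.
  exists (Num.min d' d2); first by rewrite lt_min d'0.
  move=> p; rewrite lt_min => /andP[/d'P/dP Np /d2P].
  have [_ ->] := dg w p.1 p.2 Np.
  by have [_ ->] := dg w t y (sN t y tI Ny).
apply: (@Ck_intro _ _ _ _ _ (fun w y =>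
  w 0 0 * imscale_mean m (partial 0 g) y +
  (w 0 1 * imscale_mean m.+1 (partial 1 g) y +
  (w 0 2 * imscale_mean m.+1 (partial 2 g) y +
   w 0 3 * imscale_mean m.+1 (partial 3 g) y)))) => //.
- move=> y w Ny.
  have dK t x : 0 <= t <= 1 -> N x -> derivable (fun y => t ^+ m * g (imscale t y)) x w.
    by move=> tI Nx; have [] := dg w t x (sN t x tI Nx).
  have := param_derive ler01 oN (jc m g (fun y Ny => Ck_cont cg Ny)) dK (jcw w) Ny.
  congr (is_derive _ _ _ _).
  rewrite (@eq_integ _ _ _ _ (fun t => w 0 0 * (t ^+ m * partial 0 g (imscale t y)) +
   (w 0 1 * (t ^+ m.+1 * partial 1 g (imscale t y)) +
   (w 0 2 * (t ^+ m.+1 * partial 2 g (imscale t y)) +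
    w 0 3 * (t ^+ m.+1 * partial 3 g (imscale t y)))))); last first.
    by move=> t tI; have [_ ->] := dg w t y (sN t y tI Ny).
  have cZ a l : cont_on 0 1 (fun t => w 0 l * (t ^+ a * partial l g (imscale t y))).
    by move=> t tI; apply: cvgMr; exact: (cI a l y Ny t tI).
  have cD f1 f2 : cont_on 0 1 f1 -> cont_on 0 1 f2 -> cont_on 0 1 (fun t => f1 t + f2 t : R).
    by move=> c1 c2 t tI; apply: cvgD; [exact: c1|exact: c2].
  rewrite integD ?integZ; [|exact: cI|exact: cZ|exact: (cD _ _ (cZ _ _) (cD _ _ (cZ _ _) (cZ _ _)))].
  rewrite integD ?integZ; [|exact: cI|exact: cZ|exact: (cD _ _ (cZ _ _) (cZ _ _))].
  by rewrite integD ?integZ; [|exact: cI|exact: cI|exact: cZ|exact: cZ].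
- by move=> y Ny; apply: (param_cont ler01 oN (jc m g (fun y Ny => Ck_cont cg Ny))).
- move=> w; have C l a : Ck k N (fun y => w 0 l * imscale_mean a (partial l g) y).
    by apply: CkZ => //; apply: IH; exact: Ck_derive.
  by do 3 (apply: CkD => //).
Qed.

End SphericalParts.

(** * Spherical values and spherical derivatives of stem functions *)

Section StemPairs.
Context {R : realType}.
Implicit Types (D : set (R * R)) (U : set (quat R)) (u v : R * R -> R).
Implicit Types (x y w : quat R).
Local Notation dx u := ('D_((1, 0) : R * R) u).
Local Notation dy u := ('D_((0, 1) : R * R) u).

(** What remains of a holomorphic stem function in one complex coordinate
    [u + i v]. *)
Definition stem_pair D u v := [/\ CR D u v,
  forall z, D z -> u (cconj z) = u z & forall z, D z -> v (cconj z) = - v z].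

Definition sph_value u x : R := u (axial x).
(** The quotient [v / beta] at [axial x]; on the real axis its limit is
    [dv/dbeta = du/dalpha]. *)
Definition sph_deriv u v x : R :=
  if imnorm x == 0 then dx u ((x : quat R) 0 0, 0) else v (axial x) / imnorm x.

Lemma is_derive_mulr (b t : R) : is_derive t (1 : R) (fun h : R => h * b) b.
Proof.
apply/is_deriveP => e e0; exists 1 => // h h0 _.
rewrite (_ : _ - b = 0) ?normr0// /GRing.scale /=; by field.
Qed.

Lemma is_derive_affine (a b t : R) : is_derive t (1 : R) (fun h : R => a + h * b) b.
Proof.
apply/is_deriveP => e e0; exists 1 => // h h0 _.
rewrite (_ : _ - b = 0) ?normr0// /GRing.scale /=; by field.
Qed.

Variable D : set (R * R).
Hypothesis D_open : open D.
Hypothesis D_conj : forall z, D z -> D (cconj z).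

Let Om : set (quat R) := [set x | D (axial x)].

Lemma Om_open : open Om.
Proof. by apply: open_comp D_open => x _; exact: axial_cont. Qed.

Lemma is_derive_conj u z (w : R * R) : (forall z, D z -> differentiable u z) -> D z ->
  is_derive z w (fun z => u (cconj z))
    (w.1 * dx u (cconj z) - w.2 * dy u (cconj z)).
Proof.
move=> du Dz; rewrite -mulNr.
have d2 : is_derive z w (fun z : R * R => - z.2) (- w.2).
  by apply: is_deriveN; exact: is_derive_snd.
exact: (is_derive_comp2 (is_derive_fst z w) d2 (du _ (D_conj Dz))).
Qed.

Lemma stem_pair_derive u v : stem_pair D u v -> stem_pair D (dx u) (dx v).
Proof.
move=> [cr ue vo]; split; first exact: CR_derive.
- move=> z Dz; have du z1 : D z1 -> differentiable u z1 by move=> /cr[].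
  have [_] := near_eq_deriv D_open Dz ue (is_derive_conj (1, 0) du Dz).
  by rewrite mul1r mul0r subr0 => ->.
- move=> z Dz; have dv z1 : D z1 -> differentiable v z1 by move=> /cr[].
  have [_] := near_eq_deriv D_open Dz vo (is_derive_conj (1, 0) dv Dz).
  rewrite mul1r mul0r subr0 => <-.
  by apply: deriveN; apply: diff_derivable; exact: dv.
Qed.

Lemma odd_real v (a : R) : (forall z, D z -> v (cconj z) = - v z) -> D (a, 0) -> v (a, 0) = 0.
Proof.
move=> vo Da; have := vo _ Da; rewrite /cconj /= oppr0 => /eqP.
by rewrite -addr_eq0 -mulr2n mulrn_eq0 => /eqP.
Qed.

(** At a real point the norm of the imaginary part is not differentiable, but on
    the line through [x] in direction [w] the axial point is
    [(x0 + h w0, |h| |Im w|)], and the evenness of [u] in the second variable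
    removes the absolute value. *)
Lemma sph_value_derive u v x w : stem_pair D u v -> Om x ->
  is_derive x w (sph_value u)
    (w 0 0 * sph_value (dx u) x - dotIm w x * sph_deriv (dx u) (dx v) x).
Proof.
move=> sp Ox; have [cr ue vo] := sp; have [cr' ue' vo'] := stem_pair_derive sp.
have [du dv e1 e2] := cr _ Ox.
rewrite /sph_deriv; case: ifPn => [/eqP r0|r0].
- rewrite dotIm_imnorm0// mul0r subr0 /sph_value.
  have Ex : axial x = (x 0 0, 0) by rewrite /axial r0.
  rewrite !Ex in du dv e1 e2 *.
  have Dx0 : D (x 0 0, 0) by rewrite -Ex.
  have [d d0 dP] := open_normP D_open Dx0.
  apply/is_derive_lineP.
  pose p (h : R) := x 0 0 + h * w 0 0; pose q (h : R) := h * imnorm w.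
  have dp : is_derive 0 (1 : R) p (w 0 0) by exact: is_derive_affine.
  have dq : is_derive 0 (1 : R) q (imnorm w) by exact: is_derive_mulr.
  have p0 : p 0 = x 0 0 by rewrite /p mul0r addr0.
  have q0 : q 0 = 0 by rewrite /q mul0r.
  have du0 : differentiable u (p 0, q 0) by rewrite p0 q0.
  have := is_derive_comp2 dp dq du0; rewrite p0 q0 e2 (odd_real vo' Dx0) oppr0 mulr0 addr0.
  have N0 : 0 < `|w 0 0| + imnorm w + 1 by rewrite ltr_wpDl// addr_ge0// imnorm_ge0.
  apply: near_eq_is_derive; apply/nbhs_normP; exists (d / (`|w 0 0| + imnorm w + 1)).
    by rewrite /= divr_gt0.
  move=> h; rewrite /ball_/= sub0r normrN ltr_pdivlMr// => hd.
  have rw : imnorm (x + h *: w) = `|h| * imnorm w.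
    have [x1 x2 x3] := imnorm_eq0_coord r0.
    rewrite /imnorm (_ : imnorm2 _ = h ^+ 2 * imnorm2 w); first by rewrite sqrtrM ?sqr_ge0// sqrtr_sqr.
    by rewrite /imnorm2 !coordE x1 x2 x3; ring.
  rewrite /axial rw !coordE /p /q.
  have [h0|h0] := leP 0 h; first by rewrite ger0_norm.
  rewrite ltr0_norm// mulNr; symmetry; apply: (ue (x 0 0 + h * w 0 0, h * imnorm w)).
  apply: dP; rewrite [ltLHS]prod_normE/= gt_max addrC addKr subr0 !normrM.
  rewrite (ger0_norm (imnorm_ge0 w)).
  rewrite !(le_lt_trans _ hd)// ler_wpM2l//.
    by rewrite addrAC lerDr addr_ge0.
  by rewrite -addrA lerDl addr_ge0// imnorm_ge0.
- have H := is_derive_comp2 (is_derive_coord 0 x w) (is_derive_imnorm w r0) du.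
  apply: is_derive_eq H _.
  rewrite -/(axial x) e2 /sph_value mulrN; congr (_ - _).
  by rewrite mulrAC mulrA.
Qed.

Lemma nonreal_open : open [set x : quat R | imnorm x != 0].
Proof.
rewrite (_ : [set x | _] = imnorm @^-1` [set y | y != 0]) //.
apply: open_comp => [x _|]; first exact: imnorm_cont.
exact: open_neq.
Qed.

(** The last factor is [(1/beta) d/dbeta (v/beta)], by [dv/dbeta = du/dalpha]. *)
Lemma sph_deriv_derive u v x w : stem_pair D u v -> Om x -> imnorm x != 0 ->
  is_derive x w (sph_deriv u v)
    (w 0 0 * sph_deriv (dx u) (dx v) x +
     dotIm w x * ((imnorm2 x)^-1 * (sph_value (dx u) x - sph_deriv u v x))).
Proof.
move=> [cr _ _] Ox r0; have [du dv e1 e2] := cr _ Ox.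
apply: (near_eq_deriv (f := fun y => v (y 0 0, imnorm y) * (imnorm y)^-1) nonreal_open r0).
  by move=> y /negbTE ry; rewrite /sph_deriv ry.
have dr := is_derive_imnorm w r0.
have H := is_derive_comp2 (is_derive_coord 0 x w) dr dv.
have di : is_derive x w (fun y => (imnorm y)^-1) (- imnorm x ^- 2 * (dotIm w x / imnorm x)).
  by split; [exact: derivableV|rewrite deriveV//; have [_ ->] := dr].
apply: is_derive_eq (is_deriveM H di) _.
rewrite -/(axial x) -e1 imnorm2E /sph_deriv (negbTE r0) /sph_value /GRing.scale /=.
by move: (dx u _) (dx v _) (v _) => a b c; field.
Qed.

(** Since [dv/dbeta = du/dalpha] and [v] vanishes on the real axis, [v / beta] is
    the mean of [du/dalpha] over the segment from [(alpha, 0)] to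
    [(alpha, beta)]. This is how regularity crosses the real axis. *)
Lemma sph_deriv_mean u v x : stem_pair D u v ->
  (forall t, 0 <= t <= 1 -> Om (imscale t x)) ->
  sph_deriv u v x = imscale_mean 0 (sph_value (dx u)) x.
Proof.
move=> [cr ue vo] Ot; rewrite /imscale_mean.
have tE t : 0 <= t <= 1 -> axial (imscale t x) = (x 0 0, t * imnorm x).
  by move=> /andP[t0 _]; exact: axial_imscale.
have Dt t : 0 <= t <= 1 -> D (x 0 0, t * imnorm x).
  by move=> tI; rewrite -tE//; exact: Ot.
have Dx0 : D (x 0 0, 0) by have := Dt 0; rewrite lexx ler01 mul0r; apply.
rewrite (@eq_integ _ _ _ _ (fun t => dx u (x 0 0, t * imnorm x))); last first.
  by move=> t tI; rewrite expr0 mul1r /sph_value tE.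
have dl (t : R) := is_derive_mulr (imnorm x) t.
have ct g : (forall z, D z -> {for z, continuous g}) ->
    cont_on 0 1 (fun t => g (x 0 0, t * imnorm x) : R).
  move=> cg t tI; apply: (@continuous_comp _ _ _ (fun t : R => (x 0 0, t * imnorm x)) g).
    apply: cont_pair; first exact: cvg_cst.
    by apply/differentiable_continuous/derivable1_diffP; have [] := dl t.
  exact/cg/Dt.
have cxu := ct _ (CR_cont_derive D_open cr).
rewrite /sph_deriv; case: ifPn => [/eqP r0|r0].
  rewrite (@eq_integ _ _ _ _ (fun t => dx u (x 0 0, 0))).
    rewrite (integ_FTC ler01 _ (fun t _ => is_derive_mulr (dx u (x 0 0, 0)) t)).
      by rewrite mul1r mul0r subr0.
    by move=> t _; exact: cvg_cst.
  by move=> t _; rewrite r0 mulr0.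
have dv (t : R) : 0 <= t <= 1 ->
    is_derive t (1 : R) (fun t => (imnorm x)^-1 * v (x 0 0, t * imnorm x)) (dx u (x 0 0, t * imnorm x)).
  move=> tI; have [_ dv e1 _] := cr _ (Dt t tI).
  have H := is_derive_comp2 (is_derive_cst (x 0 0) t (1 : R)) (dl t) dv.
  apply: is_derive_eq (@is_deriveZ _ _ _ _ (imnorm x)^-1 _ _ _ H) _.
  by rewrite mul0r add0r -e1 [_ *: _]mulKf.
rewrite (integ_FTC ler01 cxu dv).
by rewrite mul1r mul0r (odd_real vo)// mulr0 subr0 mulrC.
Qed.

End StemPairs.

(** * Regularity across the real axis *)

Section SphericalRegularity.
Context {R : realType}.
Implicit Types (U : set (quat R)) (u v : R * R -> R) (x y w : quat R).
Local Notation dx u := ('D_((1, 0) : R * R) u).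

Lemma nonreal_near x (d : R) : 0 < d -> exists2 y, `|y - x| < d & imnorm y != 0.
Proof.
move=> d0; have [r0|r0] := eqVneq (imnorm x) 0; last first.
  by exists x => //; rewrite subrr normr0.
pose a : quat R := delta_mx 0 1.
have N0 : 0 < `|a| + 1 by rewrite ltr_wpDl.
pose h := d / 2 / (`|a| + 1).
have h0 : 0 < h by rewrite !divr_gt0.
exists (x + h *: a).
  rewrite addrC addKr normrZ gtr0_norm//.
  apply: (@le_lt_trans _ _ (h * (`|a| + 1))); first by rewrite ler_pM2l// lerDl.
  by rewrite divfK ?gt_eqF// ltr_pdivrMr// ltr_pMr// ltr1n.
have [x1 x2 x3] := imnorm_eq0_coord r0.
rewrite -imnorm2_eq0 /imnorm2 !coordE !mxE x1 x2 x3 /= !mulr0 !addr0 mulr1 add0r.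
by rewrite expr0n/= !addr0 sqrf_eq0 gt_eqF.
Qed.

Variable D : set (R * R).
Hypothesis D_open : open D.
Hypothesis D_conj : forall z, D z -> D (cconj z).

Let Om : set (quat R) := [set x | D (axial x)].
Let Om_open : open Om := @Om_open R D D_open.
Let On : set (quat R) := Om `&` [set x | imnorm x != 0].

Lemma On_open : open On.
Proof. by apply: openI; [exact: Om_open|exact: nonreal_open]. Qed.

Lemma Ck_dotIm k U w : open U -> Ck k U (dotIm w).
Proof.
move=> oU; have c l : Ck k U (fun x => w 0 l * x 0 l).
  by apply: CkZ => //; exact: Ck_coord.
exact: (CkD oU (CkD oU (c 1) (c 2)) (c 3)).
Qed.

(** Stability under shrinking the imaginary part makes the integral formula for
    the spherical derivative valid on the whole of [N]. *)
Lemma real_nbhs x : Om x -> imnorm x = 0 -> exists N : set (quat R),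
  [/\ N x, open N, N `<=` Om &
      forall t y, 0 <= t <= 1 -> N y -> N (imscale t y)].
Proof.
move=> Ox r0; have Dx : D (x 0 0, 0) by rewrite -r0.
have [d d0 dP] := open_normP D_open Dx.
pose B := [set z : R * R | `|z - (x 0 0, 0)| < d].
have oB : open B.
  rewrite (_ : B = ball ((x 0 0, 0) : R * R) d); first exact: ball_open.
  by apply/seteqP; split => y; rewrite /B -ball_normE /ball_/= distrC.
exists [set y | B (axial y)]; split.
- by rewrite /B /= /axial r0 subrr normr0.
- by apply: open_comp oB => y _; exact: axial_cont.
- by move=> y /dP.
- move=> t y /andP[t0 t1]; rewrite /B /= axial_imscale// => H.
  rewrite [ltLHS]prod_normE/= gt_max.
  rewrite [ltLHS]prod_normE/= gt_max in H; case/andP: H => -> /=.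
  rewrite !subr0 normrM; apply: le_lt_trans.
  by rewrite ler_piMl// ger0_norm.
Qed.

Lemma Ck_sph_deriv_real k u v x : stem_pair D u v -> Om x -> imnorm x = 0 ->
  Ck k Om (sph_value (dx u)) -> exists2 N, N x & Ck k N (sph_deriv u v).
Proof.
move=> sp Ox r0 cV; have [N [Nx oN NO sN]] := real_nbhs Ox r0.
exists N => //; apply: (Ck_eq oN _ (Ck_imscale_mean 0 oN sN (Ck_sub NO cV))).
move=> y Ny; rewrite (sph_deriv_mean D_open sp)// => t tI.
by apply: NO; exact: sN.
Qed.

(** All stem pairs are handled together, since the derivatives of a spherical
    value or derivative are expressed by those of the derived stem pair: spherical
    values gain one order from the induction hypothesis, then so do spherical
    derivatives, by the same formulas away from the real axis and by the integral
    formula near it. *)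
Lemma Ck_sph k u v : stem_pair D u v ->
  Ck k Om (sph_value u) /\ Ck k Om (sph_deriv u v).
Proof.
elim: k u v => [|k IH] u v sp; have [cr _ _] := sp; have sp' := stem_pair_derive D_open D_conj sp.
- have cV u' v' : stem_pair D u' v' -> Ck 0 Om (sph_value u').
    move=> [cr' _ _]; split=> // x Ox.
    apply: (@continuous_comp _ _ _ axial u'); first exact: axial_cont.
    by have [? _ _ _] := cr' _ Ox; exact: differentiable_continuous.
  split; first exact: cV sp.
  apply: Ck_local => x Ox; have [r0|r0] := eqVneq (imnorm x) 0.
    exact: Ck_sph_deriv_real sp Ox r0 (cV _ _ sp').
  exists On => //; split=> // y [Oy ry].
  apply: (near_eq_cont (f := fun y => v (axial y) * (imnorm y)^-1) On_open) => //.
    by move=> z [_ /negbTE rz]; rewrite /sph_deriv rz.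
  have ci : {for y, continuous (fun y => (imnorm y)^-1)}.
    exact: (cvgV ry (@imnorm_cont R y)).
  have cv : {for y, continuous (fun y => v (axial y))}.
    apply: (@continuous_comp _ _ _ axial v); first exact: axial_cont.
    by have [_ ? _ _] := cr _ Oy; exact: differentiable_continuous.
  exact: (cvgM cv ci).
- have cV u' v' : stem_pair D u' v' -> Ck k.+1 Om (sph_value u').
    move=> spu; have [c1 c2] := IH _ _ (stem_pair_derive D_open D_conj spu).
    have [c0 _] := IH _ _ spu.
    apply: (@Ck_intro _ _ _ _ _ (fun w x => w 0 0 * sph_value (dx u') x -
        dotIm w x * sph_deriv (dx u') (dx v') x)) => //.
    + by move=> x w Ox; exact: (sph_value_derive D_open D_conj w spu Ox).
    + by move=> x Ox; exact: (Ck_cont c0 Ox).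
    + move=> w; apply: CkB => //; first exact: CkZ.
      by apply: CkM => //; exact: Ck_dotIm.
  split; first exact: cV sp.
  apply: Ck_local => x Ox; have [r0|r0] := eqVneq (imnorm x) 0.
    exact: Ck_sph_deriv_real sp Ox r0 (cV _ _ sp').
  exists On => //; have [c1 c2] := IH _ _ sp'; have [_ c3] := IH _ _ sp.
  have sO : On `<=` Om by move=> y [].
  have oO := On_open.
  apply: (@Ck_intro _ _ _ _ _ (fun w x => w 0 0 * sph_deriv (dx u) (dx v) x +
     dotIm w x * ((imnorm2 x)^-1 * (sph_value (dx u) x - sph_deriv u v x)))) => //.
  + by move=> y w [Oy ry]; exact: (sph_deriv_derive w sp Oy ry).
  + by move=> y [Oy _]; exact: (Ck_cont c3 Oy).
  + move=> w; apply: CkD => //; first by apply: CkZ => //; exact: Ck_sub sO _.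
    apply: CkM => //; first exact: Ck_dotIm.
    apply: CkM => //; last by apply: CkB => //; exact: Ck_sub sO _.
    apply: CkV => //; first by move=> y [_ ry]; rewrite imnorm2_eq0.
    exact: Ck_imnorm2.
Qed.

Lemma nonreal_dense (f g : quat R -> R) x : Om x ->
  {for x, continuous f} -> {for x, continuous g} ->
  (forall y, On y -> f y = g y) -> f x = g x.
Proof.
move=> Ox cf cg fg; have [r0|r0] := eqVneq (imnorm x) 0; last exact: fg.
apply/eqP; rewrite -subr_eq0 -normr_le0; apply/ler_addgt0Pr => e e0; rewrite add0r.
have [|d1 d10 d1P] := (contP _ _).1 cf (e / 2); first by rewrite divr_gt0.
have [|d2 d20 d2P] := (contP _ _).1 cg (e / 2); first by rewrite divr_gt0.
have [d3 d30 d3P] := open_normP Om_open Ox.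
have d0 : 0 < Num.min d1 (Num.min d2 d3) by rewrite !lt_min d10 d20.
have [y + ry] := nonreal_near x d0.
rewrite !lt_min => /and3P[/d1P h1 /d2P h2 /d3P Oy].
have E := fg _ (conj Oy ry).
have -> : f x - g x = (g y - g x) - (f y - f x).
  by rewrite E; ring.
apply: le_trans (ler_normB _ _) _; rewrite [leRHS]splitr.
by rewrite lerD// ltW.
Qed.

End SphericalRegularity.

(** * The Laplacian on R^4 *)

Section Laplacians.
Context {R : realType}.
Implicit Types (U : set (quat R)) (f g : quat R -> R) (x y w : quat R).

Lemma Ck_partial k U l f : Ck k.+1 U f -> Ck k U (partial l f).
Proof. exact: Ck_derive. Qed.

Lemma Ck_laplacian k U f : open U -> Ck k.+2 U f -> Ck k U (laplacian f).
Proof.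
move=> oU cf; have c l : Ck k U (partial l (partial l f)).
  by apply: Ck_partial; exact: Ck_partial.
apply: (Ck_eq (f := fun x => partial 0 (partial 0 f) x + partial 1 (partial 1 f) x +
  partial 2 (partial 2 f) x + partial 3 (partial 3 f) x)) => //.
  by move=> x _; rewrite /laplacian sum4.
exact: (CkD oU (CkD oU (CkD oU (c 0) (c 1)) (c 2)) (c 3)).
Qed.

Lemma partialD U l f g x : Ck 1 U f -> Ck 1 U g -> U x ->
  partial l (fun y => f y + g y) x = partial l f x + partial l g x.
Proof. by move=> cf cg Ux; apply: deriveD; [exact: (Ck_derivable _ cf Ux)|exact: (Ck_derivable _ cg Ux)]. Qed.

Lemma partialZ U l (a : R) f x : Ck 1 U f -> U x ->
  partial l (fun y => a * f y) x = a * partial l f x.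
Proof. by move=> cf Ux; apply: deriveZ; exact: (Ck_derivable _ cf Ux). Qed.

Lemma eq_partial (W : normedModType R) U l (f g : quat R -> W) x : open U -> U x ->
  (forall y, U y -> f y = g y) -> partial l f x = partial l g x.
Proof. exact: eq_derive_on. Qed.

Lemma eq_laplacian (W : normedModType R) U (f g : quat R -> W) x : open U -> U x ->
  (forall y, U y -> f y = g y) -> laplacian f x = laplacian g x.
Proof.
move=> oU Ux fg; apply: eq_bigr => l _; apply: (eq_partial _ oU Ux) => y Uy.
exact: (eq_partial _ oU Uy fg).
Qed.

Lemma laplacianD U f g x : open U -> Ck 2 U f -> Ck 2 U g -> U x ->
  laplacian (fun y => f y + g y) x = laplacian f x + laplacian g x.
Proof.
move=> oU cf cg Ux; rewrite /laplacian -big_split; apply: eq_bigr => l _ /=.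
rewrite -(partialD l (Ck_partial l cf) (Ck_partial l cg) Ux).
apply: (eq_partial _ oU Ux) => y Uy; exact: (partialD l (CkW cf) (CkW cg) Uy).
Qed.

Lemma laplacianZ U (a : R) f x : open U -> Ck 2 U f -> U x ->
  laplacian (fun y => a * f y) x = a * laplacian f x.
Proof.
move=> oU cf Ux; rewrite /laplacian big_distrr; apply: eq_bigr => l _ /=.
rewrite -(partialZ l a (Ck_partial l cf) Ux).
apply: (eq_partial _ oU Ux) => y Uy; exact: (partialZ l a (CkW cf) Uy).
Qed.

Lemma laplacian_partial U l f x : open U -> Ck 3 U f -> U x ->
  laplacian (partial l f) x = partial l (laplacian f) x.
Proof.
move=> oU cf Ux.
have -> : laplacian f = \sum_(m < 4) partial m (partial m f).
  by apply/funext => y; rewrite fct_sumE.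
have [_ E] := is_derive_sum (fun m =>
  derivableP (Ck_derivable (delta_mx 0 l) (Ck_partial m (Ck_partial m cf)) Ux)).
apply: (etrans _ (esym E)); apply: eq_bigr => m _.
apply: (etrans _ (Ck_deriveC _ _ oU (Ck_partial m cf) Ux)).
apply: (eq_partial _ oU Ux) => y Uy; exact: (Ck_deriveC _ _ oU (CkW cf) Uy).
Qed.

Lemma delta_coord (l m : 'I_4) : (delta_mx 0 l : quat R) 0 m = (m == l)%:R.
Proof. by rewrite mxE. Qed.

Lemma partial_coordM U (i l : 'I_4) f x : open U -> Ck 1 U f -> U x ->
  partial l (fun y : quat R => y 0 i * f y) x = (i == l)%:R * f x + x 0 i * partial l f x.
Proof.
move=> oU cf Ux.
have H := is_deriveM (is_derive_coord i x (delta_mx 0 l)) (derivableP (Ck_derivable _ cf Ux)).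
have [_ E] := H; rewrite [LHS](E : partial l (fun y : quat R => y 0 i * f y) x = _).
by rewrite delta_coord addrC /GRing.scale /= mulrC.
Qed.

Lemma laplacian_coordM U (i : 'I_4) f x : open U -> Ck 2 U f -> U x ->
  laplacian (fun y : quat R => y 0 i * f y) x = 2 * partial i f x + x 0 i * laplacian f x.
Proof.
move=> oU cf Ux; rewrite /laplacian.
transitivity (\sum_(l < 4) ((i == l)%:R * (2 * partial l f x) +
    x 0 i * partial l (partial l f) x)).
  apply: eq_bigr => l _; have c1 := Ck_partial l cf.
  have cM := CkM oU (Ck_coord 1 i oU) c1.
  have cZ := CkZ (i == l)%:R oU (CkW cf).
  apply: (etrans (eq_partial _ oU Ux (fun y Uy => partial_coordM i l oU (CkW cf) Uy))).
  apply: (etrans (partialD l cZ cM Ux)).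
  apply: (etrans (congr2 +%R (partialZ l _ (CkW cf) Ux) (partial_coordM i l oU c1 Ux))).
  by move: (partial l f x) (partial l (partial l f) x) => a b; ring.
rewrite big_split /= -big_distrr /=; congr (_ + _).
rewrite (bigD1 i)//= eqxx mul1r big1 ?addr0// => l /negbTE li.
by rewrite eq_sym li mul0r.
Qed.

End Laplacians.

(** * Harmonicity of the spherical derivative *)

Section SphericalLaplacians.
Context {R : realType}.
Implicit Types (U : set (quat R)) (u v : R * R -> R) (x y w : quat R).
Local Notation dx u := ('D_((1, 0) : R * R) u).

Variable D : set (R * R).
Hypothesis D_open : open D.
Hypothesis D_conj : forall z, D z -> D (cconj z).

Let Om : set (quat R) := [set x | D (axial x)].
Let Om_open : open Om := @Om_open R D D_open.
Let On : set (quat R) := Om `&` [set x | imnorm x != 0].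
Let On_open : open On := @On_open R D D_open.
Let stem' := @stem_pair_derive R D D_open D_conj.

Lemma dotIm_delta0 x : dotIm (delta_mx 0 0) x = 0.
Proof. by rewrite /dotIm !delta_coord /= !mul0r !addr0. Qed.

Lemma dotIm_delta l x : l != 0 -> dotIm (delta_mx 0 l) x = x 0 l.
Proof.
move: l; apply: ord4_ind => // _; rewrite /dotIm !delta_coord /=; ring.
Qed.

Lemma partial0_sph_value u v x : stem_pair D u v -> Om x ->
  partial 0 (sph_value u) x = sph_value (dx u) x.
Proof.
move=> sp Ox; have [_ E] := sph_value_derive D_open D_conj (delta_mx 0 0) sp Ox.
by apply: (etrans E); rewrite dotIm_delta0 delta_coord eqxx mul1r mul0r subr0.
Qed.

Lemma partial_sph_value u v l x : stem_pair D u v -> Om x -> l != 0 ->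
  partial l (sph_value u) x = - (x 0 l * sph_deriv (dx u) (dx v) x).
Proof.
move=> sp Ox l0; have [_ E] := sph_value_derive D_open D_conj (delta_mx 0 l) sp Ox.
apply: (etrans E).
by rewrite dotIm_delta// delta_coord eq_sym (negbTE l0) mul0r sub0r.
Qed.

(** The derivative [(1/beta) d/dbeta] of [v / beta]. *)
Definition sph_deriv2 u v x : R :=
  (imnorm2 x)^-1 * (sph_value (dx u) x - sph_deriv u v x).

Lemma partial0_sph_deriv u v x : stem_pair D u v -> On x ->
  partial 0 (sph_deriv u v) x = sph_deriv (dx u) (dx v) x.
Proof.
move=> sp [Ox rx]; have [_ E] := sph_deriv_derive (delta_mx 0 0) sp Ox rx.
by apply: (etrans E); rewrite dotIm_delta0 delta_coord eqxx mul1r mul0r addr0.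
Qed.

Lemma partial_sph_deriv u v l x : stem_pair D u v -> On x -> l != 0 ->
  partial l (sph_deriv u v) x = x 0 l * sph_deriv2 u v x.
Proof.
move=> sp [Ox rx] l0; have [_ E] := sph_deriv_derive (delta_mx 0 l) sp Ox rx.
apply: (etrans E).
by rewrite dotIm_delta// delta_coord eq_sym (negbTE l0) mul0r add0r.
Qed.

Lemma sph_deriv2_derive u v l x : stem_pair D u v -> On x -> l != 0 ->
  is_derive x (delta_mx 0 l) (sph_deriv2 u v)
    (- (imnorm2 x)^-1 * x 0 l *
      (3 * sph_deriv2 u v x + sph_deriv (dx (dx u)) (dx (dx v)) x)).
Proof.
move=> sp [Ox rx] l0; have r20 : imnorm2 x != 0 by rewrite imnorm2_eq0.
have dr := is_derive_imnorm2 x (delta_mx 0 l).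
have di : is_derive x (delta_mx 0 l : quat R) (fun y => (imnorm2 y)^-1)
    (- imnorm2 x ^- 2 * (2 * dotIm (delta_mx 0 l) x)).
  by split; [exact: derivableV|rewrite deriveV//; have [_ ->] := dr].
have dV := sph_value_derive D_open D_conj (delta_mx 0 l) (stem' sp) Ox.
have dS := sph_deriv_derive (delta_mx 0 l) sp Ox rx.
apply: is_derive_eq (is_deriveM di (is_deriveB dV dS)) _.
rewrite dotIm_delta// !delta_coord eq_sym (negbTE l0) /sph_deriv2 /GRing.scale /= !fctE.
move: (sph_deriv _ _ x) (sph_value _ x) (sph_deriv _ _ x) (sph_deriv _ _ x).
by move=> a b c d; field.
Qed.

Lemma partial2_sph_deriv u v l x : stem_pair D u v -> On x -> l != 0 ->
  partial l (partial l (sph_deriv u v)) x = sph_deriv2 u v x -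
    (imnorm2 x)^-1 * x 0 l ^+ 2 *
      (3 * sph_deriv2 u v x + sph_deriv (dx (dx u)) (dx (dx v)) x).
Proof.
move=> sp Ox l0.
apply: (etrans (eq_partial _ On_open Ox (fun y Oy => partial_sph_deriv sp Oy l0))).
have [_ E] := is_deriveM (is_derive_coord l x (delta_mx 0 l)) (sph_deriv2_derive sp Ox l0).
apply: (etrans E); rewrite delta_coord eqxx /GRing.scale /=; ring.
Qed.

Lemma Ck_cont_laplacian k f : Ck k.+2 Om f -> forall x, Om x -> {for x, continuous (laplacian f : quat R -> R)}.
Proof. by move=> cf x Ox; exact: (Ck_cont (Ck_laplacian Om_open cf) Ox). Qed.

(** For a function [s] of [(alpha, beta)] the Laplacian of [s \o axial] is
    [s_aa + s_bb + 2 s_b / beta]; for [s = v / beta] it equals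
    [(v_aa + v_bb) / beta], and [v] is harmonic. Real points are reached by
    continuity of the second derivatives. *)
Lemma sph_deriv_harmonic u v x : stem_pair D u v -> Om x ->
  laplacian (sph_deriv u v) x = 0.
Proof.
move=> sp Ox; have [_ cS] := Ck_sph D_open D_conj 2 sp.
apply: (nonreal_dense D_open (g := fun=> 0) Ox (Ck_cont_laplacian cS Ox)).
  exact: (Ck_cont (Ck_cst 0 Om 0) Ox).
move=> {Ox} y Oy; have r20 : imnorm2 y != 0 by rewrite imnorm2_eq0; case: Oy.
apply: (etrans (sum4 _)).
have E0 : partial 0 (partial 0 (sph_deriv u v)) y = sph_deriv (dx (dx u)) (dx (dx v)) y.
  apply: (etrans (eq_partial _ On_open Oy (fun z Oz => partial0_sph_deriv sp Oz))).
  exact: partial0_sph_deriv (stem' sp) Oy.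
rewrite E0 !partial2_sph_deriv// /imnorm2.
move: r20; rewrite /imnorm2.
move: (sph_deriv2 u v y) (sph_deriv _ _ y) (y 0 1) (y 0 2) (y 0 3) => T S2 a b c r20.
by field.
Qed.

(** As [u] is harmonic, only the term [2 u_b / beta] is left, and [u_b = - v_a]. *)
Lemma laplacian_sph_value u v x : stem_pair D u v -> Om x ->
  laplacian (sph_value u) x = - 2 * partial 0 (sph_deriv u v) x.
Proof.
move=> sp Ox; have [cV cS] := Ck_sph D_open D_conj 2 sp.
apply: (nonreal_dense D_open (g := fun x => - 2 * partial 0 (sph_deriv u v) x) Ox (Ck_cont_laplacian cV Ox)).
  exact: (Ck_cont (CkZ (- 2) Om_open (Ck_partial 0 cS)) Ox).
move=> {Ox} y Oy; have [Oy' ry] := Oy; have r20 : imnorm2 y != 0 by rewrite imnorm2_eq0.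
have Ez z : On z -> Om z by case.
apply: (etrans (sum4 _)).
have E0 : partial 0 (partial 0 (sph_value u)) y = sph_value (dx (dx u)) y.
  apply: (etrans (eq_partial _ On_open Oy (fun z Oz => partial0_sph_value sp (Ez z Oz)))).
  exact: partial0_sph_value (stem' sp) Oy'.
have El l : l != 0 -> partial l (partial l (sph_value u)) y =
    - sph_deriv (dx u) (dx v) y - y 0 l ^+ 2 * sph_deriv2 (dx u) (dx v) y.
  move=> l0.
  have e z : On z -> partial l (sph_value u) z = - (z 0 l * sph_deriv (dx u) (dx v) z).
    by move=> Oz; exact: (partial_sph_value sp (Ez z Oz) l0).
  apply: (etrans (eq_partial _ On_open Oy e)).
  have dS := sph_deriv_derive (delta_mx 0 l) (stem' sp) Oy' ry.
  have [_ E] := is_deriveN (is_deriveM (is_derive_coord l y (delta_mx 0 l)) dS).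
  apply: (etrans E).
  rewrite /sph_deriv2 (dotIm_delta _ l0) !delta_coord eqxx [0 == l]eq_sym (negbTE l0).
  move: (sph_value _ y) (sph_deriv _ _ y) (sph_deriv _ _ y) (imnorm2 y)^-1 => a b c d.
  by rewrite /GRing.scale /=; ring.
rewrite E0 (El 1 isT) (El 2 isT) (El 3 isT) (partial0_sph_deriv sp Oy) /sph_deriv2; move: r20; rewrite /imnorm2.
move: (sph_value _ y) (sph_deriv _ _ y) (y 0 1) (y 0 2) (y 0 3) => V S a b c r20.
by field.
Qed.

End SphericalLaplacians.

(** * Quaternion-valued functions in coordinates *)

Section QuaternionAlgebra.
Context {R : realType}.
Implicit Types (x y J : quat R) (z : cplx R).

(** The product of two basis quaternions is a signed basis quaternion: the
    [m]-th coordinate of a product pairs the [l]-th coordinate of the first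
    factor with the [qidx l m]-th one of the second. *)
Definition qidx (l m : 'I_4) : 'I_4 :=
  inord (nth 0%N (nth [::] [:: [:: 0; 1; 2; 3]; [:: 1; 0; 3; 2];
                               [:: 2; 3; 0; 1]; [:: 3; 2; 1; 0]] l) m)%N.

Definition qsgn (l m : 'I_4) : R :=
  nth 0 (nth [::] [:: [:: 1; 1; 1; 1]; [:: -1; 1; -1; 1];
                      [:: -1; 1; 1; -1]; [:: -1; -1; 1; 1]] l) m.

Lemma inord4E : ((inord 0 = 0 :> 'I_4) * (inord 1 = 1 :> 'I_4)) *
  ((inord 2 = 2 :> 'I_4) * (inord 3 = 3 :> 'I_4)).
Proof. by do !split; apply: val_inj; rewrite /= inordK. Qed.

Lemma qmulE x y m : qmul x y 0 m = \sum_(l < 4) qsgn l m * (x 0 l * y 0 (qidx l m)).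
Proof.
move: m; apply: ord4_ind; rewrite sum4 /qsgn /qidx /= !inord4E mxE /=; ring.
Qed.

Lemma qmulNr x y : qmul x (- y) = - qmul x y.
Proof. by apply: quat_eqP; rewrite !coordE; ring. Qed.

Lemma qmulZr (a : R) x y : qmul x (a *: y) = a *: qmul x y.
Proof. by apply: quat_eqP; rewrite !coordE; ring. Qed.

Lemma qmulr0 x : qmul x 0 = 0.
Proof. by have := qmulZr 0 x 0; rewrite !scale0r. Qed.

Lemma qmulZl (a : R) x y : qmul (a *: x) y = a *: qmul x y.
Proof. by apply: quat_eqP; rewrite !coordE; ring. Qed.

Lemma qmul_conj x y : qmul (qconj x) (qmul x y) = (\sum_(l < 4) x 0 l ^+ 2) *: y.
Proof. by rewrite sum4; apply: quat_eqP; rewrite !coordE; ring. Qed.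

Lemma qmulKV x y : \sum_(l < 4) x 0 l ^+ 2 != 0 -> qmul (qinv x) (qmul x y) = y.
Proof. by move=> x0; rewrite /qinv qmulZl qmul_conj scalerA mulVf// scale1r. Qed.

Lemma qsphereP J : qsphere J <-> J 0 0 = 0 /\ imnorm2 J = 1.
Proof.
split=> [H|[J0 J1]]; last first.
  rewrite /qsphere /=; apply: quat_eqP; rewrite !coordE J0; try ring.
  by rewrite -J1 /imnorm2; ring.
have E l : qmul J J 0 l = (- qone : quat R) 0 l by rewrite (H : qmul J J = _).
have := E 0; have := E 1; have := E 2; have := E 3; rewrite !coordE oppr0.
have [->|J0] := eqVneq (J 0 0) 0.
  by move=> _ _ _ H0; split=> //; rewrite /imnorm2; lra.
have N a : J 0 0 * a + a * J 0 0 = 0 -> a = 0.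
  move=> h; have /eqP : J 0 0 * (2 * a) = 0 by rewrite -h; ring.
  by rewrite mulf_eq0 (negbTE J0)/= mulf_eq0 pnatr_eq0/= => /eqP.
move=> h3 h2 h1 h0.
have a1 : J 0 1 = 0 by apply: N; rewrite -h1; ring.
have a2 : J 0 2 = 0 by apply: N; rewrite -h2; ring.
have a3 : J 0 3 = 0 by apply: N; rewrite -h3; ring.
have := sqr_ge0 (J 0 0); move: h0; rewrite a1 a2 a3 expr2; lra.
Qed.

Lemma qi_sphere : qsphere (qi : quat R).
Proof. by apply/qsphereP; rewrite /imnorm2 !coordE; split => //; ring. Qed.

Lemma qsphereN J : qsphere J -> qsphere (- J).
Proof.
move=> /qsphereP[J0 J1]; apply/qsphereP; rewrite /imnorm2 !coordE J0 oppr0 !sqrrN.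
by split.
Qed.

Lemma qpoint0 z J : qsphere J -> qpoint z J 0 0 = z.1.
Proof. by move=> /qsphereP[J0 _]; rewrite !coordE J0 mulr1 mulr0 addr0. Qed.

Lemma qpoint_im z J l : l != 0 -> qpoint z J 0 l = z.2 * J 0 l.
Proof.
by move: l; apply: ord4_ind => // _; rewrite !coordE mulr0 add0r.
Qed.

Lemma axial_qpoint z J : qsphere J -> axial (qpoint z J) = (z.1, `|z.2|).
Proof.
move=> JS; rewrite /axial qpoint0// /imnorm; congr (_, _).
have /qsphereP[_ J1] := JS.
rewrite (_ : imnorm2 _ = z.2 ^+ 2); first by rewrite sqrtr_sqr.
by rewrite /imnorm2 !qpoint_im// -[RHS]mulr1 -J1 /imnorm2; ring.
Qed.

Lemma axial_decomposition x : exists2 J, qsphere J & x = qpoint (axial x) J.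
Proof.
have [r0|r0] := eqVneq (imnorm x) 0.
  exists qi; first exact: qi_sphere.
  have [x1 x2 x3] := imnorm_eq0_coord r0.
  apply: quat_eqP; [|by rewrite qpoint_im//= r0 mul0r..].
  by rewrite qpoint0//; exact: qi_sphere.
have J : qsphere ((imnorm x)^-1 *: qIm x).
  apply/qsphereP; rewrite /imnorm2 !coordE mulr0; split=> //.
  rewrite !exprMn -!mulrDr -[_ + _ + _]/(imnorm2 x) imnorm2E exprVn mulVf//.
  by rewrite expf_neq0.
exists ((imnorm x)^-1 *: qIm x) => //.
by apply: quat_eqP; rewrite ?qpoint0 ?qpoint_im// !coordE mulVKf.
Qed.

Lemma circularE (D : set (cplx R)) : (forall z, D z -> D (cconj z)) ->
  circular D = [set x | D (axial x)].
Proof.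
move=> Dc; apply/seteqP; split => x /=.
  move=> [z [J [Dz JS ->]]]; rewrite axial_qpoint//.
  have [h|h] := leP 0 z.2; first by rewrite ger0_norm//; case: (z) Dz.
  by rewrite ltr0_norm//; exact: Dc.
by move=> Dx; have [J JS E] := axial_decomposition x; exists (axial x), J.
Qed.

Lemma open_of_circular (D : set (cplx R)) : (forall z, D z -> D (cconj z)) ->
  open (circular D) -> open D.
Proof.
move=> Dc oC.
rewrite (_ : D = (fun z => qpoint z qi) @^-1` circular D).
  apply: open_comp oC => z _.
  by apply: cvgD; apply: cvgZr_tmp; [exact: cvg_fst|exact: cvg_snd].
apply/seteqP; split => z /=; first by exists z, qi; split=> //; exact: qi_sphere.
rewrite circularE//= axial_qpoint; last exact: qi_sphere.
have [h|h] := leP 0 z.2; first by rewrite ger0_norm//; case: (z).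
by rewrite ltr0_norm// => /Dc; rewrite /cconj /= opprK; case: (z).
Qed.

End QuaternionAlgebra.

Section QuaternionValued.
Context {R : realType}.
Implicit Types (U : set (quat R)) (g : quat R -> quat R) (x : quat R).

(** Continuity and differentiability of quaternion-valued functions are reduced to
    their coordinates. *)
Lemma cont_coord {V : normedModType R} (g : V -> quat R) (x : V) :
  (forall m, {for x, continuous (fun y => g y 0 m)}) -> {for x, continuous g}.
Proof.
move=> cg.
have -> : g = fun y => g y 0 0 *: delta_mx 0 0 + g y 0 1 *: delta_mx 0 1 +
    g y 0 2 *: delta_mx 0 2 + g y 0 3 *: delta_mx 0 3.
  by apply/funext => y; rewrite [LHS]row_sum_delta sum4.
have c m : {for x, continuous (fun y => g y 0 m *: (delta_mx 0 m : quat R))}.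
  by apply: cvgZr_tmp; exact: cg.
exact: (cvgD (cvgD (cvgD (c 0) (c 1)) (c 2)) (c 3)).
Qed.

Lemma derive_coord {V : normedModType R} (g : V -> quat R) (x v : V) :
  (forall m, derivable (fun y => g y 0 m) x v) ->
  derivable g x v /\ forall m, 'D_v g x 0 m = 'D_v (fun y => g y 0 m) x.
Proof.
move=> dg; have d : derivable g x v.
  by apply/derivable_mxP => i j; rewrite ord1; exact: dg.
by split=> // m; rewrite derive_mx// mxE.
Qed.

Definition QCk k U g := forall m, Ck k U (component m g).

Lemma QCkW k U g : QCk k.+1 U g -> QCk k U g.
Proof. by move=> cg m; exact: CkW. Qed.

Lemma partial_coord U g l m x : QCk 1 U g -> U x ->
  partial l g x 0 m = partial l (component m g) x.
Proof.
move=> cg Ux.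
have [_ ->] := @derive_coord _ g x (delta_mx 0 l) (fun m => Ck_derivable _ (cg m) Ux).
by [].
Qed.

Lemma QCk_partial k U g l : open U -> QCk k.+1 U g -> QCk k U (partial l g).
Proof.
move=> oU cg m; apply: (Ck_eq oU _ (Ck_partial l (cg m))) => x Ux.
rewrite -(partial_coord l m (U := U)) //.
by move=> m'; exact: Ck_le (cg m').
Qed.

Lemma laplacian_coord U g m x : open U -> QCk 2 U g -> U x ->
  laplacian g x 0 m = laplacian (component m g) x.
Proof.
move=> oU cg Ux; rewrite /laplacian summxE; apply: eq_bigr => l _.
apply: (etrans (partial_coord l m (QCk_partial l oU cg) Ux)).
by apply: (eq_partial _ oU Ux) => y Uy; exact: (partial_coord l m (QCkW cg) Uy).
Qed.

Lemma QCk_laplacian k U g : open U -> QCk k.+2 U g -> QCk k U (laplacian g).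
Proof.
move=> oU cg m; apply: (Ck_eq oU _ (Ck_laplacian oU (cg m))) => x Ux.
have cg2 : QCk 2 U g by move=> m'; exact: Ck_le (cg m').
by rewrite -(laplacian_coord m oU cg2 Ux).
Qed.

Lemma crf_coord U g m x : QCk 1 U g -> U x ->
  crf g x 0 m = \sum_(l < 4) qsgn l m * partial l (component (qidx l m) g) x.
Proof.
move=> cg Ux; transitivity (\sum_(l < 4) qsgn l m * partial l g x 0 (qidx l m)).
  rewrite /crf sum4.
  move: (partial 0 g x) (partial 1 g x) (partial 2 g x) (partial 3 g x) => a b c d.
  move: m; apply: ord4_ind; rewrite /qsgn /qidx /= !inord4E !coordE; ring.
by apply: eq_bigr => l _; rewrite (partial_coord _ _ cg Ux).
Qed.

Lemma Ck_sum k U (I : Type) (s : seq I) (a : I -> R) (G : I -> quat R -> R) :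
  open U -> (forall i, Ck k U (G i)) -> Ck k U (fun x => \sum_(i <- s) a i * G i x).
Proof.
move=> oU cG; elim: s => [|i s IH].
  by apply: (Ck_eq oU _ (Ck_cst k U 0)) => x _; rewrite big_nil.
by apply: (Ck_eq oU _ (CkD oU (CkZ (a i) oU (cG i)) IH)) => x _; rewrite big_cons.
Qed.

Lemma partial_cst l (a : R) : partial l (fun=> a) = fun=> 0.
Proof. by apply/funext => x; exact: derive_cst. Qed.

Lemma laplacian_cst (a : R) x : laplacian (fun=> a) x = 0.
Proof.
rewrite /laplacian big1// => l _; rewrite partial_cst; exact: derive_cst.
Qed.

Lemma laplacian_sum U (I : Type) (s : seq I) (a : I -> R) (G : I -> quat R -> R) x :
  open U -> (forall i, Ck 2 U (G i)) -> U x ->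
  laplacian (fun x => \sum_(i <- s) a i * G i x) x = \sum_(i <- s) a i * laplacian (G i) x.
Proof.
move=> oU cG Ux; elim: s => [|i s IH].
  rewrite big_nil; apply: (etrans (@eq_laplacian _ _ U _ (fun=> 0) _ oU Ux _)).
    by move=> y _; rewrite big_nil.
  exact: laplacian_cst.
rewrite big_cons -IH -(laplacianZ (a i) oU (cG i) Ux).
rewrite -(laplacianD oU (CkZ (a i) oU (cG i)) (Ck_sum s a oU cG) Ux).
by apply: (eq_laplacian oU Ux) => y _; rewrite big_cons.
Qed.

(** Both operators have constant coefficients, so that each term reduces to the
    symmetry of second derivatives. *)
Lemma crf_laplacian U g x : open U -> QCk 3 U g -> U x ->
  crf (laplacian g) x = laplacian (crf g) x.
Proof.
move=> oU cg Ux; apply/rowP => m.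
have cg2 : QCk 2 U g by exact: QCkW.
have cg1 : QCk 1 U g by exact: QCkW.
have E y m' : U y -> crf g y 0 m' =
    \sum_(l < 4) qsgn l m' * partial l (component (qidx l m') g) y.
  exact: crf_coord.
have cC : QCk 2 U (crf g).
  move=> m'; apply: (Ck_eq oU _ (Ck_sum (index_enum 'I_4) (fun l => qsgn l m') oU
    (fun l => Ck_partial l (cg (qidx l m'))))) => y Uy.
  by rewrite /component E.
rewrite (crf_coord m (QCk_laplacian oU cg) Ux) (laplacian_coord m oU cC Ux).
rewrite (@eq_laplacian _ _ U _ (fun y => \sum_(l < 4) qsgn l m * partial l (component (qidx l m) g) y) x oU Ux); last first.
  by move=> y Uy; exact: E.
rewrite (laplacian_sum _ _ oU (fun l => Ck_partial l (cg (qidx l m))) Ux).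
apply: eq_bigr => l _; congr (_ * _).
rewrite (laplacian_partial _ oU (cg _) Ux).
by apply: (eq_partial _ oU Ux) => y Uy; exact: (laplacian_coord _ oU cg2 Uy).
Qed.

End QuaternionValued.

(** * Slice-regular functions *)

Section StemComponents.
Context {R : realType}.
Implicit Types (z : cplx R) (w : cquat R).

(** The pair [(coord1 l, coord2 l)] is the [l]-th complex coordinate of the
    complexified quaternions; both are instances of linear maps, so that
    differentials commute with them. *)
Definition coord1 (l : 'I_4) w : R := w.1 0 l.
Definition coord2 (l : 'I_4) w : R := w.2 0 l.

Fact coord1_linear l : linear (coord1 l).
Proof. by move=> k u v; rewrite /coord1 /= coordD coordZ. Qed.

Fact coord2_linear l : linear (coord2 l).
Proof. by move=> k u v; rewrite /coord2 /= coordD coordZ. Qed.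

HB.instance Definition _ l :=
  GRing.isLinear.Build R (cquat R) R *:%R (coord1 l) (coord1_linear l).
HB.instance Definition _ l :=
  GRing.isLinear.Build R (cquat R) R *:%R (coord2 l) (coord2_linear l).

Lemma coord1_continuous l : continuous (coord1 l).
Proof.
move=> w; apply: (@continuous_comp _ _ _ fst (fun x : quat R => x 0 l)).
  exact: cvg_fst.
exact: coord_cont.
Qed.

Lemma coord2_continuous l : continuous (coord2 l).
Proof.
move=> w; apply: (@continuous_comp _ _ _ snd (fun x : quat R => x 0 l)).
  exact: cvg_snd.
exact: coord_cont.
Qed.

Lemma holomorphic_stem_pair (D : set (cplx R)) (F : cplx R -> cquat R) l :
  stem D F -> holomorphic D F -> stem_pair D (coord1 l \o F) (coord2 l \o F).
Proof.
move=> sF hF; split.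
- move=> z Dz; have [dF cF] := hF z Dz.
  have d1 w : differentiable (coord1 l) w.
    by apply: linear_differentiable; exact: coord1_continuous.
  have d2 w : differentiable (coord2 l) w.
    by apply: linear_differentiable; exact: coord2_continuous.
  have du : differentiable (coord1 l \o F) z by exact: differentiable_comp.
  have dv : differentiable (coord2 l \o F) z by exact: differentiable_comp.
  have Eu v : 'D_v (coord1 l \o F) z = ('d F z v).1 0 l.
    by rewrite deriveE// diff_comp//= diff_lin//; exact: coord1_continuous.
  have Ev v : 'D_v (coord2 l \o F) z = ('d F z v).2 0 l.
    by rewrite deriveE// diff_comp//= diff_lin//; exact: coord2_continuous.
  have Ei : 'd F z (0, 1) = cqmuli ('d F z (1, 0)).
    by rewrite -cF /cmuli /= oppr0.
  by split=> //; rewrite Eu Ev Ei /cqmuli /= ?coordN.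
- by move=> z /sF E; rewrite /= E.
- by move=> z /sF E; rewrite /= E /coord2 /= coordN.
Qed.

End StemComponents.
Section SliceRegular.
Context {R : realType}.
Implicit Types (x y J : quat R) (z : cplx R) (l m i k : 'I_4).

Lemma is_derive_pair {V W1 W2 : normedModType R} (a : V -> W1) (b : V -> W2) (x v : V) la lb :
  is_derive x v a la -> is_derive x v b lb -> is_derive x v (fun t => (a t, b t)) (la, lb).
Proof.
move=> /is_deriveP da /is_deriveP db; apply/is_deriveP => e e0.
have [d1 d10 d1P] := da _ e0; have [d2 d20 d2P] := db _ e0.
exists (Num.min d1 d2); first by rewrite lt_min d10.
move=> h h0; rewrite lt_min => /andP[/(d1P _ h0) h1 /(d2P _ h0) h2].
by rewrite [ltLHS]prod_normE/= gt_max h1.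
Qed.

(** Used with functions that depend on [axial x] only, to compare their derivatives
    at different points of a sphere or in opposite directions. *)
Lemma derive_eq_line {V1 V2 W : normedModType R} (f : V1 -> W) (g : V2 -> W) (x v : V1) (y w : V2) :
  (forall h : R, f (x + h *: v) = g (y + h *: w)) -> 'D_v f x = 'D_w g y.
Proof.
move=> fg; have E : (fun h : R => h^-1 *: (f (h *: v + x) - f x)) =
    (fun h : R => h^-1 *: (g (h *: w + y) - g y)).
  apply/funext => h; rewrite [_ + x]addrC [_ + y]addrC fg.
  by have := fg 0; rewrite !scale0r !addr0 => ->.
exact: (congr1 (fun k : R -> W => lim (k @ 0^')) E).
Qed.

Lemma partial_sum (U : set (quat R)) l (I : Type) (s : seq I) (a : I -> R)
    (G : I -> quat R -> R) x : open U -> (forall j, Ck 1 U (G j)) -> U x ->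
  partial l (fun x => \sum_(j <- s) a j * G j x) x = \sum_(j <- s) a j * partial l (G j) x.
Proof.
move=> oU cG Ux; elim: s => [|i s IH].
  rewrite big_nil; apply: (etrans (@eq_partial _ _ U _ _ (fun=> 0) _ oU Ux _)).
    by move=> y _; rewrite big_nil.
  by rewrite partial_cst.
rewrite big_cons -IH -(partialZ l (a i) (cG i) Ux).
rewrite -(partialD l (CkZ (a i) oU (cG i)) (Ck_sum s a oU cG) Ux).
by apply: (eq_partial _ oU Ux) => y _; rewrite big_cons.
Qed.

Lemma qIm0 x : qIm x 0 0 = 0. Proof. by rewrite mkq0. Qed.

Lemma qIm_coord x l : l != 0 -> qIm x 0 l = x 0 l.
Proof. by move: l; apply: ord4_ind => // _; rewrite mkqE. Qed.

Lemma qIm_eq0 x : (qIm x == 0) = (imnorm x == 0).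
Proof.
apply/eqP/eqP => [E|/imnorm_eq0_coord[h1 h2 h3]].
  have e l : l != 0 -> x 0 l = 0 by move=> l0; rewrite -qIm_coord// E mxE.
  by rewrite /imnorm /imnorm2 !e// expr0n /= !addr0 sqrtr0.
by apply: quat_eqP; rewrite mkqE ?h1 ?h2 ?h3 mxE.
Qed.

Lemma sph_deriv_axial (u v : R * R -> R) x y : axial x = axial y ->
  sph_deriv u v x = sph_deriv u v y.
Proof. by move=> E; have [e1 e2] := E; rewrite /sph_deriv E e1 e2. Qed.

Lemma axial_conj x : axial (qconj x) = axial x.
Proof. by rewrite /axial /imnorm /imnorm2 !coordE !sqrrN. Qed.

(** The signs of the product by a purely imaginary first factor: the term of its
    real coordinate is dropped. *)
Definition isgn l m : R := qsgn l m * (l != 0)%:R.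

Lemma qmul_imE x y m : x 0 0 = 0 ->
  qmul x y 0 m = \sum_(l < 4) isgn l m * (x 0 l * y 0 (qidx l m)).
Proof.
move=> x0; rewrite qmulE; apply: eq_bigr => l _; rewrite /isgn.
by have [->|l0] := eqVneq l 0; rewrite ?x0 ?mulr1// !mul0r !mulr0.
Qed.

(** The algebra behind the Cauchy-Riemann-Fueter operator at a non-real point. [V']
    and [S'] stand for the derivatives in [x0] of the spherical value and of the
    spherical derivative [s], all entering as independent scalars. *)
Lemma crf_identity (a : 'I_4 -> R) m (V' S' s : 'I_4 -> R) :
  a 1 ^+ 2 + a 2 ^+ 2 + a 3 ^+ 2 != 0 ->
  \sum_(l < 4) qsgn l m * ((if l == 0 then V' (qidx l m) else - (a l * S' (qidx l m))) +
    \sum_(i < 4) isgn i (qidx l m) * ((i == l)%:R * s (qidx i (qidx l m)) +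
      a i * (if l == 0 then S' (qidx i (qidx l m)) else
        a l * ((a 1 ^+ 2 + a 2 ^+ 2 + a 3 ^+ 2)^-1 *
          (V' (qidx i (qidx l m)) - s (qidx i (qidx l m))))))) = - 2 * s m.
Proof.
move=> r0; move: m; apply: ord4_ind; rewrite !sum4 /isgn /qsgn /qidx;
  do 2 rewrite /= ?inord4E; rewrite /=; by field.
Qed.

Variables (D : set (cplx R)) (F : cplx R -> cquat R) (f : quat R -> quat R).
Hypothesis D_open : open D.
Hypothesis D_conj : forall z, D z -> D (cconj z).
Hypotheses (sF : stem D F) (hF : holomorphic D F) (iF : induces D F f).

Let Om : set (quat R) := [set x | D (axial x)].
Let Om_open : open Om := @Om_open R D D_open.
Let On : set (quat R) := Om `&` [set x | imnorm x != 0].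
Let On_open : open On := @On_open R D D_open.
Let u l := coord1 l \o F.
Let v l := coord2 l \o F.
Let sp l : stem_pair D (u l) (v l) := holomorphic_stem_pair l sF hF.
Let V l := sph_value (u l).
Let S l := sph_deriv (u l) (v l).

Definition sph_derivq x : quat R := \row_l S l x.

Let Sq := sph_derivq.

Lemma Sq_coord x l : Sq x 0 l = S l x.
Proof. by rewrite mxE. Qed.

Let CV n l : Ck n Om (V l). Proof. by have [] := Ck_sph D_open D_conj n (sp l). Qed.
Let CS n l : Ck n Om (S l). Proof. by have [] := Ck_sph D_open D_conj n (sp l). Qed.

Lemma QCk_Sq n : QCk n Om Sq.
Proof.
move=> l; rewrite (_ : component l Sq = S l); first exact: CS.
by apply/funext => x; exact: Sq_coord.
Qed.

(** At a real point both sides vanish, because [v l] is odd. *)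
Lemma imnorm_S x l : Om x -> imnorm x * S l x = v l (axial x).
Proof.
move=> Ox; rewrite /S /sph_deriv; case: ifPn => [/eqP r0|r0].
  have [_ _ vo] := sp l; have Ox' : D (axial x) := Ox.
  by rewrite /axial r0 in Ox' *; rewrite mul0r (odd_real vo Ox').
by rewrite mulrC divfK.
Qed.

Lemma slice_coord x m : Om x ->
  f x 0 m = V m x + \sum_(l < 4) isgn l m * (x 0 l * S (qidx l m) x).
Proof.
move=> Ox; have [J JS E] := axial_decomposition x.
have /qsphereP[J0 _] := JS.
rewrite [in LHS]E (iF Ox JS) coordD qmul_imE//; congr (_ + _).
have EF k : (F (axial x)).2 0 k = imnorm x * S k x by rewrite imnorm_S.
apply: eq_bigr => l _; rewrite EF.
have [->|l0] := eqVneq l 0; first by rewrite /isgn eqxx !mulr0 !mul0r.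
have -> : x 0 l = imnorm x * J 0 l by rewrite {1}E qpoint_im.
by move: (S _ x) (imnorm x) (J 0 l) (isgn l m) => a b c d; ring.
Qed.

Lemma QCk_slice n : QCk n Om f.
Proof.
move=> m; apply: (Ck_eq (f := fun x => V m x +
    \sum_(l < 4) isgn l m * (x 0 l * S (qidx l m) x)) Om_open).
  by move=> x Ox; rewrite -slice_coord.
apply: (CkD Om_open (CV n m)); apply: (Ck_sum _ _ Om_open) => l.
exact: (CkM Om_open (Ck_coord n l Om_open) (CS n _)).
Qed.

Lemma laplacian_slice_coord x m : Om x -> laplacian (component m f) x =
  - 2 * partial 0 (S m) x + \sum_(l < 4) isgn l m * (2 * partial l (S (qidx l m)) x).
Proof.
move=> Ox; have cM l := CkM Om_open (Ck_coord 2 l Om_open) (CS 2 (qidx l m)).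
apply: (etrans (@eq_laplacian _ _ Om _ (fun x => V m x +
    \sum_(l < 4) isgn l m * (x 0 l * S (qidx l m) x)) x Om_open Ox _)).
  exact: (fun y Oy => slice_coord m Oy).
apply: (etrans (laplacianD Om_open (CV 2 m) (Ck_sum _ _ Om_open cM) Ox)).
congr (_ + _); first exact: (laplacian_sph_value D_open D_conj (sp m) Ox).
apply: (etrans (laplacian_sum _ _ Om_open cM Ox)); apply: eq_bigr => l _.
congr (_ * _); apply: (etrans (laplacian_coordM l Om_open (CS 2 _) Ox)).
rewrite (sph_deriv_harmonic D_open D_conj (sp _) Ox) mulr0; exact: addr0.
Qed.

(** The Laplacian is a combination of first partial derivatives of harmonic
    functions. *)
Lemma laplacian2_slice_coord x m : Om x -> laplacian (laplacian (component m f)) x = 0.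
Proof.
move=> Ox.
have cP l k : Ck 2 Om (partial l (S k)) := Ck_partial l (CS 3 k).
have cZ l : Ck 2 Om (fun x => 2 * partial l (S (qidx l m)) x) := CkZ 2 Om_open (cP _ _).
have lap0 l k : laplacian (partial l (S k)) x = 0.
  apply: (etrans (laplacian_partial l Om_open (CS 3 k) Ox)).
  apply: (etrans (@eq_partial _ _ Om l _ (fun=> 0) x Om_open Ox _)).
    by move=> y Oy; exact: (sph_deriv_harmonic D_open D_conj (sp _) Oy).
  by rewrite partial_cst.
apply: (etrans (eq_laplacian Om_open Ox (fun y Oy => laplacian_slice_coord m Oy))).
apply: (etrans (laplacianD Om_open (CkZ (- 2) Om_open (cP 0 m)) (Ck_sum _ _ Om_open cZ) Ox)).
rewrite (laplacianZ (- 2) Om_open (cP 0 m) Ox) lap0 mulr0 add0r.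
apply: (etrans (laplacian_sum _ _ Om_open cZ Ox)); apply: big1 => l _.
by rewrite (laplacianZ 2 Om_open (cP _ _) Ox) lap0 !mulr0.
Qed.

(** At non-real points this is [crf_identity]; real points are reached by
    continuity. *)
Lemma crf_slice x : Om x -> crf f x = (- 2) *: Sq x.
Proof.
move=> Ox; apply/rowP => m; rewrite coordZ Sq_coord.
have c1 := QCk_slice 1.
rewrite (crf_coord m c1 Ox).
have cP l : Ck 0 Om (partial l (component (qidx l m) f)) := Ck_partial l (c1 _).
apply: (nonreal_dense D_open (f := fun y => \sum_(l < 4) qsgn l m *
   partial l (component (qidx l m) f) y) (g := fun y => - 2 * S m y) Ox).
- exact: (Ck_cont (Ck_sum _ _ Om_open cP) Ox).
- exact: (Ck_cont (CkZ (- 2) Om_open (CS 0 m)) Ox).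
move=> {Ox} y Oy; have [Oy' ry] := Oy; have r20 : imnorm2 y != 0 by rewrite imnorm2_eq0.
pose S' k := sph_deriv ('D_((1, 0) : R * R) (u k)) ('D_((1, 0) : R * R) (v k)) y.
pose V' k := sph_value ('D_((1, 0) : R * R) (u k)) y.
pose T k := (imnorm2 y)^-1 * (V' k - S k y).
have V0 k : partial 0 (V k) y = V' k := partial0_sph_value D_open D_conj (sp k) Oy'.
have Vl l k : l != 0 -> partial l (V k) y = - (y 0 l * S' k) :=
  partial_sph_value D_open D_conj (sp k) Oy'.
have S0 k : partial 0 (S k) y = S' k := partial0_sph_deriv (sp k) Oy.
have Sl l k : l != 0 -> partial l (S k) y = y 0 l * T k := partial_sph_deriv (sp k) Oy.
have pf l k : partial l (component k f) y = partial l (V k) y +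
    \sum_(i < 4) isgn i k * ((i == l)%:R * S (qidx i k) y + y 0 i * partial l (S (qidx i k)) y).
  have cM i := CkM Om_open (Ck_coord 1 i Om_open) (CS 1 (qidx i k)).
  apply: (etrans (@eq_partial _ _ Om l _ (fun x => V k x +
    \sum_(i < 4) isgn i k * (x 0 i * S (qidx i k) x)) y Om_open Oy' _)).
    by move=> t Ot; exact: slice_coord.
  apply: (etrans (partialD l (CV 1 k) (Ck_sum _ _ Om_open cM) Oy')); congr (_ + _).
  apply: (etrans (partial_sum l _ _ Om_open cM Oy')); apply: eq_bigr => i _.
  congr (_ * _); exact: (partial_coordM i l Om_open (CS 1 _) Oy').
rewrite -(crf_identity (a := fun l => y 0 l) m V' S' (fun k => S k y) r20).
apply: eq_bigr => l _; congr (_ * _); apply: (etrans (pf _ _)).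
have [->|l0] := eqVneq l 0.
  by rewrite V0; congr (_ + _); apply: eq_bigr => i _; rewrite S0.
by rewrite (Vl _ _ l0); congr (_ + _); apply: eq_bigr => i _; rewrite (Sl _ _ l0).
Qed.

Lemma Sq_axial x y : axial x = axial y -> Sq x = Sq y.
Proof. by move=> E; apply/rowP => l; rewrite !Sq_coord; exact: sph_deriv_axial. Qed.

Lemma slice_vec x : Om x -> f x = (\row_l V l x) + qmul (qIm x) (Sq x).
Proof.
move=> Ox; apply/rowP => m; rewrite (slice_coord m Ox) coordD mxE; congr (_ + _).
rewrite qmul_imE ?qIm0//; apply: eq_bigr => l _; rewrite Sq_coord /isgn.
have [->|l0] := eqVneq l 0; first by rewrite !mulr0 !mul0r.
by rewrite qIm_coord.
Qed.

Lemma spherical_quotientE x : Om x -> imnorm x != 0 -> spherical_quotient f x = Sq x.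
Proof.
move=> Ox rx; have Oc : Om (qconj x) by rewrite /Om /= axial_conj.
have cV l : V l (qconj x) = V l x by rewrite /V /sph_value axial_conj.
rewrite /spherical_quotient (slice_vec Ox) (slice_vec Oc) (Sq_axial (axial_conj x)).
have -> : \row_l V l (qconj x) = \row_l V l x by apply/rowP => l; rewrite !mxE cV.
have -> : qIm (qconj x) = - qIm x.
  by apply: quat_eqP; rewrite !coordE ?oppr0.
move: (\row_l V l x) (Sq x) => a s.
have -> : a + qmul (qIm x) s - (a + qmul (- qIm x) s) = 2 *: qmul (qIm x) s.
  by rewrite -[- qIm x]scaleN1r qmulZl scaleN1r opprD addrACA subrr add0r opprK scaler_nat mulr2n.
rewrite qmulZr qmulKV; first by rewrite scalerA mulVf ?scale1r// pnatr_eq0.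
by rewrite sum4 !coordE expr0n/= add0r -[_ + _]/(imnorm2 x) imnorm2_eq0.
Qed.

(** At a real point the limit exists and has the expected value because
    [sph_derivq F] is continuous there and agrees with the quotient elsewhere. *)
Lemma spherical_derivativeE x : Om x -> spherical_derivative f x = Sq x.
Proof.
move=> Ox; rewrite /spherical_derivative qIm_eq0; case: ifPn => [_|rx]; last first.
  exact: spherical_quotientE.
have PF : ProperFilter (within [set y : quat R | qIm y != 0] (nbhs x)).
  apply: Build_ProperFilter_ex => A; rewrite /within /= => /nbhs_normP[d /= d0 dP].
  have [y yx ry] := nonreal_near x d0; exists y; apply: dP.
    by rewrite /ball_/= distrC.
  by rewrite /= qIm_eq0.
apply: cvg_lim; first exact: norm_hausdorff.
have cS : {for x, continuous Sq}.
  by apply: cont_coord => l; apply: (Ck_cont (QCk_Sq 0 l) Ox).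
apply: (@cvg_trans _ (Sq @ within [set y : quat R | qIm y != 0] (nbhs x))); last first.
  by apply: cvg_trans cS; apply: cvg_app; exact: cvg_within.
apply: near_eq_cvg; rewrite near_withinE.
apply: filterS (open_nbhs_nbhs (conj Om_open Ox)) => y Oy; rewrite /= qIm_eq0 => ry.
by rewrite spherical_quotientE.
Qed.

Lemma partial0_S_qpoint z J k : qsphere J ->
  partial 0 (S k) (qpoint z J) = partial 0 (S k) (qpoint z qi).
Proof.
move=> JS; apply: derive_eq_line => h; apply: sph_deriv_axial.
have E I : qsphere I -> qpoint z I + h *: delta_mx 0 0 = qpoint (z.1 + h, z.2) I.
  move=> IS; apply/rowP; apply: ord4_ind; rewrite !coordE !delta_coord /=; ring.
by rewrite !E ?axial_qpoint//; exact: qi_sphere.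
Qed.

(** [S k] is even in the imaginary directions. *)
Lemma partial_S_real l k x : Om x -> imnorm x = 0 -> l != 0 -> partial l (S k) x = 0.
Proof.
move=> Ox r0 l0.
have [_ E1] := derive_scale (- 1) (Ck_derivable (delta_mx 0 l) (CS 1 k) Ox).
have E2 : 'D_(- 1 *: delta_mx 0 l) (S k) x = partial l (S k) x.
  apply: derive_eq_line => h; apply: sph_deriv_axial.
  have [x1 x2 x3] := imnorm_eq0_coord r0.
  rewrite /axial /imnorm /imnorm2 !coordE x1 x2 x3 !delta_coord eq_sym (negbTE l0) mulr0n.
  by congr (_, Num.sqrt _); ring.
move: E1; rewrite E2 mulN1r => /eqP; rewrite -addr_eq0 -mulr2n mulrn_eq0 => /eqP.
exact.
Qed.

Lemma partial_S_qpoint z J l k : D z -> qsphere J -> l != 0 ->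
  partial l (S k) (qpoint z J) = J 0 l * partial 1 (S k) (qpoint z qi).
Proof.
move=> Dz JS l0.
have O I : qsphere I -> Om (qpoint z I).
  by move=> IS; have : circular D (qpoint z I) by [exists z, I]; rewrite circularE.
have Oi := O _ qi_sphere.
have rz I : qsphere I -> imnorm (qpoint z I) = `|z.2|.
  by move=> IS; have := axial_qpoint z IS => -[].
have [z0|z0] := eqVneq z.2 0.
  rewrite !partial_S_real ?mulr0//; try exact: O; try exact: Oi;
    by rewrite rz ?z0 ?normr0//; exact: qi_sphere.
have On_ I : qsphere I -> On (qpoint z I).
  by move=> IS; split; [exact: O|rewrite /= rz// normr_eq0].
apply: (etrans (partial_sph_deriv (sp k) (On_ _ JS) l0)).
apply: (etrans _ (esym (congr1 _ (partial_sph_deriv (sp k) (On_ _ qi_sphere) (isT : (1 : 'I_4) != 0))))).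
rewrite !qpoint_im// /sph_deriv2 /sph_value.
have E : axial (qpoint z J) = axial (qpoint z qi).
  by rewrite !axial_qpoint//; exact: qi_sphere.
rewrite !imnorm2E (sph_deriv_axial _ _ E) E !rz//; last exact: qi_sphere.
by rewrite mkq1 mulr1 [z.2 * _]mulrC mulrA.
Qed.

(** The Laplacian on a whole sphere is determined by two derivatives at its point
    on the line of [qi], and in such a way that it is a slice function. *)
Lemma laplacian_qpoint z J : D z -> qsphere J -> laplacian f (qpoint z J) =
  (- 4) *: (2^-1 *: partial 0 Sq (qpoint z qi) -
            2^-1 *: qmul J (partial 1 Sq (qpoint z qi))).
Proof.
move=> Dz JS; have c1 := QCk_Sq 1.
have O I : qsphere I -> Om (qpoint z I).
  by move=> IS; have : circular D (qpoint z I) by [exists z, I]; rewrite circularE.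
have Oi := O _ qi_sphere; have Oz := O _ JS.
have alg m (P0 P1 : quat R) (s0 : R) (s : 'I_4 -> R) : P0 0 m = s0 ->
    (forall l, l != 0 -> s l = J 0 l * P1 0 (qidx l m)) ->
    - 2 * s0 + \sum_(l < 4) isgn l m * (2 * s l) =
    ((- 4) *: (2^-1 *: P0 - 2^-1 *: qmul J P1)) 0 m.
  move=> <- sE; rewrite !coordE qmul_imE; last by have /qsphereP[] := JS.
  rewrite (_ : \sum_(l < 4) isgn l m * (2 * s l) =
      2 * \sum_(l < 4) isgn l m * (J 0 l * P1 0 (qidx l m))).
    by move: (\sum_(l < 4) _) => b; field.
  rewrite big_distrr /=; apply: eq_bigr => l _.
  have [->|l0] := eqVneq l 0; first by rewrite /isgn mulr0 !mul0r mulr0.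
  by rewrite sE//; ring.
have cS k : component k Sq = S k by apply/funext => x; exact: Sq_coord.
have EP l k : partial l Sq (qpoint z qi) 0 k = partial l (S k) (qpoint z qi).
  by apply: (etrans (partial_coord l k c1 Oi)); rewrite cS.
apply/rowP => m; apply: (etrans (laplacian_coord m Om_open (QCk_slice 2) Oz)).
apply: (etrans (laplacian_slice_coord m Oz)).
apply: (alg m _ _ _ (fun l => partial l (S (qidx l m)) (qpoint z J))).
  exact: (etrans (EP 0 m) (esym (partial0_S_qpoint z m JS))).
move=> l l0; apply: (etrans (partial_S_qpoint (qidx l m) Dz JS l0)).
exact: (congr1 _ (esym (EP 1 (qidx l m)))).
Qed.

Lemma qpoint_line z (h : R) (w : cplx R) J :
  qpoint (z + h *: w) J = qpoint z J + h *: qpoint w J.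
Proof.
by rewrite /qpoint /= scalerDr !scalerA !scalerDl addrACA.
Qed.

Lemma qpoint_cont z J : {for z, continuous (fun z => qpoint z J)}.
Proof. by apply: cvgD; apply: cvgZr_tmp; [exact: cvg_fst|exact: cvg_snd]. Qed.

Lemma Om_qpoint z : D z -> Om (qpoint z qi).
Proof.
move=> Dz; have : circular D (qpoint z qi) by exists z, qi; split=> //; exact: qi_sphere.
by rewrite circularE.
Qed.

Lemma stem_derive (G : cplx R -> cquat R) z (w : cplx R) :
  (forall z, D z -> G z = (Sq (qpoint z qi), 0)) -> D z ->
  is_derive z w G ('D_(qpoint w qi) Sq (qpoint z qi), 0).
Proof.
move=> GE Dz; have Oz := Om_qpoint Dz.
have [dS _] := derive_coord (fun m => Ck_derivable (qpoint w qi) (QCk_Sq 1 m) Oz).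
have {}dS : is_derive z w (fun z => Sq (qpoint z qi)) ('D_(qpoint w qi) Sq (qpoint z qi)).
  have H := (is_deriveP _ _ _ _).1 (derivableP dS).
  apply: (is_deriveP _ _ _ _).2 => e e0; have [d d0 dP] := H e e0.
  exists d; first exact: d0.
  move=> h h0 hd.
  by have := dP h h0 hd; rewrite -qpoint_line.
apply: (near_eq_deriv (f := fun z => (Sq (qpoint z qi), 0)) D_open Dz).
  by move=> t Dt; rewrite GE.
exact: (is_derive_pair dS (is_derive_cst (0 : quat R) z w)).
Qed.

Lemma stem_dzE (G : cplx R -> cquat R) z :
  (forall z, D z -> G z = (Sq (qpoint z qi), 0)) -> D z ->
  stem_dz G z = (2^-1 *: partial 0 Sq (qpoint z qi), - (2^-1 *: partial 1 Sq (qpoint z qi))).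
Proof.
move=> GE Dz; have E w : 'D_w G z = ('D_(qpoint w qi) Sq (qpoint z qi), 0).
  by have [_ ->] := stem_derive w GE Dz.
have e0 : qpoint (1, 0) qi = delta_mx 0 0 :> quat R.
  by apply/rowP; apply: ord4_ind; rewrite !coordE !mxE /=; ring.
have e1 : qpoint (0, 1) qi = delta_mx 0 1 :> quat R.
  by apply/rowP; apply: ord4_ind; rewrite !coordE !mxE /=; ring.
rewrite /stem_dz !E e0 e1 /cqmuli /partial.
by congr pair; rewrite /= ?opprK ?addr0 ?add0r ?scalerN.
Qed.

Lemma stem_C1 : Ck 1 D (fun z => (Sq (qpoint z qi), 0 : quat R)).
Proof.
have cS (g : quat R -> quat R) : QCk 0 Om g -> forall z, D z ->
    {for z, continuous (fun z => (g (qpoint z qi), 0 : quat R))}.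
  move=> cg z Dz; apply: cont_pair; last exact: cvg_cst.
  apply: (@continuous_comp _ _ _ (fun z => qpoint z qi) g); first exact: qpoint_cont.
  by apply: cont_coord => m; exact: (Ck_cont (cg m) (Om_qpoint Dz)).
split; first exact: cS (QCk_Sq 0).
move=> w; split.
  by move=> z Dz; have [] := stem_derive w (fun z _ => erefl) Dz.
split=> [z Dz|//].
apply: (near_eq_cont (f := fun z => ('D_(qpoint w qi) Sq (qpoint z qi), 0)) D_open Dz).
  by move=> t Dt; have [_ ->] := stem_derive w (fun z _ => erefl) Dt.
apply: (cS ('D_(qpoint w qi) Sq) _ z Dz) => m.
apply: (Ck_eq Om_open _ (Ck_derive (qpoint w qi) (QCk_Sq 1 m))) => x Ox.
have [_ E] := derive_coord (fun m => Ck_derivable (qpoint w qi) (QCk_Sq 1 m) Ox).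
exact: (esym (E m)).
Qed.

(** Two opposite points of a sphere determine the stem function, and the spherical
    derivative takes the same value at both. *)
Lemma stem_unique (G : cplx R -> cquat R) :
  induces D G (spherical_derivative f) ->
  forall z, D z -> G z = (Sq (qpoint z qi), 0).
Proof.
move=> iG z Dz; have qS := @qi_sphere R; have qNS := qsphereN qS.
have Oi := Om_qpoint Dz.
have E : axial (qpoint z (- qi)) = axial (qpoint z qi) by rewrite !axial_qpoint.
have Oj : Om (qpoint z (- qi)) by rewrite /Om /= E.
have := iG z _ Dz qS; have := iG z _ Dz qNS.
rewrite !spherical_derivativeE// (Sq_axial E).
case: (G z) => a b /= -> H.
have b0 : b = 0.
  have E' m : (a + qmul (- qi) b) 0 m = (a + qmul qi b) 0 m by rewrite H.
  have := E' 0; have := E' 1; have := E' 2; have := E' 3.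
  rewrite !coordE => h3 h2 h1 h0.
  by apply: quat_eqP; rewrite mxE; lra.
by rewrite b0 qmulr0 addr0.
Qed.

End SliceRegular.
Theorem theorem6p3 (R : realType) (D : set (cplx R)) (f : quat R -> quat R)
  (D_conj : forall z, D z -> D (cconj z))
  (Omega_open : open (circular D))
  (f_regular : slice_regular D f) :
  [/\ (* (a) *)
      harmonic_on (circular D) (spherical_derivative f),
      (* (b) *)
      (forall x, circular D x ->
         [/\ crf (laplacian f) x = laplacian (crf f) x,
             laplacian (crf f) x
               = (- 2) *: laplacian (spherical_derivative f) x
           & (- 2) *: laplacian (spherical_derivative f) x = 0]),
      (forall x, circular D x -> laplacian (laplacian f) x = 0)
      /\ biharmonic_on (circular D) f
    & (* (c) *)
      (exists h, is_slice_derivative D (spherical_derivative f) h)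
      /\ forall h, is_slice_derivative D (spherical_derivative f) h ->
           (forall x, circular D x -> laplacian f x = (- 4) *: h x)
           /\ harmonic_on (circular D) h].
Proof.
have D_open := open_of_circular D_conj Omega_open.
have [F [sF hF iF]] := f_regular.
have cE := circularE D_conj.
pose Om := [set x : quat R | D (axial x)].
have Om_open : open Om by exact: Om_open.
pose Sq := sph_derivq F.
have Ssph x : Om x -> spherical_derivative f x = Sq x.
  exact: (spherical_derivativeE D_open D_conj sF hF iF).
have CS n m : Ck n Om (component m Sq) := QCk_Sq D_open D_conj sF hF n m.
have Cf n m : Ck n Om (component m f) := QCk_slice D_open D_conj sF hF iF n m.
have lapS m x : Om x -> laplacian (component m Sq) x = 0.
  move=> Ox; have E : component m Sq = sph_deriv (coord1 m \o F) (coord2 m \o F).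
    by apply/funext => y; exact: Sq_coord.
  by rewrite E; exact: (sph_deriv_harmonic D_open D_conj (holomorphic_stem_pair m sF hF) Ox).
have lapS0 x : Om x -> laplacian (spherical_derivative f) x = 0.
  move=> Ox; apply: (etrans (eq_laplacian Om_open Ox Ssph)); apply/rowP => m.
  by apply: (etrans (laplacian_coord m Om_open (CS 2%N) Ox)); rewrite lapS// mxE.
have lapC m x : Om x -> laplacian f x 0 m = laplacian (component m f) x.
  by move=> Ox; exact: (laplacian_coord m Om_open (Cf 2%N) Ox).
have lap2 m x : Om x -> laplacian (laplacian (component m f)) x = 0.
  by move=> Ox; exact: (laplacian2_slice_coord D_open D_conj sF hF iF m Ox).
have OmP z J : D z -> qsphere J -> Om (qpoint z J).
  by move=> Dz JS; have : circular D (qpoint z J) by [exists z, J]; rewrite cE.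
have crfS x : Om x -> crf f x = (- 2) *: spherical_derivative f x.
  by move=> Ox; rewrite Ssph//; exact: (crf_slice D_open D_conj sF hF iF Ox).
rewrite cE -/Om; split.
- move=> m; split.
    by apply: (Ck_eq Om_open _ (CS 2%N m)) => x Ox; rewrite /component Ssph.
  move=> x Ox; rewrite -(lapS m x Ox); apply: (eq_laplacian Om_open Ox) => y Oy.
  by rewrite /component Ssph.
- move=> x Ox; split.
  + exact: (crf_laplacian Om_open (Cf 3%N) Ox).
  + rewrite lapS0// scaler0.
    apply: (etrans (eq_laplacian Om_open Ox (fun y Oy => crf_slice D_open D_conj sF hF iF Oy))).
    have C2 : QCk 2 Om (fun y => (- 2) *: Sq y).
      move=> m; apply: (Ck_eq Om_open _ (CkZ (- 2) Om_open (CS 2%N m))) => y Oy.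
      by rewrite /component coordZ.
    apply/rowP => m; apply: (etrans (laplacian_coord m Om_open C2 Ox)).
    apply: (etrans (@eq_laplacian _ _ Om _ (fun y => - 2 * component m Sq y) x Om_open Ox _)).
      by move=> y Oy; rewrite /component coordZ.
    by apply: (etrans (laplacianZ (- 2) Om_open (CS 2%N m) Ox)); rewrite lapS// mulr0 mxE.
  + by rewrite lapS0// scaler0.
- split.
    move=> x Ox; apply/rowP => m; rewrite [RHS]mxE.
    have C2 : QCk 2 Om (laplacian f) by exact: (QCk_laplacian Om_open (Cf 4%N)).
    apply: (etrans (laplacian_coord m Om_open C2 Ox)).
    by apply: (etrans (eq_laplacian Om_open Ox (fun y Oy => lapC m y Oy))); exact: lap2.
  by move=> m; split; [exact: Cf|exact: lap2].
(* The stem function of the spherical derivative has no imath-part. *)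
pose G z : cquat R := (Sq (qpoint z qi), 0).
have key z J (G' : cplx R -> cquat R) : (forall z, D z -> G' z = G z) -> D z -> qsphere J ->
    laplacian f (qpoint z J) = (- 4) *: ((stem_dz G' z).1 + qmul J (stem_dz G' z).2).
  move=> GE Dz JS.
  rewrite (stem_dzE D_open D_conj sF hF GE Dz) /=.
  apply: (etrans (laplacian_qpoint D_open D_conj sF hF iF Dz JS)).
  by rewrite qmulNr qmulZr.
split.
  exists (fun x => (- 4)^-1 *: laplacian f x), G; split.
  - move=> z Dz; rewrite /G /cqconj /= oppr0; congr (_, _); apply: Sq_axial.
    by rewrite !axial_qpoint ?normrN//; exact: qi_sphere.
  - exact: (stem_C1 D_open D_conj sF hF).
  - move=> z J Dz JS; rewrite Ssph; last exact: OmP.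
    rewrite /G /= qmulr0 addr0; apply: Sq_axial.
    by rewrite !axial_qpoint//; exact: qi_sphere.
  - move=> z J Dz JS; rewrite (key z J G)//.
    by rewrite scalerA mulVf ?scale1r// oppr_eq0 pnatr_eq0.
move=> h [G' [_ _ iG ih]].
have GE := stem_unique D_open D_conj sF hF iF iG.
have hE x : Om x -> laplacian f x = (- 4) *: h x.
  move=> Ox; have [J JS E] := axial_decomposition x.
  by rewrite E (key _ J G' GE Ox JS) (ih _ J Ox JS).
have hE' x : Om x -> h x = (- 4)^-1 *: laplacian f x.
  by move=> Ox; rewrite hE// scalerA mulVf ?scale1r// oppr_eq0 pnatr_eq0.
split; first exact: hE.
move=> m.
have C2 : Ck 2 Om (fun y => (- 4)^-1 * laplacian (component m f) y).
  exact: (CkZ _ Om_open (Ck_laplacian Om_open (Cf 4%N m))).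
have hm x : Om x -> (- 4)^-1 * laplacian (component m f) x = component m h x.
  by move=> Ox; rewrite /component hE'// coordZ lapC.
split; first exact: (Ck_eq Om_open hm C2).
move=> x Ox; apply: (etrans (eq_laplacian Om_open Ox (fun y Oy => esym (hm y Oy)))).
apply: (etrans (laplacianZ _ Om_open (Ck_laplacian Om_open (Cf 4%N m)) Ox)).
by rewrite lap2// mulr0.
Qed.
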